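(* There exist a sequence $(a_k)$ of positive real numbers and a minimal interval exchange transformation $T$ on $6$ intervals, with alphabet $\mathcal A=\{A,B,C,D,E,F\}$, initial permutation $\pi$, and Rauzy path equal to an alternating loop path with parameters $(a_k)$ (as defined in the context), with the following properties. Let $M(n)$ be the visitation matrix after $n$ steps of Rauzy induction and $C_\sigma(n)$ its column corresponding to $\sigma\in\mathcal A$. (1) The nested simplices $\Delta_n=M(n)(\Delta)$ (projectivized) converge, as $n\to\infty$, to a nondegenerate line segment in $\Delta$, and the endpoints of this segment are ergodic measures for $T$ (a $T$-invariant probability measure $\mu$ being identified with the vector $(\mu(I_\sigma))_{\sigma\in\mathcal A}\in\Delta$). (2) One endpoint is the common projective limit of the column vectors $C_A(n)$ and $C_B(n)$, and the other endpoint is the common projective limit of the column vectors $C_E(n)$ and $C_F(n)$. (3) Along the sequence of times $n_k$ at which the path completes a loop and returns to $\pi$, the column vectors $C_C(n_k)$ and $C_D(n_k)$ converge projectively to a common point in the interior of the segment, and this limit point is a generic measure for $T$.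
   Context: **Interval exchanges.** An IET $T$ is given by an alphabet $\mathcal A$ of $d$ letters, positive lengths $\lambda=(\lambda_\alpha)_{\alpha\in\mathcal A}$ and a pair of bijections $(\pi_t,\pi_b)$ from $\mathcal A$ to $\{1,\dots,d\}$, written as two rows (top row $\pi_t$, bottom row $\pi_b$). The interval $[0,|\lambda|)$, $|\lambda|=\sum_\alpha\lambda_\alpha$, is cut into consecutive half-open intervals $I_\alpha$ of length $\lambda_\alpha$ in the order of the top row, and these are rearranged by translations into the order of the bottom row. $T$ is minimal if every orbit is dense. **Rauzy induction.** Let $\alpha,\beta$ be the last letters of the top and bottom rows, and suppose $\lambda_\alpha\ne\lambda_\beta$. If $\lambda_\alpha>\lambda_\beta$, then $\alpha$ wins (beats $\beta$) and $\beta$ loses: the top row is unchanged, in the bottom row $\beta$ is moved to the position immediately to the right of $\alpha$, and the new lengths are $\lambda'_\alpha=\lambda_\alpha-\lambda_\beta$, $\lambda'_\gamma=\lambda_\gamma$ for $\gamma\neq\alpha$. If $\lambda_\beta>\lambda_\alpha$, then $\beta$ wins (beats $\alpha$) and $\alpha$ loses: the bottom row is unchanged, in the top row $\alpha$ is moved to the position immediately to the right of $\beta$, and $\lambda'_\beta=\lambda_\beta-\lambda_\alpha$, $\lambda'_\gamma=\lambda_\gamma$ for $\gamma\ne\beta$. The new IET is the first return map of the old one to the interval with the same left endpoint obtained by cutting off a subinterval at the right end of length equal to that of the loser. The matrix of one step with winner $w$ and loser $l$ is the identity matrix with its $w$ column added to its $l$ column, i.e. $e_l\mapsto e_l+e_w$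 and $e_\gamma\mapsto e_\gamma$ for $\gamma\ne l$. $M(n)$ is the product, in order from left to right, of the matrices of the first $n$ steps of Rauzy induction applied to $T$ (so at each step the column of the winner is added to the column of the loser). $C_\sigma(n)$ is the column of $M(n)$ for the letter $\sigma$, and $|\cdot|$ is the $\ell^1$ norm. $\Delta$ is the standard simplex in $\mathbb R^6$, and $M(n)$ acts on $\Delta$ projectively. The Rauzy path of $T$ is the sequence of (winner, loser) pairs. **Alternating loop path.** Let $\pi=\begin{pmatrix} A & B & C & D & E & F \\ F & E & D & C & B & A \end{pmatrix}$ and let $(a_k)$ be positive reals. An alternating loop path with parameters $(a_k)$ consists of a finite initial path of Rauzy induction from $\pi$ to $\pi$, of length $n_{k_0}$ for some even $k_0\ge 2$, followed by loops numbered $k=k_0,k_0+1,\dots$, each starting and ending at $\pi$. Loop $k$ begins at time $n_k$; it is a right loop if $k$ is even and a left loop if $k$ is odd. At the start of each right loop the columns satisfy $\min\{|C_A(n_k)|,|C_B(n_k)|\}>a_k\max\{|C_E(n_k)|,|C_F(n_k)|\}$ and $\min\{|C_E(n_k)|,|C_F(n_k)|\}>\frac{a_{k-1}}{k^2}\max\{|C_C(n_k)|,|C_D(n_k)|\}$; at the start of each left loop the same inequalities hold with $\{A,B\}$ and $\{E,F\}$ interchanged. *Right loop.* $F$ beats $A$; $F$ beats $B$; $C$ beats $F$; $C$ beats $E$; then $D$ beats $C$ for $r_k$ consecutive steps, where $r_k$ is the smallest odd positive integer with $|C_C(n_k+4+r_k)|>k\,|C_F(n_k+4+r_k)|$; then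 $C$ beats $D$; $F$ beats $C$; $F$ beats $D$; then $E$ beats $F$ for $s_k$ consecutive steps, until the first time that $|C_F(n_k+r_k+s_k+7)|>a_{k+1}\max\{|C_A(n_k+r_k+s_k+7)|,|C_B(n_k+r_k+s_k+7)|\}$; then $F$ beats $E$, returning to $\pi$. *Left loop.* $A$ beats $F$; $A$ beats $E$; $D$ beats $A$; $D$ beats $B$; then $C$ beats $D$ for $r_k$ consecutive steps, where $r_k$ is the smallest odd positive integer with $|C_D(n_k+4+r_k)|>k\,|C_A(n_k+4+r_k)|$; then $D$ beats $C$; $A$ beats $D$; $A$ beats $C$; then $B$ beats $A$ for $s_k$ consecutive steps, until the first time that $|C_A(n_k+r_k+s_k+7)|>a_{k+1}\max\{|C_E(n_k+r_k+s_k+7)|,|C_F(n_k+r_k+s_k+7)|\}$; then $A$ beats $B$, returning to $\pi$. In both cases $n_{k+1}=n_k+r_k+s_k+8$. **Generic measures.** A point $x$ is generic for a $T$-invariant Borel probability measure $\mu$ if $\frac1N\sum_{i=0}^{N-1}f(T^ix)\to\int f\,d\mu$ for every continuous compactly supported $f$; $\mu$ is generic if it has a generic point. *)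

(* Defs.v *)
From HB Require Import structures.
From mathcomp Require Import all_boot all_order all_algebra.
From mathcomp Require Import all_classical all_reals all_analysis.

Set Implicit Arguments.
Unset Strict Implicit.
Unset Printing Implicit Defensive.

Import Order.TTheory GRing.Theory Num.Theory.
Import numFieldNormedType.Exports.
Local Open Scope classical_set_scope.
Local Open Scope ring_scope.

(* The alphabet is 'I_d.  A bijection from the alphabet to {1, ..., d} is
   written as the row listing the letters in increasing position;
   a pair is (top row, bottom row). *)
Definition rows (d : nat) := (seq 'I_d * seq 'I_d)%type.

Record iet (R : realType) (d : nat) := Iet {
  iet_rows : rows d;
  iet_len : 'I_d -> R;
  iet_topP : perm_eq iet_rows.1 (enum 'I_d);
  iet_botP : perm_eq iet_rows.2 (enum 'I_d);
  iet_len_gt0 : forall x, 0 < iet_len x }.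

Definition iet_dom (R : realType) (d : nat) (T : iet R d) : set R :=
  [set` `[0, \sum_x iet_len T x[].

(* Left endpoint of the interval of the letter x when the intervals are laid
   out from 0 in the order of the row s. *)
Definition left_end (R : realType) (d : nat) (T : iet R d) (s : seq 'I_d)
    (x : 'I_d) : R :=
  \sum_(y <- take (index x s) s) iet_len T y.

Definition iet_itv (R : realType) (d : nat) (T : iet R d) (x : 'I_d) :
    interval R :=
  `[left_end T (iet_rows T).1 x, left_end T (iet_rows T).1 x + iet_len T x[.

(* Extended by the identity outside the domain. *)
Definition iet_map (R : realType) (d : nat) (T : iet R d) (z : R) : R :=
  if [pick x | z \in iet_itv T x] is Some x
  then z - left_end T (iet_rows T).1 x + left_end T (iet_rows T).2 x
  else z.

Definition minimal (R : realType) (d : nat) (T : iet R d) : Prop :=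
  forall z, iet_dom T z ->
    iet_dom T `<=` closure [set iter i (iet_map T) z | i in [set: nat]].

(* s with y inserted immediately to the right of x. *)
Definition insert_after (d : nat) (x y : 'I_d) (s : seq 'I_d) : seq 'I_d :=
  take (index x s).+1 s ++ y :: drop (index x s).+1 s.

(* Edges of the Rauzy diagram, labelled by (winner, loser). *)
Inductive rauzy_move (d : nat) : rows d -> 'I_d * 'I_d -> rows d -> Prop :=
| top_wins (t b : seq 'I_d) (x y : 'I_d) : x != y ->
    rauzy_move (rcons t x, rcons b y) (x, y) (rcons t x, insert_after x y b)
| bottom_wins (t b : seq 'I_d) (x y : 'I_d) : x != y ->
    rauzy_move (rcons t x, rcons b y) (y, x) (insert_after y x t, rcons b y).

Definition rauzy_step (R : realType) (d : nat) (T : iet R d)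
    (e : 'I_d * 'I_d) (T' : iet R d) : Prop :=
  [/\ rauzy_move (iet_rows T) e (iet_rows T'),
      iet_len T e.2 < iet_len T e.1 &
      forall x, iet_len T' x =
        if x == e.1 then iet_len T e.1 - iet_len T e.2 else iet_len T x].

(* Rauzy induction can be iterated forever from T, and p n is the
   (winner, loser) pair of step n, steps being numbered from 0. *)
Definition rauzy_path (R : realType) (d : nat) (T : iet R d)
    (p : nat -> 'I_d * 'I_d) : Prop :=
  exists S : nat -> iet R d,
    S 0%N = T /\ forall n, rauzy_step (S n) (p n) (S n.+1).

(* Right multiplication by this matrix adds the column of the winner e.1 to the
   column of the loser e.2. *)
Definition step_mx (R : realType) (d : nat) (e : 'I_d * 'I_d) : 'M[R]_d :=
  1%:M + delta_mx e.1 e.2.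

Fixpoint visit_mx (R : realType) (d : nat) (p : nat -> 'I_d * 'I_d)
    (n : nat) : 'M[R]_d :=
  if n is m.+1 then visit_mx R p m *m step_mx R (p m) else 1%:M.

Definition visit_col (R : realType) (d : nat) (p : nat -> 'I_d * 'I_d)
    (x : 'I_d) (n : nat) : 'cV[R]_d := col x (visit_mx R p n).

Definition l1norm (R : realType) (d : nat) (v : 'cV[R]_d) : R :=
  \sum_i `|v i ord0|.

Definition projectivize (R : realType) (d : nat) (v : 'cV[R]_d) : 'cV[R]_d :=
  (l1norm v)^-1 *: v.

Definition simplex (R : realType) (d : nat) : set 'cV[R]_d :=
  [set v | (forall i, 0 <= v i ord0) /\ \sum_i v i ord0 = 1].

Definition visit_simplex (R : realType) (d : nat) (p : nat -> 'I_d * 'I_d)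
    (n : nat) : set 'cV[R]_d :=
  [set projectivize (visit_mx R p n *m v) | v in @simplex R d].
Arguments visit_simplex R {d} p n _.

Definition segment (R : realType) (d : nat) (u v : 'cV[R]_d) : set 'cV[R]_d :=
  [set (1 - t) *: u + t *: v | t in [set` `[0, 1]]].

Definition open_segment (R : realType) (d : nat) (u v : 'cV[R]_d) :
    set 'cV[R]_d :=
  [set (1 - t) *: u + t *: v | t in [set` `]0, 1[]].

(* Convergence in the Hausdorff metric (of the sup norm). *)
Definition hausdorff_cvg (R : realType) (d : nat) (K : nat -> set 'cV[R]_d)
    (L : set 'cV[R]_d) : Prop :=
  forall e : R, 0 < e -> \forall n \near \oo,
    (forall v, K n v -> exists2 w, L w & ball w e v) /\
    (forall w, L w -> exists2 v, K n v & ball v e w).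

Definition lA : 'I_6 := @Ordinal 6 0 isT.
Definition lB : 'I_6 := @Ordinal 6 1 isT.
Definition lC : 'I_6 := @Ordinal 6 2 isT.
Definition lD : 'I_6 := @Ordinal 6 3 isT.
Definition lE : 'I_6 := @Ordinal 6 4 isT.
Definition lF : 'I_6 := @Ordinal 6 5 isT.

Definition perm_pi : rows 6 :=
  ([:: lA; lB; lC; lD; lE; lF], [:: lF; lE; lD; lC; lB; lA]).

(* Loop k of the path p, begun at time n, with r and s repetitions.  With
   (A, B, C, D, E, F) the actual letters this is a right loop; a left loop is
   the same thing after exchanging A <-> F, B <-> E, C <-> D. *)
Definition is_loop (R : realType) (A B C D E F : 'I_6) (a : nat -> R)
    (p : nat -> 'I_6 * 'I_6) (k n r s : nat) : Prop :=
  let c (x : 'I_6) (m : nat) : R := l1norm (visit_col R p x m) in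
  let r_stop (j : nat) :=
    k%:R * c F (n + 4 + j)%N < c C (n + 4 + j)%N in
  let s_stop (j : nat) :=
    a k.+1 * Num.max (c A (n + r + j + 7)%N) (c B (n + r + j + 7)%N)
      < c F (n + r + j + 7)%N in
  [/\ a k * Num.max (c E n) (c F n) < Num.min (c A n) (c B n) /\
      a k.-1 / k%:R ^+ 2 * Num.max (c C n) (c D n) < Num.min (c E n) (c F n),
      mkseq (fun i => p (n + i)%N) (r + s + 8) =
        [:: (F, A); (F, B); (C, F); (C, E)] ++ nseq r (D, C) ++
        [:: (C, D); (F, C); (F, D)] ++ nseq s (E, F) ++ [:: (F, E)],
      [/\ odd r, r_stop r & forall j, odd j -> (j < r)%N -> ~~ r_stop j] &
      [/\ (0 < s)%N, s_stop s & forall j, (j < s)%N -> ~~ s_stop j]].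

Definition right_loop (R : realType) := @is_loop R lA lB lC lD lE lF.
Definition left_loop (R : realType) := @is_loop R lF lE lD lC lB lA.

(* n k is the time n_k at which loop k begins; its values for k < k0 are
   irrelevant. *)
Definition alternating_loop_path (R : realType) (a : nat -> R)
    (p : nat -> 'I_6 * 'I_6) (n : nat -> nat) : Prop :=
  exists (k0 : nat) (r s : nat -> nat) (rho : nat -> rows 6),
  [/\ (2 <= k0)%N /\ ~~ odd k0,
      rho 0%N = perm_pi /\ (forall m, rauzy_move (rho m) (p m) (rho m.+1)),
      (forall k, (k0 <= k)%N -> rho (n k) = perm_pi),
      (forall k, (k0 <= k)%N -> n k.+1 = (n k + r k + s k + 8)%N) &
      forall k, (k0 <= k)%N ->
        if odd k then left_loop a p k (n k) (r k) (s k)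
        else right_loop a p k (n k) (r k) (s k)].

(* A Borel probability measure on the domain of T is a Borel probability
   measure on R giving full mass to the domain. *)
Definition invariant (R : realType) (d : nat) (T : iet R d)
    (mu : probability (measurableTypeR R) R) : Prop :=
  mu (iet_dom T) = 1%E /\
  forall X : set (measurableTypeR R), measurable X ->
    mu (iet_map T @^-1` X) = mu X.

Definition ergodic (R : realType) (d : nat) (T : iet R d)
    (mu : probability (measurableTypeR R) R) : Prop :=
  invariant T mu /\
  forall X : set (measurableTypeR R), measurable X ->
    iet_map T @^-1` X = X -> mu X = 0%E \/ mu X = 1%E.

(* The vector (mu(I_x))_x with which mu is identified. *)
Definition measure_vec (R : realType) (d : nat) (T : iet R d)
    (mu : probability (measurableTypeR R) R) : 'cV[R]_d :=
  \col_x fine (mu [set` iet_itv T x]).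

(* Test functions are continuous functions on the domain [0, |lambda|) whose
   support is a compact subset of it. *)
Definition generic_point (R : realType) (d : nat) (T : iet R d)
    (mu : probability (measurableTypeR R) R) (z : R) : Prop :=
  forall f : R -> R,
    {within iet_dom T, continuous f} ->
    (exists K : set R, [/\ compact K, K `<=` iet_dom T &
       forall x, iet_dom T x -> ~ K x -> f x = 0]) ->
    (fun N : nat => N%:R^-1 * \sum_(i < N) f (iter i (iet_map T) z)) @ \oo
      --> \int[mu]_(x in iet_dom T) f x.

Definition generic (R : realType) (d : nat) (T : iet R d)
    (mu : probability (measurableTypeR R) R) : Prop :=
  invariant T mu /\ exists2 z, iet_dom T z & generic_point T mu z.

Definition ergodic_vec (R : realType) (d : nat) (T : iet R d)
    (v : 'cV[R]_d) : Prop :=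
  exists2 mu : probability (measurableTypeR R) R,
    measure_vec T mu = v & ergodic T mu.

Definition generic_vec (R : realType) (d : nat) (T : iet R d)
    (v : 'cV[R]_d) : Prop :=
  exists2 mu : probability (measurableTypeR R) R,
    measure_vec T mu = v & generic T mu.

(* Main.v *)
Require Import Defs.
From HB Require Import structures.
From mathcomp Require Import all_boot all_order all_algebra.
From mathcomp Require Import all_classical all_reals all_analysis.
From mathcomp Require Import measurable_realfun zify ring lra.
Import Order.TTheory GRing.Theory Num.Theory.
Import numFieldNormedType.Exports.
Local Open Scope classical_set_scope.
Local Open Scope ring_scope.

(* A vector v whose formal lengths stay nonnegative along the whole path is the
   length vector of an IET with that path.  Its orbit of 0 has the same
   itinerary and the same order as that of T, so a monotone semiconjugacy onto
   T pushes Lebesgue measure to a T-invariant measure with vector v; conversely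
   an invariant measure is determined by its vector, because the measure of
   [0, T^i 0) is linear in it.  So the invariant measures form the intersection
   of the visitation simplices, and extreme points are ergodic.

   With a_k = 4^(k+6) (k+1)^2, the columns A, B and E, F move by O(4^-k) during
   loop k and so converge, to u and v.  During loop k the columns C and D are
   replaced by mixtures of the old ones with weight k/(k+1) and of the smaller
   pair with weight 1/(k+1); the smaller pair is alternately E, F and A, B, so
   this running average tends to w = (u + v) / 2.  T is taken with lengths w.

   The generic point lies, for every k, in the interval of the letter (D or C)
   repeated r_k times in loop k.  Its orbit up to a large time N consists of
   towers over that letter at levels close to k, all of whose long prefixes have
   letter frequencies within O(1/k) of w.  Frequencies of letters determine
   those of the intervals [0, T^i 0), hence the limits of ergodic averages. *)

Set Implicit Arguments.
Unset Strict Implicit.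
Unset Printing Implicit Defensive.

(** * Interval exchanges and Rauzy steps *)

Section rows.
Variables (R : realType) (d : nat).
Implicit Types (s t b : seq 'I_d) (len : 'I_d -> R).

(** In loop [k] the new [C] consists of [C], a run of [r_k] copies of [D], and the pair [C], [F].
    The rule for [r_k] makes the run [k] times as long as the pair, up to a few copies of [D], while
    [C] and [D] are negligible against [F]. The directions thus satisfy (k+1) w_(k+1) = k w_k +
    phi_k up to a summable error, phi_k being the small direction. The weights 1/(k+1) tend to 0,
    but their sum diverges, so the initial direction is forgotten. The square in a_k pays for this
    growth: the middle columns reach at most (k+1)^2 |F|, and after division the ratio 4^(k+6)
    remains, whose inverses are summable. The obstacle to genericity is that averages are needed at
    all times, while the block [F] inside a middle tower is far from w. Such a block has to be
    outweighed by a run of [D] met before it. This is why the point is placed inside the run of [D]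
    at every level: its orbit completes the run before it meets the [F] of that level. Since T has
    lengths w, the measure with vector w has distribution function x on [0, 1]. *)

Definition lend len s (x : 'I_d) : R := \sum_(y <- take (index x s) s) len y.

Lemma lend_cons len y s x :
  lend len (y :: s) x = if y == x then 0 else len y + lend len s x.
Proof. by rewrite /lend /=; case: eqP => _; rewrite ?big_nil ?big_cons. Qed.

Lemma lend_catl len s1 s2 x : x \in s1 -> lend len (s1 ++ s2) x = lend len s1 x.
Proof.
elim: s1 => //= y s IH; rewrite inE eq_sym !lend_cons.
by case: eqP => //= _ /IH ->.
Qed.

Lemma lend_catr len s1 s2 x : x \notin s1 ->
  lend len (s1 ++ s2) x = \sum_(y <- s1) len y + lend len s2 x.
Proof.
elim: s1 => [|y s IH] /=; first by rewrite big_nil add0r.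
rewrite inE negb_or eq_sym lend_cons big_cons.
by case: eqP => //= _ /IH ->; rewrite addrA.
Qed.

Lemma eq_lend len len' s x : {in s, len =1 len'} -> lend len s x = lend len' s x.
Proof. by move=> h; apply: eq_big_seq => y /mem_take /h. Qed.

Lemma lend_ge0 len s x : (forall y, 0 <= len y) -> 0 <= lend len s x.
Proof. by move=> h; rewrite /lend; apply: sumr_ge0. Qed.

Lemma lend_total len s x : (forall y, 0 <= len y) -> x \in s ->
  lend len s x + len x <= \sum_(y <- s) len y.
Proof.
move=> h; elim: s => //= y s IH; rewrite inE eq_sym lend_cons big_cons.
case: eqP => /= [-> _|_ /IH]; last by rewrite -addrA; exact: lerD.
by rewrite add0r lerDl; apply: sumr_ge0.
Qed.

Lemma lend_cover len s z : uniq s -> 0 <= z < \sum_(y <- s) len y ->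
  exists2 x, x \in s & lend len s x <= z < lend len s x + len x.
Proof.
elim: s z => [|y s IH] z /=; first by rewrite big_nil => _ /andP[]; lra.
rewrite big_cons => /andP[ys us] /andP[z0 z1].
have [zy|zy] := ltP z (len y).
  by exists y; rewrite ?mem_head // lend_cons eqxx add0r z0.
have [|x xs xz] := IH (z - len y) us; first by apply/andP; split; lra.
have yx : y != x by apply: contraNneq ys => ->.
exists x; first by rewrite inE xs orbT.
by rewrite lend_cons (negPf yx); apply/andP; split; case/andP: xz; lra.
Qed.

Lemma lend_inj len s x y z : uniq s -> (forall y, 0 <= len y) ->
  x \in s -> y \in s ->
  lend len s x <= z < lend len s x + len x ->
  lend len s y <= z < lend len s y + len y -> x = y.
Proof.
move=> us h; elim: s us z => //= a s IH /andP[as_ us] z.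
rewrite !inE !lend_cons ![_ == a]eq_sym.
have [<-|ax] := eqVneq a x; have [<-|ay] := eqVneq a y => //= xs ys.
- move=> /andP[_ zx] /andP[zy _]; exfalso; have := @lend_ge0 len s y h; lra.
- move=> /andP[zx _] /andP[_ zy]; exfalso; have := @lend_ge0 len s x h; lra.
- move=> /andP[z1 z2] /andP[z3 z4].
  by apply: (IH us (z - len a)) => //; apply/andP; split; lra.
Qed.

(* The row from which the loser is not moved keeps its left endpoints since the
   winner is its last letter. *)
Lemma lend_fixed_row len t w x : uniq (rcons t w) -> x \in rcons t w ->
  forall len', (forall y, y != w -> len' y = len y) ->
  lend len' (rcons t w) x = lend len (rcons t w) x.
Proof.
rewrite rcons_uniq => /andP[wt ut] xin len' h.
have E : {in t, len' =1 len}.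
  by move=> y yt; apply: h; apply: contraTneq yt => ->.
rewrite -cats1; have [xt|xt] := boolP (x \in t).
  by rewrite !lend_catl //; apply: eq_lend.
rewrite !lend_catr // (eq_big_seq len) //; congr (_ + _).
by move: xin; rewrite mem_rcons inE (negPf xt) orbF => /eqP ->; rewrite !lend_cons eqxx.
Qed.

Lemma lend_last len t w : uniq (rcons t w) ->
  lend len (rcons t w) w = \sum_(y <- rcons t w) len y - len w.
Proof.
rewrite rcons_uniq => /andP[wt ut].
rewrite -cats1 lend_catr // lend_cons eqxx big_cat big_seq1 /=; lra.
Qed.

(** The winner gives up exactly the length of the loser, which is inserted into the gap, so every
    letter but the loser keeps its left endpoint. *)
Lemma lend_moved_row len b w l x : uniq (rcons b l) -> w \in b -> x \in rcons b l ->
  forall len', (forall y, len' y = if y == w then len w - len l else len y) ->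
  lend len' (insert_after w l b) x =
  if x == l then lend len (rcons b l) w + len w - len l
  else lend len (rcons b l) x.
Proof.
rewrite rcons_uniq => /andP[lb ub] wb xin len' h.
rewrite /insert_after; case/splitPr: wb ub lb xin => b1 b2.
rewrite cat_uniq mem_cat /= !inE => /and4P[u1 /norP[wb1 dis] wb2 u2].
rewrite !negb_or => /and3P[lb1 lw lb2] xin.
have -> : index w (b1 ++ w :: b2) = size b1.
  by rewrite index_cat (negPf wb1) /= eqxx addn0.
rewrite -cat1s catA take_size_cat ?size_cat ?addn1 //.
rewrite drop_size_cat ?size_cat ?addn1 //.
rewrite -cats1 -!catA /=.
have E1 : {in b1, len' =1 len}.
  by move=> y yt; rewrite h; case: eqP yt wb1 => // -> ->.
have E2 : {in b2, len' =1 len}.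
  by move=> y yt; rewrite h; case: eqP yt wb2 => // -> ->.
have [xb1|xb1] := boolP (x \in b1).
  have xl : x != l by apply: contraNneq lb1 => <-.
  by rewrite (negPf xl) !lend_catl // (eq_lend _ E1).
rewrite !lend_catr // !(eq_big_seq len E1) !lend_cons.
rewrite !eqxx (h l) (h w) eqxx (negPf lw) [l == x]eq_sym.
have [->|xl] := eqVneq x l; first by rewrite [w == l]eq_sym (negPf lw); lra.
have [//|wx] := eqVneq w x; rewrite (eq_lend _ E2) lend_catl; last first.
  by move: xin; rewrite mem_rcons inE mem_cat inE (negPf xl) (negPf xb1) [x == w]eq_sym (negPf wx).
lra.
Qed.

End rows.

Section step.
Variables (R : realType) (d : nat).
Implicit Types (T : iet R d).

Fact tau_key : unit. Proof. by []. Qed.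
(** Translation applied on the interval of [a]; locked so that it stays an atom. *)
Definition tau := locked_with tau_key (fun T a =>
  left_end T (iet_rows T).2 a - left_end T (iet_rows T).1 a : R).

Lemma tauE T a :
  tau T a = left_end T (iet_rows T).2 a - left_end T (iet_rows T).1 a.
Proof. by rewrite [tau]unlock. Qed.

Definition inI T a (z : R) : bool :=
  left_end T (iet_rows T).1 a <= z < left_end T (iet_rows T).1 a + iet_len T a.

Definition tot T : R := \sum_a iet_len T a.

Lemma mem_top T a : a \in (iet_rows T).1.
Proof. by rewrite (perm_mem (iet_topP T)) mem_enum. Qed.

Lemma mem_bot T a : a \in (iet_rows T).2.
Proof. by rewrite (perm_mem (iet_botP T)) mem_enum. Qed.

Lemma uniq_top T : uniq (iet_rows T).1.
Proof. by rewrite (perm_uniq (iet_topP T)) enum_uniq. Qed.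

Lemma uniq_bot T : uniq (iet_rows T).2.
Proof. by rewrite (perm_uniq (iet_botP T)) enum_uniq. Qed.

Lemma len_ge0 T a : 0 <= iet_len T a.
Proof. exact/ltW/iet_len_gt0. Qed.

Lemma sum_perm T s : perm_eq s (enum 'I_d) -> \sum_(a <- s) iet_len T a = tot T.
Proof. by move=> h; rewrite /tot (perm_big _ h) /= big_enum. Qed.

Lemma sum_top T : \sum_(a <- (iet_rows T).1) iet_len T a = tot T.
Proof. exact/sum_perm/iet_topP. Qed.

Lemma sum_bot T : \sum_(a <- (iet_rows T).2) iet_len T a = tot T.
Proof. exact/sum_perm/iet_botP. Qed.

Lemma left_end_ge0 T s a : 0 <= left_end T s a.
Proof. exact/lend_ge0/len_ge0. Qed.

Lemma top_le_tot T a : left_end T (iet_rows T).1 a + iet_len T a <= tot T.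
Proof. by rewrite -sum_top; apply/lend_total/mem_top/len_ge0. Qed.

Lemma bot_le_tot T a : left_end T (iet_rows T).2 a + iet_len T a <= tot T.
Proof. by rewrite -sum_bot; apply/lend_total/mem_bot/len_ge0. Qed.

Lemma inI_cover T z : 0 <= z < tot T -> exists a, inI T a z.
Proof.
rewrite -sum_top => /(lend_cover (uniq_top T))[a _ az]; by exists a.
Qed.

Lemma inI_inj T a b z : inI T a z -> inI T b z -> a = b.
Proof.
by apply: lend_inj; rewrite ?mem_top ?uniq_top //; apply: len_ge0.
Qed.

Lemma inI_dom T a z : inI T a z -> 0 <= z < tot T.
Proof.
by move=> /andP[z1 z2]; have := top_le_tot T a;
  have := left_end_ge0 T (iet_rows T).1 a => *; apply/andP; split; lra.
Qed.

(** Membership in the image of the interval of [a], written through the translation; [inJE] reads it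
    on the bottom row. *)
Definition inJ T a (z : R) : bool := inI T a (z - tau T a).

Lemma inJE T a z : inJ T a z =
  (left_end T (iet_rows T).2 a <= z < left_end T (iet_rows T).2 a + iet_len T a).
Proof.
by rewrite /inJ /inI tauE; apply/andP/andP => -[h1 h2]; split; lra.
Qed.

Lemma inJ_cover T z : 0 <= z < tot T -> exists a, inJ T a z.
Proof.
rewrite -sum_bot => /(lend_cover (uniq_bot T))[a _ az]; by exists a; rewrite inJE.
Qed.

Lemma inJ_inj T a b z : inJ T a z -> inJ T b z -> a = b.
Proof.
by rewrite !inJE; apply: lend_inj; rewrite ?mem_bot ?uniq_bot //; apply: len_ge0.
Qed.

Lemma inJ_dom T a z : inJ T a z -> 0 <= z < tot T.
Proof.
by rewrite inJE => /andP[z1 z2]; have := bot_le_tot T a;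
  have := left_end_ge0 T (iet_rows T).2 a => *; apply/andP; split; lra.
Qed.

Lemma iet_mapE T a z : inI T a z -> iet_map T z = z + tau T a.
Proof.
move=> az; rewrite /iet_map; case: pickP => [b bz|/(_ a)].
  have -> : b = a by apply: (inI_inj _ az); move: bz; rewrite in_itv.
  by rewrite tauE; lra.
by rewrite in_itv /= -/(inI T a z) az.
Qed.

Lemma iet_map_out T z : ~~ (0 <= z < tot T) -> iet_map T z = z.
Proof.
move=> az; rewrite /iet_map; case: pickP => [b bz|//].
by case/negP: az; apply: (@inI_dom T b); move: bz; rewrite in_itv.
Qed.

Definition top_type T (w : 'I_d) := last w (iet_rows T).1 == w.

(** All that the later step lemmas need: only the loser moves, in the row where the winner is not
    last, and winner and loser end at [tot T] in opposite rows. The rest is linear arithmetic on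
    these equations. *)
Lemma step_rows T e T' : rauzy_step T e T' ->
  let: (w, l) := e in let top := top_type T w in
  let L1 := left_end T (iet_rows T).1 in let L2 := left_end T (iet_rows T).2 in
  [/\ w != l,
   (forall a, left_end T' (iet_rows T').1 a =
     if ~~ top && (a == l) then L1 w + iet_len T w - iet_len T l else L1 a),
   (forall a, left_end T' (iet_rows T').2 a =
     if top && (a == l) then L2 w + iet_len T w - iet_len T l else L2 a) &
   if top then L1 w = tot T - iet_len T w /\ L2 l = tot T - iet_len T l
   else L2 w = tot T - iet_len T w /\ L1 l = tot T - iet_len T l].
Proof.
case: e => w l [] /=; rewrite /top_type.
have := (uniq_top T, uniq_bot T); have := (mem_top T, mem_bot T).
have := (sum_top T, sum_bot T); have := (mem_top T', mem_bot T').
case E: (iet_rows T) => [t0 b0]; case E': (iet_rows T') => [t0' b0'] /=.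
move=> [mt' mb'] [st sb] [mt mb] [ut ub] mv llt hl.
have hl1 y : y != w -> iet_len T' y = iet_len T y by rewrite hl => /negPf ->.
inversion mv; subst; rewrite last_rcons;
  match goal with H : is_true (_ != _) |- _ => move: (H) => ne end.
  rewrite eqxx /=; split=> //.
  - by move=> a; apply: lend_fixed_row.
  - move=> a; apply: lend_moved_row => //.
    by have := mb w; rewrite mem_rcons inE (negPf ne).
  - by split; [rewrite -st; apply: lend_last|rewrite -sb; apply: lend_last].
rewrite eq_sym (negPf ne) /=; split=> //.
- move=> a; apply: lend_moved_row => //.
  by have := mt w; rewrite mem_rcons inE eq_sym (negPf ne).
- by move=> a; apply: lend_fixed_row.
- by split; [rewrite -sb; apply: lend_last|rewrite -st; apply: lend_last].
Qed.

End step.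

Section step_dynamics.
Variables (R : realType) (d : nat) (T T' : iet R d) (w l : 'I_d).
Hypothesis hs : rauzy_step T (w, l) T'.
Let top := top_type T w.

Lemma step_len a : iet_len T' a = if a == w then iet_len T w - iet_len T l else iet_len T a.
Proof. by case: hs => _ _ ->. Qed.

Lemma step_neq : w != l.
Proof. by case: (step_rows hs). Qed.

Lemma step_tot : tot T' = tot T - iet_len T l.
Proof.
rewrite /tot (bigD1 w) //= [in RHS](bigD1 w) //= step_len eqxx.
rewrite (eq_bigr (iet_len T)); first by lra.
by move=> a /negPf aw; rewrite step_len aw.
Qed.

Lemma step_tau a : a != l -> tau T' a = tau T a.
Proof.
move=> /negPf al; case: (step_rows hs) => _ h1 h2 _.
by rewrite !tauE h1 h2 al !andbF.
Qed.

Lemma step_tau_loser : tau T' l = tau T l + tau T w.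
Proof.
case: (step_rows hs) => _ h1 h2; rewrite !tauE h1 h2 -/top !eqxx !andbT.
by case: (boolP top) => _ [] /= *; lra.
Qed.

(** On the new loser interval the first return takes two old steps: through [f], then through
    [g]. *)
Let f := if top then l else w.
Let g := if top then w else l.

Lemma step_inI a x : a != l -> inI T' a x -> inI T a x.
Proof.
move=> /negPf al; case: (step_rows hs) => _ h1 _ _.
rewrite /inI h1 al andbF step_len; case: eqP => // ->.
by have := iet_len_gt0 T l => ? /andP[? ?]; apply/andP; split; lra.
Qed.

Lemma step_inI_loser x : inI T' l x -> inI T f x /\ inI T g (x + tau T f).
Proof.
have [_ ltlw _] := hs.
case: (step_rows hs) => /negPf wl h1 h2; rewrite /inI ?tauE h1 eqxx andbT.
rewrite step_len eq_sym wl /f /g -/top; move: ltlw => /=.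
by case: (boolP top) => _ /= ? [? ?] /andP[? ?]; split; apply/andP; split; lra.
Qed.

Lemma step_inI_other a x : a != w -> a != l -> inI T a x = inI T' a x.
Proof.
move=> /negPf aw /negPf al; case: (step_rows hs) => _ h1 _ _.
by rewrite /inI h1 al andbF step_len aw.
Qed.

Lemma step_loserE x : inI T l x = inI T' l (if top then x else x - tau T w).
Proof.
case: (step_rows hs) => /negPf wl h1 h2; rewrite /inI ?tauE h1 eqxx andbT.
rewrite step_len eq_sym wl -/top.
by case: (boolP top) => _ /= [? ?]; apply/andP/andP => -[? ?]; split; lra.
Qed.

(** The old winner interval is the new one together with a floor of the tower over the loser; this
    is the second floor when the type is top, whence the shift by [tau T l]. *)
Lemma step_winnerE x :
  inI T w x = inI T' w x || inI T' l (if top then x - tau T l else x).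
Proof.
have [_ /= ltlw _] := hs; have l0 := iet_len_gt0 T l.
case: (step_rows hs) => /negPf wl h1 h2; rewrite /inI ?tauE !h1 eqxx wl.
rewrite andbF andbT !step_len eqxx eq_sym wl -/top.
case: (boolP top) => _ /= [? ?]; apply/idP/orP => [/andP[h3 h4]|].
- have [?|?] := ltP x (left_end T (iet_rows T).1 w + (iet_len T w - iet_len T l)).
    by left; apply/andP; split.
  by right; apply/andP; split; lra.
- by case=> /andP[? ?]; apply/andP; split; lra.
- have [?|?] := ltP x (left_end T (iet_rows T).1 w + (iet_len T w - iet_len T l)).
    by left; apply/andP; split.
  by right; apply/andP; split; lra.
- by case=> /andP[? ?]; apply/andP; split; lra.
Qed.

Lemma step_winner_disj x :
  inI T' w x -> inI T' l (if top then x - tau T l else x) -> False.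
Proof.
have [_ /= ltlw _] := hs; have l0 := iet_len_gt0 T l.
case: (step_rows hs) => /negPf wl h1 h2; rewrite /inI ?tauE !h1 eqxx wl.
rewrite andbF andbT !step_len eqxx eq_sym wl -/top.
by case: (boolP top) => _ /= [? ?] /andP[? ?] /andP[? ?]; lra.
Qed.

(** The piece cut off is the second floor of the tower over the loser. *)
Lemma step_cover x : 0 <= x < tot T -> 0 <= x < tot T' \/ inI T' l (x - tau T f).
Proof.
move=> /andP[x0 x1]; rewrite step_tot x0 /=.
have [?|?] := ltP x (tot T - iet_len T l); [by left|right].
case: (step_rows hs) => /negPf wl h1 h2; rewrite /inI ?tauE !h1 eqxx andbT.
rewrite step_len eq_sym wl /f -/top.
by case: (boolP top) => _ /= [? ?]; apply/andP; split; lra.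
Qed.

End step_dynamics.

(** * Itineraries and tower words *)

Section itineraries.
Variables (R : realType) (d : nat).
Implicit Types (T : iet R d) (W : seq 'I_d).

Definition dW T W : R := \sum_(a <- W) tau T a.

Fixpoint itin T x W : Prop :=
  if W is a :: W' then inI T a x /\ itin T (x + tau T a) W' else True.

Lemma dW_cat T W1 W2 : dW T (W1 ++ W2) = dW T W1 + dW T W2.
Proof. by rewrite /dW big_cat. Qed.

Lemma dW_cons T a W : dW T (a :: W) = tau T a + dW T W.
Proof. by rewrite /dW big_cons. Qed.

Lemma dW_nil T : dW T [::] = 0.
Proof. by rewrite /dW big_nil. Qed.

Lemma itin_cat T x W1 W2 :
  itin T x (W1 ++ W2) <-> itin T x W1 /\ itin T (x + dW T W1) W2.
Proof.
elim: W1 x => [|a W1 IH] x /=; first by rewrite dW_nil addr0; split=> // -[].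
have := IH (x + tau T a); rewrite dW_cons addrA => -[h1 h2].
split; first by case=> ax /h1[? ?].
by case=> -[? ?] ?; split=> //; apply: h2.
Qed.

Lemma itin_iter T x W : itin T x W -> iter (size W) (iet_map T) x = x + dW T W.
Proof.
elim: W x => [|a W IH] x /=; first by rewrite dW_nil addr0.
by case=> ax /IH; rewrite -iterS iterSr (iet_mapE ax) dW_cons addrA.
Qed.

Lemma itin_nth T x W i a0 : itin T x W -> (i < size W)%N ->
  inI T (nth a0 W i) (iter i (iet_map T) x).
Proof.
elim: W x i => [|a W IH] x [|i] //= [ax xW]; rewrite ?ltnS // => iW.
by rewrite -iterS iterSr (iet_mapE ax); apply: IH.
Qed.

(* A move [(top, (w, l))] records the type of the step besides the winner [w]
   and the loser [l]. *)
Definition move := (bool * ('I_d * 'I_d))%type.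

(* The new tower over the loser is made of the two old ones, and the type of the
   step decides which one is traversed first. *)
Definition ev (st : 'I_d -> seq 'I_d) (m : move) : 'I_d -> seq 'I_d :=
  let: (top, (w, l)) := m in
  fun x => if x == l then (if top then st l ++ st w else st w ++ st l) else st x.

(** [wrd q n j a] is the itinerary, through the intervals of level [n], of the tower of level
    [n + j] over [a]; its letter counts are the column of [a] in the product of the [j] step
    matrices from step [n] on. *)
Fixpoint wrd (q : nat -> move) n j : 'I_d -> seq 'I_d :=
  if j is j'.+1 then ev (wrd q n j') (q (n + j')%N) else fun a => [:: a].

Lemma wrdS (q : nat -> move) n j a : wrd q n j.+1 a =
  let: (top, (w, l)) := q (n + j)%N in
  if a == l then
    (if top then wrd q n j l ++ wrd q n j w else wrd q n j w ++ wrd q n j l)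
  else wrd q n j a.
Proof. by rewrite /=; case: (q (n + j)%N) => top [w l]. Qed.

(** The new loser tower contains the winner tower once, which restores the length that the winner
    has lost. [L] is abstract so that both lengths of IETs and formal lengths are covered. *)
Lemma weights_wrd (q : nat -> move) (L : nat -> 'I_d -> R) :
  (forall n, (q n).2.1 != (q n).2.2) ->
  (forall n x, L n.+1 x = if x == (q n).2.1 then L n (q n).2.1 - L n (q n).2.2 else L n x) ->
  forall n j b, L n b = \sum_a (count_mem b (wrd q n j a))%:R * L (n + j)%N a.
Proof.
move=> hq hL n j b; elim: j => [|j IH].
  rewrite (bigD1 b) //= eqxx mul1r big1 ?addr0 ?addn0 // => a /negPf ab.
  by rewrite /= ab mul0r.
have := wrdS q n j; rewrite IH addnS; have := hq (n + j)%N; have := hL (n + j)%N.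
move: (L (n + j).+1) (wrd q n j.+1) => L' W; case: (q (n + j)%N) => top [w l] /= hL' wl hW.
rewrite (bigD1 w) //= [in RHS](bigD1 w) //= (bigD1 l) 1?eq_sym //=.
rewrite [in RHS](bigD1 l) 1?eq_sym //= !hW !hL' !eqxx (negPf wl) [l == w]eq_sym (negPf wl).
rewrite [in RHS](eq_bigr (fun a => (count_mem b (wrd q n j a))%:R * L (n + j)%N a)); last first.
  by move=> a /andP[/negPf aw /negPf al]; rewrite hW hL' al aw.
by case: (top); rewrite count_cat natrD; ring.
Qed.

End itineraries.
Arguments wrd {d} q n j _ : simpl nomatch.

Section rauzy_sequence.
Variables (R : realType) (d : nat) (S : nat -> iet R d) (q : nat -> move d).

Definition rauzy_seq := forall n,
  rauzy_step (S n) (q n).2 (S n.+1) /\ top_type (S n) (q n).2.1 = (q n).1.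

Hypothesis hS : rauzy_seq.

Lemma dW_wrd n j a : dW (S n) (wrd q n j a) = tau (S (n + j)%N) a.
Proof.
elim: j a => [|j IH] a; first by rewrite /= addn0 /dW big_seq1.
rewrite wrdS; have [] := hS (n + j)%N; rewrite addnS.
case: (q (n + j)%N) => top [w l] /= hs _.
case: eqP => [->|/eqP al]; last by rewrite (step_tau hs).
by rewrite (step_tau_loser hs); case: top; rewrite dW_cat !IH // addrC.
Qed.

Lemma wrd_itin n j a x : inI (S (n + j)%N) a x -> itin (S n) x (wrd q n j a).
Proof.
elim: j a x => [|j IH] a x; first by rewrite addn0.
rewrite wrdS; have [] := hS (n + j)%N; rewrite addnS.
case E: (q (n + j)%N) => [top [w l]] /= hs ht.
case: eqP => [->|/eqP al]; last by move=> /(step_inI hs al) /IH.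
move/(step_inI_loser hs); rewrite ht.
by case: top {ht E} => -[/IH h1 /IH h2]; rewrite itin_cat dW_wrd.
Qed.

(** When the level increases, a base point either remains in the base or becomes a second floor; in
    the latter case the tower visited first is put in front of the prefix [P]. *)
Lemma tower_cover n y : 0 <= y < tot (S 0%N) -> exists a x P Q,
  [/\ inI (S n) a x, wrd q 0 n a = P ++ Q & y = x + dW (S 0%N) P].
Proof.
elim: n => [|n IH] hy.
  have [a ay] := inI_cover hy.
  by exists a, y, [::], [:: a]; rewrite dW_nil addr0.
have [a [x [P [Q [ax aP ->]]]]] := IH hy.
have [] := hS n; have := wrdS q 0 n; rewrite add0n.
have := dW_wrd 0 n; rewrite add0n => hd.
case E: (q n) => [top [w l]] /= hW hs ht.
have [x'|x'] := step_cover hs (inI_dom ax).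
  have [b bx] := inI_cover x'.
  have [bl|bl] := eqVneq b l.
    subst b; have [xf _] := step_inI_loser hs bx.
    rewrite ht in xf; have ea := inI_inj ax xf.
    exists l, x, P, (Q ++ wrd q 0 n (if top then w else l)); split => //.
    by rewrite hW eqxx catA -aP ea; case: (top).
  exists b, x, P, Q; split => //.
  by rewrite hW (negPf bl) -aP (inI_inj ax (step_inI hs bl bx)).
have [xf xg] := step_inI_loser hs x'; rewrite ht in x' xf xg.
rewrite subrK in xg.
have {ax xg} ea := inI_inj ax xg.
exists l, (x - tau (S n) (if top then l else w)),
  (wrd q 0 n (if top then l else w) ++ P), Q.
split => //; last by rewrite dW_cat hd addrA subrK.
by rewrite hW eqxx -catA -aP ea; case: (top).
Qed.

Lemma len_wrd n j b : iet_len (S n) b =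
  \sum_a (count_mem b (wrd q n j a))%:R * iet_len (S (n + j)%N) a.
Proof.
apply: (weights_wrd (L := fun m => iet_len (S m))) => [m|m x]; have [hs _] := hS m.
  by move: hs; case: (q m).2 => w l; apply: step_neq.
by move: hs; case: (q m).2 => w l /= /step_len ->.
Qed.

End rauzy_sequence.

(** * Density of all orbits *)

Section towers.
Variables (R : realType) (d : nat) (S : nat -> iet R d) (q : nat -> move d).
Hypothesis hS : rauzy_seq S q.

Definition exw n (V : seq 'I_d) := flatten [seq wrd q 0 n a | a <- V].

Lemma exw_cat n V1 V2 : exw n (V1 ++ V2) = exw n V1 ++ exw n V2.
Proof. by rewrite /exw map_cat flatten_cat. Qed.

Lemma exw_cons n a V : exw n (a :: V) = wrd q 0 n a ++ exw n V.
Proof. by []. Qed.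

Lemma dW_exw n V : dW (S 0%N) (exw n V) = dW (S n) V.
Proof.
elim: V => [|a V IH]; first by rewrite !dW_nil.
by rewrite exw_cons dW_cat IH (dW_wrd hS) dW_cons.
Qed.

Lemma exw_itin n V x : itin (S n) x V -> itin (S 0%N) x (exw n V).
Proof.
elim: V x => //= a V IH x [ax /IH h]; rewrite exw_cons itin_cat.
by rewrite (dW_wrd hS); split=> //; apply: (wrd_itin hS).
Qed.

Lemma sum_count_mem (s : seq 'I_d) : (\sum_b count_mem b s)%N = size s.
Proof.
elim: s => [|a s IH] /=; first by rewrite big1.
rewrite big_split /= IH (bigD1 a) //= eqxx big1 ?addn0 // => b /negPf.
by rewrite eq_sym => ->.
Qed.

Lemma tot_wrd n : tot (S 0%N) =
  \sum_a (size (wrd q 0 n a))%:R * iet_len (S n) a.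
Proof.
rewrite /tot (eq_bigr _ (fun b _ => len_wrd hS 0 n b)) exchange_big /=.
apply: eq_bigr => a _; rewrite -mulr_suml -natr_sum.
by rewrite sum_count_mem.
Qed.

Hypothesis hpos : forall n, exists j, forall a b, b \in wrd q n j a.
Hypothesis hgrow : forall N, exists n, forall a, (N <= size (wrd q 0 n a))%N.

Lemma tot_gt0 n (a0 : 'I_d) : 0 < tot (S n).
Proof.
rewrite /tot (bigD1 a0) //=; apply: ltr_pwDl; first exact: iet_len_gt0.
by apply: sumr_ge0 => a _; apply: len_ge0.
Qed.

(** The towers have total area [tot (S 0%N)], so a large height forces a short base. *)
Lemma small_len (e : R) : 0 < e -> exists n, forall a, iet_len (S n) a < e.
Proof.
move=> e0; have [n hn] := hgrow (Num.truncn (tot (S 0%N) / e)).+1.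
exists n => a; rewrite ltNge; apply/negP => h.
have t0 := tot_gt0 0 a.
have h1 : (size (wrd q 0 n a))%:R * iet_len (S n) a <= tot (S 0%N).
  rewrite (tot_wrd n) (bigD1 a) //= lerDl; apply: sumr_ge0 => b _.
  by apply: mulr_ge0 => //; apply: len_ge0.
have h2 : tot (S 0%N) / e < (size (wrd q 0 n a))%:R.
  apply: lt_le_trans (truncnS_gt _) _.
  by rewrite ler_nat.
move: h2; rewrite ltr_pdivrMr // => h2.
suff : (size (wrd q 0 n a))%:R * e <= (size (wrd q 0 n a))%:R * iet_len (S n) a :> R by lra.
by apply: ler_wpM2l.
Qed.

Lemma domE (T : iet R d) z : iet_dom T z <-> 0 <= z < tot T.
Proof. by rewrite /iet_dom /= in_itv. Qed.

(** The orbit of [z] leaves its tower of level [n + j] and enters another one, which visits every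
    base of level [n], in particular that of the tower containing [y]. Rising to the floor of [y]
    leaves an error below the width of this base. *)
Lemma orbit_dense z y : 0 <= z < tot (S 0%N) -> 0 <= y < tot (S 0%N) ->
  forall e, 0 < e -> exists i, `|iter i (iet_map (S 0%N)) z - y| < e.
Proof.
move=> hz hy e e0; have [n hn] := small_len e0; have [j hj] := hpos n.
have [b [y0 [P [Q [by0 bP ->]]]]] := tower_cover hS n hy.
have [c [z0 [P0 [Q0 [cz0 cP ->]]]]] := tower_cover hS (n + j)%N hz.
have /itin_cat[_ /itin_iter hQ] : itin (S 0%N) z0 (P0 ++ Q0).
  by rewrite -cP; apply: (wrd_itin hS).
have [c' hc'] : exists c', inI (S (n + j)%N) c' (z0 + tau (S (n + j)%N) c).
  by apply/inI_cover/(@inJ_dom _ _ _ c); rewrite /inJ addrK.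
have := wrd_itin hS hc'; have := hj c' b.
case/splitPr => V1 V2 /itin_cat[/exw_itin /itin_iter hV1 /= [bz _]].
have /itin_cat[/itin_iter hP _] : itin (S 0%N)
   (z0 + tau (S (n + j)%N) c + dW (S n) V1) (P ++ Q).
  by rewrite -bP; apply: (wrd_itin hS).
exists (size P + (size (exw n V1) + size Q0))%N.
rewrite !iterD hQ -addrA -dW_cat -cP -[dW _ (wrd _ _ _ _)]/(dW (S 0%N) _).
rewrite (dW_wrd hS) add0n hV1 dW_exw hP.
move: bz by0; rewrite /inI; have := hn b => ? /andP[? ?] /andP[? ?].
by rewrite ltr_norml; apply/andP; split; lra.
Qed.

Lemma rauzy_minimal : minimal (S 0%N).
Proof.
move=> z /domE hz y /domE hy B /nbhs_ballP[e /= e0 he].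
have [i hi] := orbit_dense hz hy e0.
exists (iter i (iet_map (S 0%N)) z); split; first by exists i.
by apply: he; rewrite /ball /= distrC.
Qed.

Lemma iet_map_dom (T : iet R d) z : 0 <= z < tot T -> 0 <= iet_map T z < tot T.
Proof.
by move=> /inI_cover[a az]; rewrite (iet_mapE az); apply: (@inJ_dom _ _ _ a);
  rewrite /inJ addrK.
Qed.

Lemma iter_dom (T : iet R d) z i : 0 <= z < tot T -> 0 <= iter i (iet_map T) z < tot T.
Proof. by move=> hz; elim: i => //= i; apply: iet_map_dom. Qed.

Lemma iet_map_inj (T : iet R d) x y :
  0 <= x < tot T -> 0 <= y < tot T -> iet_map T x = iet_map T y -> x = y.
Proof.
move=> /inI_cover[a ax] /inI_cover[b bY]; rewrite (iet_mapE ax) (iet_mapE bY).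
move=> h; suff ab : a = b by move: h; rewrite ab => /addIr.
by apply: (@inJ_inj _ _ T a b (x + tau T a)); rewrite /inJ ?addrK // h addrK.
Qed.

Lemma orbit0_dom (a0 : 'I_d) i : 0 <= iter i (iet_map (S 0%N)) 0 < tot (S 0%N).
Proof. by apply: iter_dom; apply/andP; split; [exact: lexx|exact: tot_gt0]. Qed.

(** A finite orbit stays away from the open interval between 0 and its least positive value, against
    density. *)
Lemma orbit0_aperiodic (a0 : 'I_d) i : (0 < i)%N -> iter i (iet_map (S 0%N)) 0 != 0.
Proof.
move=> i0; apply/eqP => hi; set f := iet_map (S 0%N) in hi *.
have per k : iter k f 0 = iter (k %% i) f 0.
  rewrite {1}(divn_eq k i) addnC iterD; congr iter.
  by elim: (k %/ i)%N => // m IH; rewrite mulSn iterD IH.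
(* [m] is also kept below [tot] so that [m / 2] lies in the domain even when 0 is the only orbit
   point. *)
have [m m0 hm] : exists2 m : R, 0 < m < tot (S 0%N) &
    forall k, (k < i)%N -> iter k f 0 = 0 \/ m <= iter k f 0.
  have t0 := tot_gt0 0 a0.
  elim: (i) => [|k [m /andP[m0 mt] hm]]; first by exists (tot (S 0%N) / 2) => //; lra.
  have /andP[h0 h1] := orbit0_dom a0 k; rewrite -/f in h0 h1.
  have [hk|hk] := eqVneq (iter k f 0) 0.
    exists m; first by rewrite m0.
    by move=> k'; rewrite ltnS leq_eqVlt => /orP[/eqP ->|/hm //]; left.
  have hk0 : 0 < iter k f 0 by rewrite lt0r hk.
  exists (Num.min m (iter k f 0)).
    by rewrite lt_min m0 hk0 gt_min mt.
  move=> k'; rewrite ltnS leq_eqVlt => /orP[/eqP ->|/hm[]]; [|by left|].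
    by right; rewrite ge_min lexx orbT.
  by move=> h; right; rewrite ge_min h.
have z0 : 0 <= (0 : R) < tot (S 0%N) by apply/andP; split; [exact: lexx|exact: tot_gt0].
have y0 : 0 <= m / 2 < tot (S 0%N) by apply/andP; split; lra.
have [|k] := @orbit_dense 0 (m / 2) z0 y0 (m / 2); first lra.
rewrite -/f per ltr_norml => /andP[h1 h2].
by case: (hm (k %% i)%N) => [|h|h]; [rewrite ltn_mod|rewrite h in h1; lra|lra].
Qed.

Lemma orbit0_inj (a0 : 'I_d) i j :
  iter i (iet_map (S 0%N)) 0 = iter j (iet_map (S 0%N)) 0 -> i = j.
Proof.
wlog ij : i j / (i <= j)%N.
  by move=> H; case/orP: (leq_total i j) => /H // h /esym /h.
elim: i j ij => [|i IH] [|j] //.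
  by move=> _ /esym/eqP; rewrite (negPf (@orbit0_aperiodic a0 j.+1 isT)).
move=> ij /= /iet_map_inj h; congr _.+1; apply: IH => //.
by apply: h; apply: orbit0_dom.
Qed.

End towers.

Lemma inI_head (R : realType) (d : nat) (T : iet R d) a :
  ohead (iet_rows T).1 = Some a -> inI T a 0.
Proof.
rewrite /inI /left_end; case: (iet_rows T).1 => //= b s [->].
by rewrite eqxx big_nil add0r lexx iet_len_gt0.
Qed.

Section common_code.
Variables (R : realType) (d : nat) (rho : nat -> rows d) (q : nat -> move d).
Hypothesis hgrow : forall N, exists n, forall a, (N <= size (wrd q 0 n a))%N.

(* All the IETs with the same Rauzy path give the same itinerary to 0, since 0
   lies in the tower over the first letter at every level. *)
Lemma orbit0_code (a0 : 'I_d) : exists code : nat -> 'I_d,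
  forall S : nat -> iet R d, rauzy_seq S q -> (forall n, iet_rows (S n) = rho n) ->
  forall i, inI (S 0%N) (code i) (iter i (iet_map (S 0%N)) 0).
Proof.
have [nn hn] := choice (fun i => hgrow i.+1).
pose hd n := head a0 (rho n).1.
exists (fun i => nth a0 (wrd q 0 (nn i) (hd (nn i))) i) => S hS hrho i.
apply: itin_nth; last exact: hn.
apply: (wrd_itin hS); apply: inI_head.
have := mem_top (S (nn i)) a0; rewrite add0n hrho /hd.
by case: (rho (nn i)).1.
Qed.

End common_code.

(** * Order of the orbit of 0 for different lengths *)

Section order_of_orbits.
Variables (R : realType) (d : nat).
Implicit Types (T : iet R d).

(** The translation as a linear function of an arbitrary vector, so that measure vectors and
    indicators of the intervals can be inserted for the lengths. *)
Definition tauv (r : rows d) (v : 'I_d -> R) a := lend v r.2 a - lend v r.1 a.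

Lemma tau_tauv T a : tau T a = tauv (iet_rows T) (iet_len T) a.
Proof. by rewrite tauE. Qed.

Definition phi T i : R := iter i (iet_map T) 0.

Definition codes T (code : nat -> 'I_d) := forall i, inI T (code i) (phi T i).

Lemma phiS T code i : codes T code -> phi T i.+1 = phi T i + tau T (code i).
Proof. by move=> h; rewrite /phi iterS (iet_mapE (h i)). Qed.

Lemma phiE T code i : codes T code -> phi T i = \sum_(j < i) tau T (code j).
Proof.
move=> h; elim: i => [|i IH]; first by rewrite big_ord0.
by rewrite (phiS _ h) IH big_ord_recr.
Qed.

Lemma inI_code T code a i : codes T code -> inI T a (phi T i) -> code i = a.
Proof. by move=> h; apply: inI_inj. Qed.

(* A change of order along the segment between the two length vectors would
   force a coincidence on the orbit of 0 for some intermediate IET. *)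
Lemma orbit_order T0 T1 code : codes T0 code -> codes T1 code ->
  iet_rows T0 = iet_rows T1 ->
  (forall t, 0 <= t <= 1 -> exists T, [/\ iet_rows T = iet_rows T0,
     (forall a, iet_len T a = (1 - t) * iet_len T0 a + t * iet_len T1 a),
     codes T code & injective (phi T)]) ->
  forall i j, phi T0 i < phi T0 j -> phi T1 i < phi T1 j.
Proof.
move=> h0 h1 hr hT i j ij; rewrite ltNge; apply/negP => ji.
set x := phi T0 j - phi T0 i; set y := phi T1 i - phi T1 j.
have x0 : 0 < x by rewrite /x; lra.
have y0 : 0 <= y by rewrite /y; lra.
have xy : x + y != 0 by rewrite gt_eqF // ltr_wpDr.
(* The difference of the two orbit points is affine in the parameter, equal to [x] at 0 and to [- y]
   at 1; this is its zero. *)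
have [|T [rT lT cT injT]] := hT (x / (x + y)).
  apply/andP; split; first by apply: divr_ge0; lra.
  by rewrite ler_pdivrMr; lra.
set t := x / (x + y) in lT.
have tE a : tau T a = (1 - t) * tau T0 a + t * tau T1 a.
  rewrite !tauE rT -hr.
  have E s : left_end T s a = (1 - t) * left_end T0 s a + t * left_end T1 s a.
    rewrite /left_end !mulr_sumr -big_split.
    by apply: eq_bigr => b _; rewrite lT.
  by rewrite !E; ring.
have pE k : phi T k = (1 - t) * phi T0 k + t * phi T1 k.
  rewrite (phiE _ cT) (phiE _ h0) (phiE _ h1) !mulr_sumr -big_split /=.
  by apply: eq_bigr => l _; rewrite tE.
have : phi T i = phi T j.
  apply/eqP; rewrite -subr_eq0 !pE.
  have -> : (1 - t) * phi T0 i + t * phi T1 i - ((1 - t) * phi T0 j + t * phi T1 j)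
    = t * (x + y) - x by rewrite /x /y; ring.
  by rewrite /t divfK // subrr.
by move/injT => ij'; rewrite ij' ltxx in ij.
Qed.

End order_of_orbits.

Section semiconjugacy.
Variables (R : realType) (d : nat) (T0 T1 : iet R d) (code : nat -> 'I_d).
Hypotheses (c0 : codes T0 code) (c1 : codes T1 code).
Hypothesis mono : forall i j, phi T0 i < phi T0 j -> phi T1 i < phi T1 j.
Hypothesis dense : forall y, 0 <= y < tot T0 -> forall e, 0 < e ->
  exists i, `|phi T0 i - y| < e.

Let A z : set R :=
  [set y | y = tot T1 \/ exists2 i, z < phi T0 i & y = phi T1 i].

(** A monotone extension of the map from [phi T0 i] to [phi T1 i], taken from the orbit points on
    the right; [tot T1] keeps the set nonempty where there are none. *)
Definition semiconj (z : R) : R := inf (A z).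
Local Notation h := semiconj.

Lemma phi_dom (T : iet R d) (code' : nat -> 'I_d) i : codes T code' -> 0 <= phi T i < tot T.
Proof. by move=> hc; apply: inI_dom (hc i). Qed.

Let A_inf z : has_inf (A z).
Proof.
split; first by exists (tot T1); left.
exists 0 => y [->|[i _ ->]]; last by case/andP: (phi_dom i c1).
by case/andP: (phi_dom 0 c1); lra.
Qed.

Lemma semiconj_le z i : z < phi T0 i -> h z <= phi T1 i.
Proof. by move=> zi; apply: ge_inf; [case: (A_inf z)|right; exists i]. Qed.

Lemma semiconj_ge z y : y <= tot T1 ->
  (forall i, z < phi T0 i -> y <= phi T1 i) -> y <= h z.
Proof.
move=> y1 yi; apply: lb_le_inf; first by case: (A_inf z).
by move=> x [->|[i /yi h1 ->]].
Qed.

Lemma semiconj_nd : nondecreasing_fun h.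
Proof.
move=> x y xy; apply: semiconj_ge => [|i yi].
  by apply: ge_inf; [case: (A_inf x)|left].
by apply: semiconj_le; apply: le_lt_trans yi.
Qed.

Lemma phi_between x y : 0 <= x -> x < y -> y <= tot T0 ->
  exists i, x < phi T0 i < y.
Proof.
move=> x0 xy yt; have [||i] := @dense ((x + y) / 2) _ ((y - x) / 2); try lra.
by rewrite ltr_norml => /andP[? ?]; exists i; apply/andP; split; lra.
Qed.

Lemma phi_in a z : inI T0 a z -> exists2 i, z < phi T0 i & inI T0 a (phi T0 i).
Proof.
move=> az; have /andP[z0 z1] := inI_dom az; case/andP: (az) => za1 za2.
have [i /andP[zi iz]] := phi_between z0 za2 (top_le_tot T0 a).
by exists i => //; apply/andP; split; lra.
Qed.

(** An orbit point to the right of [z] in the same interval bounds [h z] from above. No orbit point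
    to the right of [z] is sent to the left of the interval of [a] in [T1]: by the order it would
    precede the former point, hence lie in the interval of [a] in [T0] and be coded by [a]. *)
Lemma semiconj_inI a z : inI T0 a z -> inI T1 a (h z).
Proof.
move=> az; have [i zi ia] := phi_in az; case/andP: (az) => za1 za2.
have := c1 i; rewrite (inI_code c0 ia) => /andP[h1 h2].
apply/andP; split; last by apply: le_lt_trans (semiconj_le zi) h2.
apply: semiconj_ge => [|j zj].
  by have := top_le_tot T1 a; have := len_ge0 T1 a; lra.
rewrite leNgt; apply/negP => ja.
have ji : phi T1 j < phi T1 i by lra.
have : inI T0 a (phi T0 j).
  apply/andP; split; first lra.
  case/andP: ia => _; apply: le_lt_trans.
  by rewrite leNgt; apply/negP => /mono; lra.
by move/(inI_code c0) => cj; have := c1 j; rewrite cj => /andP[]; lra.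
Qed.

Lemma phi_next a i : inI T0 a (phi T0 i) ->
  phi T0 i.+1 = phi T0 i + tau T0 a /\ phi T1 i.+1 = phi T1 i + tau T1 a.
Proof. by move=> /(inI_code c0) <-; rewrite !(phiS _ c0) !(phiS _ c1). Qed.

(** For one inequality the orbit points to the right of [z] are pushed forward, for the other those
    to the right of the image are pulled back; points beyond the interval are handled by the
    order. *)
Lemma semiconj_map a z : inI T0 a z -> h (z + tau T0 a) = h z + tau T1 a.
Proof.
move=> az; have [k zk ka] := phi_in az; have [k0 k1] := phi_next ka.
have /andP[_ kt] := phi_dom k c1; have /andP[_ kt'] := phi_dom k.+1 c1.
have hk : h (z + tau T0 a) <= phi T1 k + tau T1 a.
  by rewrite -k1; apply: semiconj_le; lra.
have hk' := semiconj_le zk.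
apply: le_anti; apply/andP; split.
  rewrite -lerBlDr; apply: semiconj_ge => [|i zi]; first lra.
  have [ir|ir] := ltP (phi T0 i) (left_end T0 (iet_rows T0).1 a + iet_len T0 a).
    have [i0 i1] : phi T0 i.+1 = phi T0 i + tau T0 a /\
        phi T1 i.+1 = phi T1 i + tau T1 a.
      by apply: phi_next; apply/andP; split=> //; case/andP: az; lra.
    rewrite lerBlDr -i1; apply: semiconj_le; lra.
  have /mono : phi T0 k < phi T0 i by case/andP: ka; lra.
  lra.
apply: semiconj_ge => [|i zi]; first by lra.
have hJ : inJ T0 a (phi T0 k.+1) by rewrite /inJ k0 addrK.
have [ir|ir] := ltP (phi T0 i) (left_end T0 (iet_rows T0).2 a + iet_len T0 a).
  have hz : inJ T0 a (z + tau T0 a) by rewrite /inJ addrK.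
  have : inJ T0 a (phi T0 i).
    by rewrite inJE in hz; rewrite inJE; apply/andP; split=> //; case/andP: hz; lra.
  (* The orbit point 0 has no predecessor on the orbit, but it cannot lie to the right of a point of
     the domain. *)
  case: i zi {ir} => [|i] zi hi.
    by have /andP[? _] := inJ_dom hz; rewrite /phi /= in zi; lra.
  have ia : inI T0 a (phi T0 i).
    have hi' : inJ T0 (code i) (phi T0 i.+1) by rewrite /inJ (phiS _ c0) addrK.
    by rewrite (inJ_inj hi hi').
  have [i0 i1] := phi_next ia.
  by have := @semiconj_le z i; rewrite i1; lra.
have /mono : phi T0 k.+1 < phi T0 i by move: hJ; rewrite inJE => /andP[]; lra.
lra.
Qed.

End semiconjugacy.

(** * Invariant measures and their vectors *)

Section shift_invariance.
Variables (R : realType) (d : nat).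
Local Notation mR := (measurableTypeR R).
Implicit Types (T : iet R d) (J X : set mR).

Definition Iset T a : set mR := [set z : R | inI T a z].

Lemma IsetE T a : Iset T a = [set` iet_itv T a].
Proof. by apply/seteqP; split=> z; rewrite /Iset /inI /iet_itv /= in_itv. Qed.

Lemma measurable_Iset T a : measurable (Iset T a).
Proof. by rewrite IsetE; apply: measurable_itv. Qed.

Definition translate (c : R) J : set mR := [set y : R | J (y - c)].

Lemma measurable_translate c J : measurable J -> measurable (translate c J).
Proof.
move=> mJ; have mf : measurable_fun setT (fun y : mR => (y - c : mR)).
  by apply: measurable_funB; [exact: measurable_id|exact: measurable_cst].
by have := mf measurableT _ mJ; rewrite setTI.
Qed.

Lemma translateD c e J : translate c (translate e J) = translate (c + e) J.
Proof. by apply/seteqP; split=> y; rewrite /translate /= opprD addrA. Qed.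

(** Invariance tested only on sets inside one interval. In this form it passes to the induced maps
    and holds for Lebesgue measure on the whole line. *)
Definition shift_inv (mu : set mR -> \bar R) T := forall a J, measurable J ->
  J `<=` Iset T a -> mu (translate (tau T a) J) = mu J.

Variable mu : {measure set mR -> \bar R}.

Section one_step.
Variables (T T' : iet R d) (w l : 'I_d).
Hypothesis hs : rauzy_step T (w, l) T'.

Lemma shift_inv_step : shift_inv mu T -> shift_inv mu T'.
Proof.
move=> hT a J mJ hJ; have [al|al] := eqVneq a l; last first.
  rewrite (step_tau hs al); apply: hT => // x /hJ; exact: (step_inI hs).
subst a; set f := if top_type T w then l else w; set g := if top_type T w then w else l.
have hx x : J x -> inI T f x /\ inI T g (x + tau T f).
  by move=> /hJ; apply: (step_inI_loser hs).
have -> : tau T' l = tau T g + tau T f.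
  by rewrite (step_tau_loser hs) /f /g; case: ifP => // _; rewrite addrC.
rewrite -translateD hT; first by apply: hT => // x /hx[].
  exact: measurable_translate.
by move=> x /hx[_]; rewrite subrK.
Qed.

Lemma step_measure_ne a : shift_inv mu T -> a != w ->
  mu (Iset T a) = mu (Iset T' a).
Proof.
move=> hT aw; have [al|al] := eqVneq a l; last first.
  by congr (mu _); apply/seteqP; split=> x; rewrite /Iset /= (step_inI_other hs).
subst a; case E: (top_type T w).
  by congr (mu _); apply/seteqP; split=> x; rewrite /Iset /= (step_loserE hs) E.
rewrite -(hT w (Iset T' l)); [|exact: measurable_Iset|].
  by congr (mu _); apply/seteqP; split=> x; rewrite /Iset /= (step_loserE hs) E.
by move=> x /(step_inI_loser hs)[]; rewrite E.
Qed.

Lemma step_measure_winner : shift_inv mu T ->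
  mu (Iset T w) = (mu (Iset T' w) + mu (Iset T' l))%E.
Proof.
move=> hT.
have -> : mu (Iset T' l) =
    mu [set x : mR | inI T' l (if top_type T w then x - tau T l else x)].
  case E: (top_type T w) => //.
  rewrite -(hT l (Iset T' l)) //; first exact: measurable_Iset.
  by move=> x /(step_inI_loser hs)[]; rewrite E.
rewrite -measureU //.
- by congr (mu _); apply/seteqP; split=> x; rewrite /Iset /= (step_winnerE hs) => /orP.
- exact: measurable_Iset.
- case E: (top_type T w); last exact: measurable_Iset.
  exact: (measurable_translate (tau T l) (measurable_Iset T' l)).
- by rewrite -subset0 => x [/= h1 h2]; apply: (step_winner_disj hs h1 h2).
Qed.

End one_step.

Hypothesis mufin : (mu setT < +oo)%E.

Lemma fin_mu X : measurable X -> mu X \is a fin_num.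
Proof.
move=> mX; rewrite ge0_fin_numE //; apply: le_lt_trans mufin.
by apply: le_measure; rewrite ?inE //.
Qed.

Definition mvec T a : R := fine (mu (Iset T a)).

Lemma mvec_ge0 T a : 0 <= mvec T a.
Proof. exact: fine_ge0. Qed.

Lemma step_mvec T T' w l a : rauzy_step T (w, l) T' -> shift_inv mu T ->
  mvec T a = mvec T' a + (if a == w then mvec T' l else 0).
Proof.
move=> hs hT; case: eqP => [->|/eqP aw]; last first.
  by rewrite /mvec (step_measure_ne hs) ?addr0.
rewrite /mvec (step_measure_winner hs hT) fineD //; apply: fin_mu;
  exact: measurable_Iset.
Qed.

Lemma measurable_cc (x y : R) : measurable ([set z : R | x <= z < y] : set mR).
Proof.
have -> : [set z : R | x <= z < y] = [set` `[x, y[].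
  by apply/seteqP; split=> z; rewrite /= in_itv.
exact: measurable_itv.
Qed.

Definition G (x : R) : R := fine (mu [set z : R | 0 <= z < x]).

Lemma mu_itv_split (x y z : R) : x <= y -> y <= z ->
  fine (mu [set t : R | x <= t < z]) =
  fine (mu [set t : R | x <= t < y]) + fine (mu [set t : R | y <= t < z]).
Proof.
move=> xy yz; rewrite -fineD; try (by apply: fin_mu; exact (measurable_cc _ _)).
rewrite -measureU; try (exact (measurable_cc _ _)).
- congr (fine (mu _)); apply/seteqP; split=> t /=; last by case; lra.
  by have [ty|ty] := ltP t y; [left|right]; lra.
- by rewrite -subset0 => t [/= ? ?]; lra.
Qed.

Lemma G_lend T s a : uniq s -> a \in s ->
  G (lend (iet_len T) s a) = \sum_(b <- take (index a s) s)
    fine (mu [set z : R | lend (iet_len T) s b <= z < lend (iet_len T) s b + iet_len T b]).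
Proof.
move=> us as_.
have E k : (k <= size s)%N -> G (\sum_(b <- take k s) iet_len T b) =
    \sum_(b <- take k s) fine (mu [set z : R |
      lend (iet_len T) s b <= z < lend (iet_len T) s b + iet_len T b]).
  elim: k => [|k IH] ks.
    rewrite take0 !big_nil /G -[RHS]/(fine 0%E); congr fine.
    rewrite (_ : [set z : R | _] = set0) ?measure0 //.
    by rewrite -subset0 => z /=; lra.
  rewrite (take_nth a ks) -cats1 !big_cat !big_seq1 /= -(IH (ltnW ks)).
  have sk : lend (iet_len T) s (nth a s k) = \sum_(b <- take k s) iet_len T b.
    by rewrite /lend index_uniq.
  rewrite /G (@mu_itv_split 0 (\sum_(b <- take k s) iet_len T b)) ?sk //.
    by apply: sumr_ge0 => b _; apply: len_ge0.
  by rewrite lerDl len_ge0.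
by rewrite /lend E // index_size.
Qed.

(** Cut [0, x) at the left end of the interval of [a]: the last piece is translated without change
    of mass, and the part before it, in either row, is a union of whole intervals. *)
Lemma G_tau T a x : shift_inv mu T -> inI T a x ->
  G (x + tau T a) = G x + tauv (iet_rows T) (mvec T) a.
Proof.
move=> hT ax; case/andP: (ax) => x1 x2.
have hJ b : mvec T b = fine (mu [set z : R | left_end T (iet_rows T).2 b <= z
     < left_end T (iet_rows T).2 b + iet_len T b]).
  rewrite /mvec -(hT b) //; last exact: measurable_Iset.
  by congr (fine (mu _)); apply/seteqP; split=> z; rewrite /translate /Iset /=
    -/(inJ T b z) inJE.
have -> : G x = G (left_end T (iet_rows T).1 a) +
    fine (mu [set z : R | left_end T (iet_rows T).1 a <= z < x]).
  by rewrite /G (@mu_itv_split 0 (left_end T (iet_rows T).1 a)) //; exact: left_end_ge0.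
have -> : G (x + tau T a) = G (left_end T (iet_rows T).2 a) +
    fine (mu [set z : R | left_end T (iet_rows T).2 a <= z < x + tau T a]).
  rewrite /G (@mu_itv_split 0 (left_end T (iet_rows T).2 a)) //.
    exact: left_end_ge0.
  by rewrite tauE; lra.
rewrite [X in _ = _ + X + _](_ : _ = fine (mu [set z : R |
    left_end T (iet_rows T).2 a <= z < x + tau T a])); last first.
  rewrite -(hT a).
  - congr (fine (mu _)); apply/seteqP; split=> z; rewrite /translate /= tauE; lra.
  - exact (measurable_cc _ _).
  - by move=> z /= ?; apply/andP; split; lra.
rewrite !G_lend ?uniq_top ?uniq_bot ?mem_top ?mem_bot // /tauv /lend.
rewrite (eq_bigr (mvec T)); last by move=> b _; rewrite hJ.
rewrite [X in _ = X + _ + _](eq_bigr (mvec T)) //; lra.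
Qed.

Lemma G0 : G 0 = 0.
Proof.
rewrite /G (_ : [set z : R | _] = set0) ?measure0 //.
by rewrite -subset0 => z /=; lra.
Qed.

Lemma G_phi T code i : shift_inv mu T -> codes T code ->
  G (phi T i) = \sum_(j < i) tauv (iet_rows T) (mvec T) (code j).
Proof.
move=> hT hc; elim: i => [|i IH]; first by rewrite big_ord0 G0.
by rewrite (phiS _ hc) (G_tau hT) // IH big_ord_recr.
Qed.

End shift_invariance.

Section invariant_measures.
Variables (R : realType) (d : nat).
Local Notation mR := (measurableTypeR R).
Implicit Types (T : iet R d) (J X : set mR).

Section push.
Variables (m : {measure set mR -> \bar R}) (h : mR -> mR).
Hypothesis mh : measurable_fun setT h.

(** The measurability proof is an argument so that the measure structure can be attached to the
    term; [prob_of] does the same with total mass 1. *)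
Definition push_measure of measurable_fun setT h : set mR -> \bar R :=
  pushforward m h.
Local Notation pm := (push_measure mh).

Let pm0 : pm set0 = 0%E.
Proof. by rewrite /push_measure /pushforward preimage_set0 measure0. Qed.

Let pm_ge0 A : (0 <= pm A)%E.
Proof. exact: measure_ge0. Qed.

Let pm_sigma : semi_sigma_additive pm.
Proof. by apply: (@measure_semi_sigma_additive _ _ _ (pushforward m h)). Qed.

HB.instance Definition _ := isMeasure.Build _ _ _ pm pm0 pm_ge0 pm_sigma.

End push.

Definition prob_of (m : {measure set mR -> \bar R}) (hm : m setT = 1%E) :
  set mR -> \bar R := m.

HB.instance Definition _ m hm := Measure.on (@prob_of m hm).
HB.instance Definition _ m hm := Measure_isProbability.Build _ _ _ (@prob_of m hm) hm.

Lemma lebesgue_translate c J : measurable J ->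
  lebesgue_measure (translate c J) = lebesgue_measure J.
Proof.
move=> mJ.
have mf : measurable_fun setT (fun y : mR => (y - c : mR)).
  by apply: measurable_funB; [exact: measurable_id|exact: measurable_cst].
rewrite -[LHS]/(push_measure lebesgue_measure mf J).
apply/esym/lebesgue_measure_unique => //= _ [[a b]] _ <-.
rewrite /push_measure /pushforward.
have -> : (fun y : R => y - c) @^-1` `]a, b]%classic = `](a + c), (b + c)]%classic.
  by apply/seteqP; split=> y; rewrite /= !in_itv /=; lra.
by rewrite !lebesgue_measure_itv /= !lte_fin ltrD2r; case: ifP => // _;
  rewrite -!EFinB; congr (_%:E); ring.
Qed.

Lemma invariant_shift T (mu : probability mR R) : Defs.invariant T mu -> shift_inv mu T.
Proof.
move=> [_ hmu] a J mJ hJ; rewrite -(hmu _ (measurable_translate (tau T a) mJ)).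
congr (mu _); apply/seteqP; split=> z; rewrite /translate /= => hz; last first.
  by rewrite (iet_mapE (hJ _ hz)) addrK.
have hz' : inJ T a (iet_map T z) := hJ _ hz.
(* Off the domain [iet_map] is the identity, while the image of [z] lies in an image interval, so
   [z] is in the domain. *)
have [zd|zd] := boolP (0 <= z < tot T); last first.
  by rewrite (iet_map_out zd) in hz'; rewrite (inJ_dom hz') in zd.
have [b bz] := inI_cover zd; rewrite (iet_mapE bz) in hz hz'.
have bz' : inJ T b (z + tau T b) by rewrite /inJ addrK.
by rewrite (inJ_inj bz' hz') addrK in hz.
Qed.

Definition dom T : set mR := [set z : R | 0 <= z < tot T].

Lemma dom_iet T : iet_dom T = dom T.
Proof. by apply/seteqP; split=> z; rewrite /iet_dom /dom /= in_itv. Qed.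

Lemma measurable_dom T : measurable (dom T).
Proof. exact (measurable_cc _ _). Qed.

(** The domain is cut by the intervals on one side and by their images on the other, and
    translations match the pieces. It is intersected throughout because [mu] may charge the
    complement, as Lebesgue measure does. *)
Lemma shift_invariant T (mu : {measure set mR -> \bar R}) X :
  shift_inv mu T -> measurable X ->
  measurable (iet_map T @^-1` X `&` dom T) /\
  mu (iet_map T @^-1` X `&` dom T) = mu (X `&` dom T).
Proof.
move=> hT mX; pose K a : set mR := Iset T a `&` translate (- tau T a) X.
have mK a : measurable (K a).
  by apply: measurableI; [exact: measurable_Iset|exact: measurable_translate].
have EK : iet_map T @^-1` X `&` dom T = \bigcup_(a in setT) K a.
  apply/seteqP; split=> z.
    move=> [/= Xz /inI_cover[a az]]; exists a => //; split => //.
    by rewrite /translate /= opprK -(iet_mapE az).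
  move=> [a _ [az]]; rewrite /translate /= opprK -(iet_mapE az) => Xz.
  by split=> //; apply: inI_dom az.
have EJ : X `&` dom T = \bigcup_(a in setT) translate (tau T a) (K a).
  apply/seteqP; split=> z.
    move=> [/= Xz /inJ_cover[a az]]; exists a => //; split => //.
    by rewrite /translate /= opprK subrK.
  move=> [a _ [az]]; rewrite /translate /= opprK subrK => Xz.
  by split=> //; apply: (@inJ_dom _ _ _ a).
split; first by rewrite EK; apply: fin_bigcup_measurable => // a _; exact: mK.
rewrite EK EJ !measure_fin_bigcup //; try exact: finite_finset.
- by apply: eq_fsbigr => a _; rewrite /= hT // => z [].
- by move=> a b _ _ [z [[az _] [bz _]]]; apply: (inJ_inj az bz).
- by move=> a _; apply: measurable_translate.
- by move=> a b _ _ [z [[az _] [bz _]]]; apply: (inI_inj az bz).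
Qed.

Section determined_by_orbit.
Variables (m1 m2 : {measure set mR -> \bar R}) (T : iet R d).
Hypotheses (fin1 : (m1 setT < +oo)%E) (fin2 : (m2 setT < +oo)%E).
Hypotheses (out1 : m1 (~` dom T) = 0%E) (out2 : m2 (~` dom T) = 0%E).
Hypothesis tot12 : m1 setT = m2 setT.
Hypothesis dense : forall x y, 0 <= x -> x < y -> y <= tot T -> exists i, x < phi T i < y.
Hypothesis G12 : forall i, G m1 (phi T i) = G m2 (phi T i).

(** Index of the largest orbit point not exceeding [x] among the first [n], with the orbit point 0
    as default; the intervals [F x n] then increase to [0, x). *)
Let maxj x := fix maxj n := if n is n'.+1 then
  if (phi T (maxj n') < phi T n') && (phi T n' <= x) then n' else maxj n' else 0%N.

Let F x n : set mR := [set z : R | 0 <= z < phi T (maxj x n)].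

Let maxj_le x n : 0 <= x -> phi T (maxj x n) <= x.
Proof. by move=> x0; elim: n => //= n IH; case: ifP => // /andP[]. Qed.

Let maxj_nd x : {homo (fun n => phi T (maxj x n)) : n m / (n <= m)%N >-> n <= m}.
Proof.
apply: homo_leq => //=; first exact: le_trans.
by move=> n; case: ifP => // /andP[/ltW].
Qed.

Let maxj_ge x n : phi T n <= x -> phi T n <= phi T (maxj x n.+1).
Proof. by move=> h /=; rewrite h andbT; case: ltP. Qed.

Let FE x : 0 <= x -> x <= tot T -> \bigcup_n F x n = [set z : R | 0 <= z < x].
Proof.
move=> x0 xt; apply/seteqP; split=> z.
  by move=> [n _ /andP[h1 h2]] /=; rewrite h1 (lt_le_trans h2) ?maxj_le.
move=> /= /andP[z0 zx]; have [i /andP[zi ix]] := dense z0 zx xt.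
exists i.+1 => //; rewrite /F /= -/(maxj x i.+1); apply/andP; split => //.
exact: lt_le_trans zi (maxj_ge (ltW ix)).
Qed.

Let mu_cc x : 0 <= x -> x <= tot T ->
  m1 [set z : R | 0 <= z < x] = m2 [set z : R | 0 <= z < x].
Proof.
move=> x0 xt.
have cv (m : {measure set mR -> \bar R}) :
    (fun n => m (F x n)) @ \oo --> m [set z : R | 0 <= z < x].
  rewrite -FE //; apply: nondecreasing_cvg_mu.
  - by move=> n; exact (measurable_cc _ _).
  - by rewrite FE //; exact (measurable_cc _ _).
  - move=> n k nk; rewrite subsetEset => z /andP[z0 h]; apply/andP; split=> //.
    exact: lt_le_trans h (maxj_nd x nk).
have E : (fun n => m1 (F x n)) = (fun n => m2 (F x n)).
  apply/funext => n; have h := congr1 EFin (G12 (maxj x n)).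
  by rewrite /G !fineK in h => //; apply: fin_mu => //; exact (measurable_cc _ _).
have := cv m1; rewrite E => h; exact: cvg_unique h (cv m2).
Qed.

Lemma measure_in_dom (m : {measure set mR -> \bar R}) X : m (~` dom T) = 0%E ->
  measurable X -> m X = m (X `&` dom T).
Proof.
move=> h mX; rewrite (measureDI m mX (measurable_dom T)).
rewrite [X in (X + _)%E](_ : _ = 0%E) ?add0e //.
apply: subset_measure0 h; try (by move=> z []).
  by apply: measurableD => //; exact: measurable_dom.
by apply: measurableC; exact: measurable_dom.
Qed.

(** Rays are stable under intersection and generate the Borel sets; up to null sets they are
    intervals [0, x), whose masses are limits of masses at orbit points. *)
Lemma measure_eq_orbit X : measurable X -> m1 X = m2 X.
Proof.
move=> mX; apply: (@measure_unique _ R mR (@RGenInftyO.G R)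
  (fun n => `]-oo, n%:R[%classic)) => //.
- exact: RGenInftyO.measurableE.
- move=> _ _ [x ->] [y ->]; exists (Num.min x y).
  by apply/seteqP; split=> z; rewrite /= !in_itv /= lt_min => /andP.
- by move=> n; exists n%:R.
- apply/seteqP; split=> // z _; exists (Num.truncn `|z|).+1 => //.
  by rewrite /= in_itv /=; apply: le_lt_trans (ler_norm z) (truncnS_gt _).
- move=> _ [x ->]; have mx : measurable (`]-oo, x[%classic : set mR) by exact: measurable_itv.
  have [xt|xt] := leP x (tot T).
    rewrite (measure_in_dom out1 mx) (measure_in_dom out2 mx).
    have [x0|x0] := leP 0 x.
      rewrite (_ : _ `&` _ = [set z : R | 0 <= z < x]) ?mu_cc //.
      by apply/seteqP; split=> z; rewrite /dom /= in_itv /=; [case|move=> ?; split]; lra.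
    rewrite (_ : _ `&` _ = set0) ?measure0 //.
    by rewrite -subset0 => z []; rewrite /dom /= in_itv /=; lra.
  have E : `]-oo, x[%classic `&` dom T = setT `&` dom T.
    by apply/seteqP; split=> z; rewrite /dom /= in_itv /= => -[? ?]; split=> //; lra.
  by rewrite (measure_in_dom out1 mx) (measure_in_dom out2 mx) E -!measure_in_dom.
- move=> n; apply: le_lt_trans fin1.
  by apply: le_measure; rewrite ?inE //; exact: measurable_itv.
Qed.

End determined_by_orbit.

End invariant_measures.

(** * Vectors sharing one Rauzy path, and their measures *)

Section families.
Variables (R : realType) (d : nat) (rho : nat -> rows d) (q : nat -> move d).
Local Notation mR := (measurableTypeR R).
Hypothesis rho0 : perm_eq (rho 0%N).1 (enum 'I_d) /\ perm_eq (rho 0%N).2 (enum 'I_d).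
Hypothesis hrho : forall n, rauzy_move (rho n) (q n).2 (rho n.+1).
Hypothesis htop : forall n, (last (q n).2.1 (rho n).1 == (q n).2.1) = (q n).1.

(* Formal lengths: nothing ensures that they stay positive. *)
Fixpoint lens (v : 'I_d -> R) n : 'I_d -> R :=
  if n is n'.+1 then fun x =>
    if x == (q n').2.1 then lens v n' (q n').2.1 - lens v n' (q n').2.2
    else lens v n' x
  else v.

Lemma lens_lin (a b : R) u v n x :
  lens (fun y => a * u y + b * v y) n x = a * lens u n x + b * lens v n x.
Proof.
elim: n x => //= n IH x; rewrite !IH; case: ifP => // _; ring.
Qed.

Lemma eq_lens u v n x : u =1 v -> lens u n x = lens v n x.
Proof. by move=> h; elim: n x => //= n IH x; rewrite !IH. Qed.

Definition pos_lens v := forall n x, 0 < lens v n x.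

Lemma pos_lens_conv t u v : 0 <= t <= 1 -> pos_lens u -> pos_lens v ->
  pos_lens (fun y => (1 - t) * u y + t * v y).
Proof.
move=> /andP[t0 t1] hu hv n x; rewrite lens_lin; have := hu n x; have := hv n x.
have [->|tn] := eqVneq t 0; first by lra.
move=> h1 h2; apply: ltr_wpDl; first by apply: mulr_ge0; lra.
by apply: mulr_gt0 => //; rewrite lt0r tn.
Qed.

Lemma rauzy_move_perm (r r' : rows d) e : rauzy_move r e r' ->
  [/\ perm_eq r'.1 r.1, perm_eq r'.2 r.2 & e.1 != e.2].
Proof.
have P (x y : 'I_d) s : perm_eq (insert_after x y s) (rcons s y).
  rewrite /insert_after -cats1.
  rewrite -[X in perm_eq _ (X ++ _)](cat_take_drop (index x s).+1 s) -catA perm_cat2l.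
  by rewrite -cat1s perm_catC.
by case=> t b x y xy /=; split=> //; rewrite eq_sym.
Qed.

Lemma rho_perm n : perm_eq (rho n).1 (enum 'I_d) /\ perm_eq (rho n).2 (enum 'I_d).
Proof.
elim: n => // n [h1 h2]; have [p1 p2 _] := rauzy_move_perm (hrho n).
by split; [apply: perm_trans h1|apply: perm_trans h2].
Qed.

(** Positivity of the winner at level [n.+1] says exactly that it is longer than the loser at level
    [n], so the prescribed move is the one that Rauzy induction makes. *)
Lemma iet_family v : pos_lens v -> exists S : nat -> iet R d,
  [/\ rauzy_seq S q, (forall n, iet_rows (S n) = rho n) &
      (forall n, iet_len (S n) =1 lens v n)].
Proof.
move=> hv.
exists (fun n => Iet (proj1 (rho_perm n)) (proj2 (rho_perm n)) (hv n)); split=> // n.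
split=> /=; last first.
  have := htop n; rewrite /top_type /=; case: (rho n) (rho_perm n).1 => t b /=.
  by case: t.
split=> //=; have := hv n.+1 (q n).2.1; rewrite /= eqxx subr_gt0 //.
Qed.

Hypothesis hpos : forall n, exists j, forall a b, b \in wrd q n j a.
Hypothesis hgrow : forall N, exists n, forall a, (N <= size (wrd q 0 n a))%N.

Lemma lens_wrd v n j b : lens v n b =
  \sum_a (count_mem b (wrd q n j a))%:R * lens v (n + j)%N a.
Proof. by apply: weights_wrd => // m; case: (rauzy_move_perm (hrho m)). Qed.

(* A nonnegative vector all of whose renormalizations are nonnegative is
   positive at every level, by positivity of products of step matrices. *)
Lemma nonneg_pos_lens v : (forall n x, 0 <= lens v n x) ->
  (exists x, v x != 0) -> pos_lens v.
Proof.
move=> h [x0 vx0] n b; have [j hj] := hpos n.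
have [a ha] : exists a, lens v (n + j)%N a != 0.
  apply/not_existsP => H; move/negP: vx0; apply; apply/eqP.
  rewrite -[v x0]/(lens v 0 x0) (lens_wrd v 0 (n + j)) big1 // => a _.
  by have /negP/negPn/eqP -> := H a; rewrite mulr0.
rewrite (lens_wrd v n j) (bigD1 a) //=; apply: ltr_pwDl.
  rewrite mulr_gt0 //; last by rewrite lt0r ha h.
  by rewrite ltr0n -has_count has_pred1 hj.
by apply: sumr_ge0 => c _; rewrite mulr_ge0.
Qed.

Variables (a0 : 'I_d) (w : 'I_d -> R) (S : nat -> iet R d).
Hypotheses (hw : pos_lens w) (hS : rauzy_seq S q).
Hypotheses (hSrho : forall n, iet_rows (S n) = rho n).
Hypothesis hSlen : forall n, iet_len (S n) =1 lens w n.
Let T := S 0%N.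
Hypothesis totT : tot T = 1.

Lemma family_codes : exists code, codes T code /\
  forall v, pos_lens v -> forall S' : nat -> iet R d, rauzy_seq S' q ->
    (forall n, iet_rows (S' n) = rho n) -> codes (S' 0%N) code.
Proof.
have [code hc] := orbit0_code R rho hgrow a0.
by exists code; split=> [|v hv S' h1 h2] i; exact: hc.
Qed.

Lemma exists_invariant v : pos_lens v -> \sum_a v a = 1 ->
  exists mu : probability mR R,
    (forall a, fine (mu (Iset T a)) = v a) /\ Defs.invariant T mu.
Proof.
move=> hv v1; have [code [cT hc]] := family_codes.
have [S' [hS' hr' hl']] := iet_family hv; set T0 := S' 0%N.
have cT0 : codes T0 code by apply: hc hv _ hS' hr'.
have tT0 : tot T0 = 1 by rewrite /tot (eq_bigr _ (fun a _ => hl' 0%N a)).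
have ord : forall i j, phi T0 i < phi T0 j -> phi T i < phi T j.
  apply: (orbit_order cT0 cT); first by rewrite hSrho hr'.
  (* Vectors with positive formal lengths form a convex set, so the intermediate vectors have the
     same path and hence the same code. *)
  move=> t ht; have hp := pos_lens_conv ht hv hw.
  have [S2 [hS2 hr2 hl2]] := iet_family hp; exists (S2 0%N); split.
  - by rewrite hr2 hr'.
  - by move=> a; rewrite hl2 hl' hSlen.
  - exact: hc hp _ hS2 hr2.
  - by move=> i j; apply: (orbit0_inj hS2 hpos hgrow a0).
have den y : 0 <= y < tot T0 -> forall e, 0 < e -> exists i, `|phi T0 i - y| < e.
  move=> hy e e0; apply: (orbit_dense hS' hpos hgrow) => //.
  by rewrite lexx (tot_gt0 _ _ a0).
pose h := semiconj T0 T.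
have mh : measurable_fun setT (h : mR -> mR).
  apply: nondecreasing_measurable => //.
  exact: (@semiconj_nd _ _ T0 T code cT).
have hI := semiconj_inI cT0 cT ord den.
have hM := semiconj_map cT0 cT ord den.
(* Lebesgue measure is cut down to the domain of [T0], where [h] is a semiconjugacy; its image is
   the measure sought. *)
pose lb := mrestr (@lebesgue_measure R) (measurable_dom T0).
have lb1 : push_measure lb mh setT = 1%E.
  rewrite -[LHS]/(lebesgue_measure (h @^-1` setT `&` dom T0)) preimage_setT setTI.
  rewrite (_ : dom T0 = [set` `[0%R, 1%R[]); last first.
    by rewrite -tT0 -dom_iet.
  by rewrite lebesgue_measure_itv /= lte_fin ltr01 -EFinB subr0.
have preI a : h @^-1` (Iset T a) `&` dom T0 = Iset T0 a.
  apply/seteqP; split=> z.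
    move=> [/= haz /inI_cover[b bz]]; have := inI_inj haz (hI _ _ bz).
    by move=> ->.
  by move=> az; split; [exact: hI|exact: inI_dom az].
exists (prob_of lb1); split.
  move=> a; rewrite -[LHS]/(fine (lebesgue_measure (h @^-1` (Iset T a) `&` dom T0))).
  rewrite preI IsetE.
  rewrite lebesgue_measure_itv /= lte_fin ltrDl iet_len_gt0 -EFinB /=.
  by rewrite addrAC subrr add0r hl'.
have shl : shift_inv (@lebesgue_measure R) T0.
  by move=> a J mJ _; exact: lebesgue_translate.
have hdom z : dom T0 z -> dom T (h z) /\ h (iet_map T0 z) = iet_map T (h z).
  move=> /inI_cover[a az]; have haz := hI _ _ az.
  by split; [exact: inI_dom haz|rewrite (iet_mapE az) (iet_mapE haz); exact: hM].
split.
  rewrite -lb1 -[RHS]/(lebesgue_measure (h @^-1` setT `&` dom T0)).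
  rewrite -[LHS]/(lebesgue_measure (h @^-1` iet_dom T `&` dom T0)).
  congr (lebesgue_measure _); apply/seteqP; split=> z [_ hz]; split=> //.
  by rewrite dom_iet; case: (hdom z hz).
move=> X mX; rewrite -[RHS]/(lebesgue_measure (h @^-1` X `&` dom T0)).
rewrite -[LHS]/(lebesgue_measure (h @^-1` (iet_map T @^-1` X) `&` dom T0)).
have mhX : measurable (h @^-1` X) by have := mh measurableT _ mX; rewrite setTI.
have [_ <-] := shift_invariant shl mhX.
congr (lebesgue_measure _); apply/seteqP; split=> z [hz hd]; split=> //.
  by move: hz; rewrite /preimage /= (hdom z hd).2.
by move: hz; rewrite /preimage /= (hdom z hd).2.
Qed.

End families.

(** * Ergodicity of extreme vectors *)

Section ergodicity.
Variables (R : realType) (d : nat) (q : nat -> move d) (S : nat -> iet R d).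
Local Notation mR := (measurableTypeR R).
Hypothesis hS : rauzy_seq S q.
Hypothesis hpos : forall n, exists j, forall a b, b \in wrd q n j a.
Hypothesis hgrow : forall N, exists n, forall a, (N <= size (wrd q 0 n a))%N.
Let T := S 0%N.
Variables (a0 : 'I_d) (code : nat -> 'I_d).
Hypothesis cT : codes T code.

Lemma measure_dom_sum (m : {measure set mR -> \bar R}) :
  m (dom T) = (\sum_a m (Iset T a))%E.
Proof.
have -> : dom T = \big[setU/set0]_(a < d) Iset T a.
  rewrite -bigcup_seq; apply/seteqP; split=> z.
    by move=> /inI_cover[a az]; exists a => //=; rewrite mem_index_enum.
  by move=> [a _ az]; apply: inI_dom az.
apply: measure_bigsetU_ord => [a|]; first exact: measurable_Iset.
by move=> a b _ _ [z [az bz]]; apply: inI_inj az bz.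
Qed.

(** Masses of the intervals change under a step as lengths do. This is the source of nonnegativity:
    the formal lengths of a measure vector are masses. *)
Lemma mvec_lens (m : {measure set mR -> \bar R}) n : (m setT < +oo)%E ->
  shift_inv m T -> shift_inv m (S n) /\ forall a : 'I_d, mvec m (S n) a = lens q (mvec m T) n a.
Proof.
move=> fm hm; elim: n => [//|n [h1 h2]].
have [] := hS n; case E: (q n) => [top [w l]] /= hs _.
have h3 := shift_inv_step hs h1; split=> // b.
have mE c := step_mvec fm c hs h1.
have wl := step_neq hs.
have ll := mE l; rewrite eq_sym (negPf wl) addr0 in ll.
rewrite E /= -!h2; case: eqP => [->|/eqP bw].
  by rewrite (mE w) eqxx ll addrK.
by rewrite (mE b) (negPf bw) addr0.
Qed.

Lemma T_dense x y : 0 <= x -> x < y -> y <= tot T -> exists i, x < phi T i < y.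
Proof.
apply: phi_between => z hz e e0; apply: (orbit_dense hS hpos hgrow) => //.
by rewrite lexx (tot_gt0 _ _ a0).
Qed.

(** An invariant set splits [mu] into two invariant pieces whose vectors stay nonnegative along the
    path. Extremality makes the first vector a multiple [c] of [v], so this piece is [c] times [mu],
    the vector determining the measure. Evaluation on the complement of [X] leaves only [c = 0] or a
    null complement. *)
Lemma ergodic_of_extreme (v : 'I_d -> R) (mu : probability mR R) :
  Defs.invariant T mu -> (forall a, fine (mu (Iset T a)) = v a) -> \sum_a v a = 1 ->
  (forall v1 v2, (forall n x, 0 <= lens q v1 n x) -> (forall n x, 0 <= lens q v2 n x) ->
     (forall a, v1 a + v2 a = v a) -> exists c, forall a, v1 a = c * v a) ->
  ergodic T mu.
Proof.
move=> hinv hv v1 hext; split=> // X mX hX.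
have hmu := invariant_shift hinv.
have fmu A : measurable A -> mu A \is a fin_num by move=> mA; apply: fin_num_measure.
have restr_inv (Y : set mR) (mY : measurable Y) : iet_map T @^-1` Y = Y ->
    shift_inv (mrestr mu mY) T.
  move=> hY a J mJ hJ; rewrite /mrestr.
  rewrite (_ : _ `&` Y = translate (tau T a) (J `&` Y)).
    by apply: hmu; [exact: measurableI|move=> z [/hJ]].
  apply/seteqP; rewrite /translate; split=> z /= [Jz Yz]; split=> //.
    have := hJ _ Jz; rewrite /Iset /= => az.
    by rewrite -hY /= (iet_mapE az) subrK.
  have := hJ _ Jz; rewrite /Iset /= => az.
  by rewrite -hY /= (iet_mapE az) subrK in Yz.
have mCX : measurable (~` X) by exact: measurableC.
have hCX : iet_map T @^-1` (~` X) = ~` X by rewrite -[in RHS]hX.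
have fin_restr (Y : set mR) (mY : measurable Y) : (mrestr mu mY setT < +oo)%E.
  by rewrite /mrestr setTI ltey_eq fmu.
pose m1 : {measure set mR -> \bar R} := mrestr mu mX.
have vpos (Y : set mR) (mY : measurable Y) : iet_map T @^-1` Y = Y ->
    forall n x, 0 <= lens q (mvec (mrestr mu mY) T) n x.
  move=> hY n x; have [_ <-] := mvec_lens n (fin_restr Y mY) (restr_inv Y mY hY).
  exact: mvec_ge0.
have [|c hc] := hext _ _ (vpos X mX hX) (vpos _ mCX hCX).
  move=> a; rewrite -hv /mvec -fineD; try by apply: fmu; apply: measurableI => //; exact: measurable_Iset.
  by rewrite (measureDI mu (measurable_Iset T a) mX) addeC setDE.
have muout : mu (~` dom T) = 0%E.
  rewrite probability_setC; last exact: measurable_dom.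
  by rewrite -dom_iet hinv.1 subee.
have m1out : m1 (~` dom T) = 0%E.
  apply: subset_measure0 muout; last by move=> z [].
    apply: measurableI => //; apply: measurableC; exact: measurable_dom.
  apply: measurableC; exact: measurable_dom.
have cE : m1 setT = c%:E.
  rewrite (measure_in_dom m1out) // setTI measure_dom_sum.
  rewrite -[c]mulr1 -v1 mulr_sumr -sumEFin; apply: eq_bigr => a _.
  rewrite -hc /mvec fineK //; apply: fmu; apply: measurableI => //.
  exact: measurable_Iset.
have c0 : 0 <= c by rewrite -lee_fin -cE; apply: measure_ge0.
pose m3 : {measure set mR -> \bar R} := mscale (NngNum c0) mu.
have mu1 := @probability_setT _ _ _ mu.
have m3T : m3 setT = c%:E by rewrite /m3 /= /mscale /= mu1 mule1.
have E Y : measurable Y -> m1 Y = m3 Y.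
  apply: (@measure_eq_orbit _ _ m1 m3 T).
  - exact: fin_restr.
  - by rewrite m3T ltry.
  - exact: m1out.
  - by rewrite /m3 /= /mscale /= muout mule0.
  - by rewrite m3T cE.
  - exact: T_dense.
  - move=> i; have fin1 := fin_restr X mX.
    rewrite (G_phi fin1 i (restr_inv X mX hX) cT).
    have -> : G m3 (phi T i) = c * G mu (phi T i).
      by rewrite /G /m3 /= /mscale /= fineM //; apply: fmu; exact (measurable_cc _ _).
    have fT : (mu setT < +oo)%E by rewrite ltey_eq fmu.
    rewrite (G_phi fT i hmu cT) mulr_sumr; apply: eq_bigr => j _.
    rewrite /tauv mulrBr /lend !mulr_sumr; congr (_ - _); apply: eq_bigr => b _;
      by rewrite hc -hv.
have := E _ mCX; rewrite /m3 /= /mscale /= /m1 /= /mrestr setICl measure0 => /esym/eqP.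
rewrite mule_eq0 => /orP[|/eqP h0].
  rewrite eqe => /eqP /= c00; left.
  by move: cE; rewrite /m1 /= /mrestr setTI c00.
right; have := probability_setC mu mX; rewrite h0 -(fineK (fmu _ mX)) -EFinB => -[h].
by congr (_%:E); lra.
Qed.

End ergodicity.

(** * A criterion for generic points *)

Section equidistribution.
Variables (R : realType) (d : nat).
Local Notation mR := (measurableTypeR R).

(** The domain is not compact; a uniform radius is obtained at the points of [K], and two points off
    [K] have the same value 0. *)
Lemma unif_cont_compact_support (D : set R) (f : R -> R) (K : set R) :
  {within D, continuous f} -> compact K -> K `<=` D ->
  (forall x, D x -> ~ K x -> f x = 0) ->
  forall e, 0 < e -> exists2 r, 0 < r &
    forall x y, D x -> D y -> `|x - y| < r -> `|f x - f y| < e.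
Proof.
move=> cf cK KD fK e e0.
pose P r x := D x -> forall y, D y -> `|x - y| < r -> `|f x - f y| < e.
have [r [r0 hr]] : exists r, 0 < r /\ K `<=` P r.
  have /compact_near_coveringP/(_ R (0:R)^'+ P _) := cK.
  case=> [x Kx|r].
  - have /subspace_continuousP/(_ _ (KD _ Kx))/cvgrPdist_lt/(_ (e / 2)) := cf.
    case=> [|eta /= eta0 heta]; first by rewrite divr_gt0.
    have hx y : D y -> `|x - y| < eta -> `|f x - f y| < e / 2.
      by move=> Dy xy; apply: heta.
    exists (ball x (eta / 2), [set r : R | r < eta / 2]) => /=.
      split; first by apply: nbhsx_ballx; rewrite divr_gt0.
      by apply: nbhs_right_lt; rewrite divr_gt0.
    move=> [x' r] [/= h1 h2] Dx' y Dy xy.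
    have {}h1 : `|x - x'| < eta / 2 by [].
    have := hx x' Dx'; have := hx y Dy.
    have := ler_distD x' x y; have := ler_distD (f x) (f x') (f y).
    rewrite (distrC (f x') (f x)) => h3 h4 h5 h6.
    have := h5 ltac:(lra); have := h6 ltac:(lra); lra.
  - move=> /= r0 hr; exists (r / 2); split; first lra.
    move=> x Kx; have r2 : 0 < r / 2 by lra.
    by apply: (hr (r / 2)) => //=; rewrite sub0r normrN gtr0_norm //; lra.
exists r => // x y Dx Dy xy.
have [Kx|Kx] := EM (K x); first exact: hr.
have [Ky|Ky] := EM (K y); first by rewrite distrC; apply: hr => //; rewrite distrC.
by rewrite !fK // subrr normr0.
Qed.

Section average.
Variables (T : iet R d) (mu : probability mR R) (z : R) (code : nat -> 'I_d).
Hypotheses (totT : tot T = 1) (zT : 0 <= z < tot T).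
Hypotheses (hinv : Defs.invariant T mu) (hvec : forall a, fine (mu (Iset T a)) = iet_len T a).
Hypothesis cT : codes T code.
Hypothesis dense : forall x y, 0 <= x -> x < y -> y <= tot T -> exists i, x < phi T i < y.
Let y i := iter i (iet_map T) z.
Hypothesis freq : forall a, (fun N : nat => N%:R^-1 * \sum_(i < N) (inI T a (y i))%:R)
  @ \oo --> iet_len T a.

Let yT i : 0 <= y i < 1.
Proof. by rewrite -totT; apply: iter_dom. Qed.

(** This is [G_lend] for the Dirac mass at [t]. *)
Lemma indic_lend (t : R) s a : 0 <= t -> uniq s -> a \in s ->
  (t < lend (iet_len T) s a)%R%:R = \sum_(b <- take (index a s) s)
    (lend (iet_len T) s b <= t < lend (iet_len T) s b + iet_len T b)%R%:R :> R.
Proof.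
move=> t0 us as_.
have E (A : set mR) (b : bool) : (A t <-> b) ->
    fine (dirac (t : mR) A : \bar R) = b%:R :> R.
  move=> h; rewrite diracE; congr (_%:R); congr nat_of_bool.
  by apply/idP/idP; rewrite inE => /h.
have fd : (dirac (t : mR) (setT : set mR) < +oo :> \bar R)%E.
  by rewrite diracE ltry.
have := G_lend fd T us as_; rewrite /G (E _ (t < lend (iet_len T) s a)); last first.
  by split=> /= [/andP[]|-> //]; rewrite t0.
by move=> ->; apply: eq_bigr => b _; apply: E.
Qed.

(** A pointwise form of [G_tau]: the point mass at the image of [t] gives to the intervals of the
    bottom row what the point mass at [t] gives to those of the top row. *)
Lemma indic_tau t a x : 0 <= t < 1 -> inI T a x ->
  (iet_map T t < x + tau T a)%R%:R =
  (t < x)%R%:R + tauv (iet_rows T) (fun b => (inI T b t)%:R) a :> R.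
Proof.
rewrite -[X in _ < X]totT => tT ax; case/andP: (ax) => x1 x2.
have tT' := iet_map_dom tT; case/andP: (tT) => t0 _; case/andP: (tT') => t0' _.
have [b bt] := inI_cover tT; have Tt := iet_mapE bt.
have bJ c : inJ T c (iet_map T t) = inI T c t.
  have h : inJ T b (iet_map T t) by rewrite Tt /inJ addrK.
  apply/idP/idP => [h1|h1]; first by rewrite (inJ_inj h1 h).
  by rewrite (inI_inj h1 bt).
have S1 (u v : R) : 0 <= v <= u -> forall s : R, (s < u)%R%:R = (s < v)%R%:R + (v <= s < u)%R%:R :> R.
  move=> /andP[v0 vu] s; case: (ltP s v) => sv /=; last by rewrite add0r.
  by rewrite (lt_le_trans sv vu) addr0.
rewrite (S1 _ (left_end T (iet_rows T).2 a)); last first.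
  by rewrite left_end_ge0 tauE; lra.
rewrite [in RHS](S1 _ (left_end T (iet_rows T).1 a)); last first.
  by rewrite left_end_ge0; lra.
rewrite !indic_lend ?uniq_top ?uniq_bot ?mem_top ?mem_bot // /tauv /lend.
rewrite (eq_bigr (fun b => (inI T b t)%:R)); last first.
  by move=> c _; rewrite -bJ inJE.
rewrite [X in _ = X + _ + _](eq_bigr (fun b => (inI T b t)%:R)) //.
suff -> : (left_end T (iet_rows T).2 a <= iet_map T t < x + tau T a) =
  (left_end T (iet_rows T).1 a <= t < x) by ring.
rewrite Tt; have [ba|ba] := eqVneq b a.
  by rewrite ba tauE; apply/andP/andP => -[? ?]; split; lra.
have hb : inJ T b (t + tau T b) by rewrite /inJ addrK.
apply/idP/idP => h; exfalso; move/negP: ba; apply; apply/eqP.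
  apply: (inJ_inj hb); rewrite inJE; move: h x2; rewrite !tauE => /andP[? ?] ?.
  by apply/andP; split; lra.
by apply: (inI_inj bt); move: h x2 => /andP[? ?] ?; apply/andP; split; lra.
Qed.

Let favg N (f : R -> R) : R := N%:R^-1 * \sum_(i < N) f (y i).

Lemma cvg_sum_seq (I : Type) (s : seq I) (u : nat -> I -> R) (v : I -> R) :
  (forall b, u N b @[N --> \oo] --> v b) ->
  \sum_(b <- s) u N b @[N --> \oo] --> \sum_(b <- s) v b.
Proof.
move=> h; elim: s => [|b s IH].
  rewrite big_nil; under eq_fun do rewrite big_nil.
  exact: cvg_cst.
rewrite big_cons; under eq_fun do rewrite big_cons.
by apply: cvgD.
Qed.

Lemma cvg_tauv (u : nat -> 'I_d -> R) (v : 'I_d -> R) a : (forall b, u N b @[N --> \oo] --> v b) ->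
  tauv (iet_rows T) (u N) a @[N --> \oo] --> tauv (iet_rows T) v a.
Proof.
by move=> h; rewrite /tauv /lend; apply: cvgB; apply: cvg_sum_seq.
Qed.

Lemma tauvZ (c : R) (v : 'I_d -> R) a : tauv (iet_rows T) (fun b => c * v b) a = c * tauv (iet_rows T) v a.
Proof. by rewrite /tauv /lend mulrBr !mulr_sumr. Qed.

Lemma tauv_sum N (v : nat -> 'I_d -> R) a :
  tauv (iet_rows T) (fun b => \sum_(i < N) v i b) a = \sum_(i < N) tauv (iet_rows T) (v i) a.
Proof. by rewrite /tauv /lend sumrB; congr (_ - _); rewrite exchange_big. Qed.

Lemma cvg_inv_nat : (fun N : nat => N%:R^-1 : R) @ \oo --> (0 : R).
Proof.
apply/cvgrPdist_lt => e e0; near=> N.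
rewrite sub0r normrN gtr0_norm ?invr_gt0 ?ltr0n; last by near: N; exact: nbhs_infty_gt.
rewrite invf_plt ?posrE //; last by rewrite ltr0n; near: N; exact: nbhs_infty_gt.
near: N; exact: nbhs_infty_gtr.
Unshelve. all: by end_near. Qed.

(** Summed along the orbit, [indic_tau] telescopes up to a boundary term bounded by 1, so the
    frequency of [0, phi T k) is obtained from those of the letters by induction on [k]. *)
Lemma freq_phi k : favg N (fun t => (t < phi T k)%R%:R) @[N --> \oo] --> phi T k.
Proof.
elim: k => [|k IH].
  have -> : (fun N => favg N (fun t => (t < phi T 0)%R%:R)) = fun=> 0.
    apply/funext => N; rewrite /favg big1 ?mulr0 // => i _.
    by have /andP[] := yT i; rewrite /phi /= leNgt => /negPf ->.
  exact: cvg_cst.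
rewrite (phiS _ cT); set a := code k; set x := phi T k in IH *.
have E N : favg N (fun t => (t < x + tau T a)%R%:R) =
    favg N (fun t => (t < x)%R%:R) +
    tauv (iet_rows T) (fun b => N%:R^-1 * \sum_(i < N) (inI T b (y i))%:R) a +
    N%:R^-1 * ((y 0 < x + tau T a)%R%:R - (y N < x + tau T a)%R%:R).
  rewrite tauvZ (tauv_sum N (fun i b => (inI T b (y i))%:R)) /favg -!mulrDr; congr (_ * _).
  have -> : \sum_(i < N) (y i < x)%R%:R +
      \sum_(i < N) tauv (iet_rows T) (fun b => (inI T b (y i))%:R) a =
      \sum_(i < N) (y i.+1 < x + tau T a)%R%:R :> R.
    rewrite -big_split; apply: eq_bigr => i _ /=.
    by rewrite -indic_tau //; exact: cT.
  elim: N => [|N IHN]; first by rewrite !big_ord0 subrr addr0.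
  by rewrite !big_ord_recr /= IHN; ring.
under eq_fun do rewrite E.
set c := x + tau T a; have -> : c = x + tauv (iet_rows T) (iet_len T) a + 0.
  by rewrite addr0 -tau_tauv.
apply: cvgD; first by apply: cvgD => //; exact: cvg_tauv.
apply/cvgrPdist_lt => e e0; near=> N.
rewrite sub0r normrN normrM.
have h (c0 : R) : `|(y 0 < c0)%R%:R - (y N < c0)%R%:R| <= 1 :> R.
  by case: (_ < _)%R; case: (_ < _)%R; rewrite /= ?subrr ?subr0 ?sub0r ?normrN ?normr0 ?normr1.
apply: (@le_lt_trans _ _ `|N%:R^-1 : R|); first exact: ler_piMr.
rewrite -normrN -sub0r; near: N.
by have /cvgrPdist_lt/(_ e e0) := cvg_inv_nat.
Unshelve. all: by end_near. Qed.

Lemma le_favg N (f g : R -> R) : (forall t, 0 <= t < 1 -> f t <= g t) -> favg N f <= favg N g.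
Proof.
move=> fg; apply: ler_wpM2l; first by rewrite invr_ge0.
by apply: ler_sum => i _; apply/fg/yT.
Qed.

Lemma favg_cst N (c : R) : 0 <= c -> favg N (fun=> c) <= c.
Proof.
move=> c0; rewrite /favg sumr_const card_ord -[c *+ N]mulr_natr.
case: N => [|N]; first by rewrite (_ : 0%:R = 0 :> R) ?invr0 ?mul0r.
by rewrite mulrC -mulrA divff ?mulr1 // pnatr_eq0.
Qed.

Lemma ler_indic (t x x' : R) : x <= x' -> (t < x)%R%:R <= (t < x')%R%:R :> R.
Proof. by move=> xx'; case: (ltP t x) => // tx; rewrite (lt_le_trans tx xx'). Qed.

Lemma phi_below x e : 0 <= x <= 1 -> 0 < e -> exists2 k, phi T k <= x & x - e < phi T k.
Proof.
move=> /andP[x0 x1] e0; have [xe|xe] := leP x 0.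
  by exists 0%N; rewrite /phi /=; lra.
have [|||k /andP[k1 k2]] := @dense (Num.max 0 (x - e)) x.
- by rewrite le_max lexx.
- by rewrite gt_max xe; lra.
- by rewrite totT.
- exists k; first exact: ltW.
  by apply: le_lt_trans k1; rewrite le_max lexx orbT.
Qed.

Lemma phi_above x e : 0 <= x < 1 -> 0 < e -> exists2 k, x <= phi T k & phi T k < x + e.
Proof.
move=> /andP[x0 x1] e0.
have [||k /andP[k1 k2]] := @dense x (Num.min 1 (x + e)) x0.
- by rewrite lt_min x1; lra.
- by rewrite totT ge_min lexx.
- exists k; first exact: ltW.
  by apply: lt_le_trans k2 _; rewrite ge_min lexx orbT.
Qed.

(** By density [0, x) is squeezed between intervals ending at orbit points of 0; at [x = 1] none
    lies above, and the trivial bound serves. *)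
Lemma freq_lt x : 0 <= x <= 1 -> favg N (fun t => (t < x)%R%:R) @[N --> \oo] --> x.
Proof.
move=> hx; have /andP[x0 x1] := hx; apply/cvgrPdist_lt => e e0.
have e2 : 0 < e / 2 by lra.
have [k kx xk] := phi_below hx e2.
have /cvgrPdist_lt/(_ _ e2) hk := @freq_phi k.
have up : \forall N \near \oo, favg N (fun t => (t < x)%R%:R) < x + e.
  have [xlt|xge] := ltP x 1; last first.
    near=> N; apply: (@le_lt_trans _ _ 1); last by lra.
    apply: le_trans (favg_cst N ler01).
    by apply: le_favg => t _; rewrite lern1 leq_b1.
  have [|k' kx' xk'] := @phi_above x _ _ e2; first by rewrite x0.
  have /cvgrPdist_lt/(_ _ e2) hk' := @freq_phi k'.
  near=> N; have : `|phi T k' - favg N (fun t => (t < phi T k')%R%:R)| < e / 2.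
    by near: N.
  rewrite ltr_norml => /andP[h1 h2].
  apply: (@le_lt_trans _ _ (favg N (fun t => (t < phi T k')%R%:R))); last by lra.
  by apply: le_favg => t _; apply: ler_indic.
near=> N; have : `|phi T k - favg N (fun t => (t < phi T k)%R%:R)| < e / 2 by near: N.
have u : favg N (fun t => (t < x)%R%:R) < x + e by near: N.
have : favg N (fun t => (t < phi T k)%R%:R) <= favg N (fun t => (t < x)%R%:R).
  by apply: le_favg => t _; apply: ler_indic.
by rewrite !ltr_norml => h /andP[h1 h2]; lra.
Unshelve. all: by end_near. Qed.

Let fmu A : measurable A -> mu A \is a fin_num.
Proof. by move=> mA; apply: fin_num_measure. Qed.

(** The vector of [mu] is the length vector, so its distribution function is the identity on the
    orbit of 0, and by monotonicity everywhere. *)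
Lemma G_id x : 0 <= x <= 1 -> G mu x = x.
Proof.
move=> hx; have /andP[x0 x1] := hx.
have hmu := invariant_shift hinv.
have fT : (mu setT < +oo)%E by rewrite ltey_eq fmu.
have Gphi k : G mu (phi T k) = phi T k.
  rewrite (G_phi fT k hmu cT) (phiE _ cT); apply: eq_bigr => j _; rewrite tau_tauv.
  by rewrite /tauv /lend; congr (_ - _); apply: eq_bigr => b _; apply: hvec.
have Gnd u v : u <= v -> G mu u <= G mu v.
  move=> uv; apply: fine_le; try by apply: fmu; exact (measurable_cc _ _).
  apply: le_measure; rewrite ?inE; try exact (measurable_cc _ _).
  by move=> t /=; lra.
have up : G mu x <= x.
  have [xlt|xge] := ltP x 1; last first.
    have -> : x = 1 by apply: le_anti; rewrite x1.
    have -> : G mu 1 = 1; last by [].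
    have E : [set t : R | 0 <= t < 1] = iet_dom T by rewrite dom_iet /dom totT.
    by rewrite /G E; exact: (congr1 fine hinv.1).
  rewrite leNgt; apply/negP => h.
  have x01 : 0 <= x < 1 by rewrite x0.
  have e0 : 0 < G mu x - x by lra.
  have [k' kx' xk'] := phi_above x01 e0.
  by have := Gnd _ _ kx'; rewrite Gphi; lra.
apply: le_anti; rewrite up /= leNgt; apply/negP => h.
have e0 : 0 < x - G mu x by lra.
have [k kx xk] := phi_below hx e0.
by have := Gnd _ _ kx; rewrite Gphi; lra.
Qed.

Lemma mu_itv x x' : 0 <= x -> x <= x' -> x' <= 1 -> fine (mu [set t : R | x <= t < x']) = x' - x.
Proof.
move=> x0 xx x1; have fT : (mu setT < +oo)%E by rewrite ltey_eq fmu.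
have := mu_itv_split fT x0 xx; rewrite -!/(G _ _) !G_id; lra.
Qed.

Section step_approximation.
Variables (f : R -> R) (e : R) (n : nat).
Hypotheses (n0 : (0 < n)%N) (e0 : 0 <= e).
Let g k : R := k%:R / n%:R.
Hypothesis fg : forall k t, (k < n)%N -> g k <= t < g k.+1 -> `|f t - f (g k)| <= e.

Let g_le k l : (k <= l)%N -> g k <= g l.
Proof. by move=> kl; rewrite ler_pM2r ?invr_gt0 ?ltr0n // ler_nat. Qed.

Let g0 : g 0 = 0. Proof. by rewrite /g mul0r. Qed.
Let gn : g n = 1. Proof. by rewrite /g divff // pnatr_eq0 -lt0n. Qed.

Let g_ge0 k : 0 <= g k. Proof. by rewrite -g0 g_le. Qed.
Let g_le1 k : (k <= n)%N -> g k <= 1. Proof. by rewrite -gn; apply: g_le. Qed.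

Let g_cover t : 0 <= t < 1 -> exists2 k, (k < n)%N & g k <= t < g k.+1.
Proof.
move=> /andP[t0 t1]; have nR : 0 < n%:R :> R by rewrite ltr0n.
have tn : 0 <= t * n%:R by apply: mulr_ge0 => //; apply: ltW.
have /andP[h1 h2] := truncn_itv tn.
exists (Num.truncn (t * n%:R)).
  rewrite -(ltr_nat R); apply: le_lt_trans h1 _.
  by rewrite -[X in _ < X]mul1r ltr_pM2r.
by rewrite /g ler_pdivrMr // h1 ltr_pdivlMr.
Qed.

Let indic k t : g k <= t < g k.+1 -> forall l,
  (t < g l.+1)%R%:R - (t < g l)%R%:R = (l == k)%:R :> R.
Proof.
move=> /andP[t1 t2] l; case: (ltngtP l k) => [lk|lk|->].
- rewrite ltNge (le_trans (g_le lk) t1) ltNge (le_trans (g_le (ltnW lk)) t1).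
  by rewrite subrr.
- by rewrite (lt_le_trans t2 (g_le lk)) (lt_le_trans t2 (g_le (leqW lk))) subrr.
- by rewrite t2 ltNge t1 subr0.
Qed.

Let st t : R := \sum_(k < n) f (g k) * ((t < g k.+1)%R%:R - (t < g k)%R%:R).

Lemma step_dist t : 0 <= t < 1 -> `|f t - st t| <= e.
Proof.
move=> /g_cover[k kn kt]; rewrite /st (bigD1 (Ordinal kn)) //= big1 ?addr0.
  by rewrite (indic kt) eqxx mulr1; apply: fg.
move=> l lk; rewrite (indic kt) (_ : _ == _ = false) ?mulr0 //.
by apply: contraNF lk => /eqP h; apply/eqP/val_inj.
Qed.

Lemma step_bounded t : 0 <= t < 1 -> `|f t| <= \sum_(k < n) `|f (g k)| + e.
Proof.
move=> /g_cover[k kn kt]; have := fg kn kt; have := ler_normD (f t - f (g k)) (f (g k)).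
rewrite subrK (bigD1 (Ordinal kn)) //= => h1 h2.
have : 0 <= \sum_(i < n | i != Ordinal kn) `|f (g i)| by apply: sumr_ge0.
lra.
Qed.

Lemma favg_step N : `|favg N f - favg N st| <= e.
Proof.
rewrite /favg -mulrBr -sumrB normrM ger0_norm ?invr_ge0 //.
apply: le_trans (favg_cst N e0); apply: ler_wpM2l; first by rewrite invr_ge0.
by apply: le_trans (ler_norm_sum _ _ _) _; apply: ler_sum => i _; apply: step_dist.
Qed.

Lemma cvg_favg_step : favg N st @[N --> \oo] --> \sum_(k < n) f (g k) * (g k.+1 - g k).
Proof.
have E N : favg N st = \sum_(k < n) f (g k) *
    (favg N (fun t => (t < g k.+1)%R%:R) - favg N (fun t => (t < g k)%R%:R)).
  rewrite /favg /st exchange_big mulr_sumr; apply: eq_bigr => k _.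
  by rewrite -mulrBr -sumrB -mulr_sumr mulrCA.
under eq_fun do rewrite E.
apply: cvg_sum_seq => k; apply: cvgMl_tmp; apply: cvgB; apply: freq_lt.
  by rewrite g_ge0 g_le1.
by rewrite g_ge0 g_le1 // ltnW.
Qed.

Hypothesis fint : mu.-integrable [set t : R | 0 <= t < 1] (EFin \o f).

Lemma integral_step : `|\int[mu]_(x in [set t : R | 0 <= t < 1]) f x -
  \sum_(k < n) f (g k) * (g k.+1 - g k)| <= e.
Proof.
have fi (a b : R) : 0 <= a -> b <= 1 -> mu.-integrable [set t : R | a <= t < b] (EFin \o f).
  move=> a0 b1; apply: integrableS fint; try exact (measurable_cc _ _).
  by move=> t /=; lra.
have H m : (m <= n)%N -> `|\int[mu]_(x in [set t : R | 0 <= t < g m]) f x -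
    \sum_(k < m) f (g k) * (g k.+1 - g k)| <= e * g m.
  elim: m => [|m IH] mn.
    rewrite big_ord0 g0 mulr0 (_ : [set t : R | _] = set0).
      by rewrite Rintegral_set0 subrr normr0.
    by rewrite -subset0 => t /=; lra.
  have gm : g m <= g m.+1 by apply: g_le.
  have -> : [set t : R | 0 <= t < g m.+1] =
      [set t : R | 0 <= t < g m] `|` [set t : R | g m <= t < g m.+1].
    apply/seteqP; split=> t /=; last by have := g_ge0 m; case; lra.
    by have [?|?] := ltP t (g m); [left|right]; lra.
  rewrite Rintegral_setU; try exact (measurable_cc _ _); last 2 first.
  - apply: integrableS fint; try exact (measurable_cc _ _).
      by apply: measurableU; exact (measurable_cc _ _).
    by have := g_le1 mn; have := g_ge0 m; move=> ? ? t /= []; lra.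
  - by apply/disj_setPS => t [] /=; lra.
  rewrite big_ord_recr /=.
  have := IH (ltnW mn).
  suff : `|\int[mu]_(x in [set t : R | g m <= t < g m.+1]) f x -
     f (g m) * (g m.+1 - g m)| <= e * (g m.+1 - g m).
    by rewrite !ler_norml => /andP[? ?] /andP[? ?]; apply/andP; split; lra.
  have mI : measurable ([set t : R | g m <= t < g m.+1] : set mR) by exact (measurable_cc _ _).
  have im := fi _ _ (g_ge0 m) (g_le1 mn).
  have Ec (c : R) : \int[mu]_(x in [set t : R | g m <= t < g m.+1]) c = c * (g m.+1 - g m).
    by rewrite Rintegral_cst // mu_itv // ?g_ge0 ?g_le1.
  have ci (c : R) : mu.-integrable ([set t : R | g m <= t < g m.+1]) (EFin \o (fun=> c)).
    by apply: finite_measure_integrable_cst.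
  rewrite ler_norml; apply/andP; split.
    have := @le_Rintegral _ _ _ mu _ (fun=> f (g m) - e) f mI (ci _) im.
    rewrite Ec => h; have := h ltac:(move=> t ht; have := fg mn ht;
      rewrite ler_norml => /andP[]; lra); lra.
  have := @le_Rintegral _ _ _ mu _ f (fun=> f (g m) + e) mI im (ci _).
  rewrite Ec => h; have := h ltac:(move=> t ht; have := fg mn ht;
    rewrite ler_norml => /andP[]; lra); lra.
by have := H n (leqnn n); rewrite gn mulr1.
Qed.

End step_approximation.

(** Averages and integral of [f] are compared with those of a step function on a grid finer than the
    modulus of continuity; for the step function they agree in the limit because [0, x) has both
    frequency and mass [x]. *)
Lemma generic_of_freq : generic_point T mu z.
Proof.
move=> f cf [K [cK KD fK]].
have dE : iet_dom T = [set t : R | 0 <= t < 1] by rewrite dom_iet /dom totT.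
have Dd t : 0 <= t < 1 -> iet_dom T t by rewrite dE.
apply/cvgrPdist_lt => e e0; have e4 : 0 < e / 4 by lra.
have [r r0 hr] := unif_cont_compact_support cf cK KD fK e4.
pose n := (Num.truncn r^-1).+1.
have nr : n%:R^-1 < r.
  by rewrite invf_plt ?posrE ?ltr0n //; apply: truncnS_gt.
have n0 : (0 < n)%N by [].
have fg k t : (k < n)%N -> k%:R / n%:R <= t < k.+1%:R / n%:R ->
    `|f t - f (k%:R / n%:R)| <= e / 4.
  move=> kn /andP[t1 t2]; have nR : 0 < n%:R :> R by rewrite ltr0n.
  have k0 : 0 <= k%:R / n%:R :> R by apply: divr_ge0.
  have k1 : k.+1%:R / n%:R <= 1 :> R by rewrite ler_pdivrMr // mul1r ler_nat.
  apply/ltW/hr; try by apply: Dd; lra.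
  have -> : `|t - k%:R / n%:R| = t - k%:R / n%:R by apply: ger0_norm; lra.
  by move: t2; rewrite -natr1 mulrDl mul1r; lra.
have mf : measurable_fun (iet_dom T : set mR) f.
  apply: subspace_continuous_measurable_fun => //.
  by rewrite dom_iet; exact: measurable_dom.
have fint : mu.-integrable [set t : R | 0 <= t < 1] (EFin \o f).
  rewrite -dE; apply: measurable_bounded_integrable => //.
  - by rewrite dom_iet; exact: measurable_dom.
  - by rewrite ltey_eq fmu // dom_iet; exact: measurable_dom.
  exists (\sum_(k < n) `|f (k%:R / n%:R)| + e / 4); split; first exact: num_real.
  move=> M hM t /=; rewrite dE => ht; apply: le_trans (ltW hM).
  exact: (step_bounded n0 fg).
have e40 := ltW e4.
have h1 := integral_step n0 fg fint.
have /cvgrPdist_lt/(_ _ e4) := @cvg_favg_step f n n0.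
apply: filterS => N h2; have := favg_step n0 e40 fg N; rewrite dE.
move: h1 h2; rewrite -[N%:R^-1 * _]/(favg N f).
set s1 := \sum_(k < n) _; set s2 := favg N (fun _ => _).
rewrite !ler_norml !ltr_norml => /andP[? ?] /andP[? ?] /andP[? ?].
by apply/andP; split; lra.
Qed.

End average.

End equidistribution.

(** * Loops in the Rauzy diagram *)

Section rauzy_walks.
Variable d : nat.

(** A computable form of [rauzy_move], with [okmove] as decidable side condition, so that concrete
    walks are checked by evaluation. *)
Definition rnext (r : rows d) (m : move d) : rows d :=
  let: (top, (w, l)) := m in
  if top then (r.1, insert_after w l (take (size r.2).-1 r.2))
  else (insert_after w l (take (size r.1).-1 r.1), r.2).

Definition okmove (r : rows d) (m : move d) : bool :=
  let: (top, (w, l)) := m in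
  (w != l) && if top then (last l r.1 == w) && (last w r.2 == l)
              else (last w r.1 == l) && (last l r.2 == w).

Lemma okmoveP r m : okmove r m ->
  rauzy_move r m.2 (rnext r m) /\ (last m.2.1 r.1 == m.2.1) = m.1.
Proof.
have L (s : seq 'I_d) x y : y != x -> last y s == x -> s = rcons (take (size s).-1 s) x.
  case/lastP: s => [|s z] yx; first by rewrite /= (negPf yx).
  by rewrite last_rcons => /eqP ->; rewrite size_rcons /= -[in RHS]cats1 -[X in take _ X]cats1 take_size_cat ?cats1.
case: m => [[] [w l]]; case: r => t b /= /andP[wl /andP[h1 h2]].
  have lw : l != w by rewrite eq_sym.
  split; last by rewrite (L _ _ _ lw h1) last_rcons eqxx.
  by have := top_wins (take (size t).-1 t) (take (size b).-1 b) wl; rewrite -(L _ _ _ lw h1) -(L _ _ _ wl h2).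
have lw : l != w by rewrite eq_sym.
split; last by rewrite (L _ _ _ wl h1) last_rcons (negPf lw).
by have := bottom_wins (take (size t).-1 t) (take (size b).-1 b) lw; rewrite -(L _ _ _ wl h1) -(L _ _ _ lw h2).
Qed.

Fixpoint walk (r : rows d) (ms : seq (move d)) : bool :=
  if ms is m :: ms' then okmove r m && walk (rnext r m) ms' else true.

Definition walk_end (r : rows d) ms := foldl rnext r ms.

Lemma walk_cat r ms ms' : walk r (ms ++ ms') = walk r ms && walk (walk_end r ms) ms'.
Proof. by elim: ms r => //= m ms IH r; rewrite IH andbA. Qed.

Lemma walk_end_cat r ms ms' : walk_end r (ms ++ ms') = walk_end (walk_end r ms) ms'.
Proof. exact: foldl_cat. Qed.

Lemma walk_nseq r n m : okmove r m -> rnext r m = r ->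
  walk r (nseq n m) /\ walk_end r (nseq n m) = r.
Proof.
move=> h1 h2; elim: n => //= n [IH1 IH2]; by rewrite h1 h2 IH1; split.
Qed.

Definition evs (st : 'I_d -> seq 'I_d) (ms : seq (move d)) := foldl (@ev d) st ms.

Lemma evs_cat st ms ms' : evs st (ms ++ ms') = evs (evs st ms) ms'.
Proof. exact: foldl_cat. Qed.

Definition pw n (W : seq 'I_d) := flatten (nseq n W).

Lemma pwSr n W : pw n.+1 W = pw n W ++ W.
Proof. by elim: n => [|n IH]; rewrite /pw /= ?cats0 // -catA -[flatten _ ++ W]IH. Qed.

(** The winner tower does not change during the run, so its copies pile up on one side of the loser
    tower. *)
Lemma evs_nseq st n top w l : w != l -> evs st (nseq n (top, (w, l))) =
  fun x => if x == l then (if top then st l ++ pw n (st w) else pw n (st w) ++ st l)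
           else st x.
Proof.
move=> wl; elim: n st => [|n IH] st.
  by apply/funext => x /=; case: eqP => // ->; case: (top); rewrite ?cats0.
rewrite /evs /= -/(evs _ _) IH; apply/funext => x.
rewrite eqxx (negPf wl); case: eqP => // _.
by case: (top); [rewrite -catA|rewrite catA -pwSr].
Qed.

Section path.
Variable q : nat -> move d.

Lemma wrd_evs n j k : wrd q n (j + k)%N = evs (wrd q n j) (mkseq (fun i => q (n + j + i)%N) k).
Proof.
elim: k => [|k IH]; first by rewrite addn0.
by rewrite addnS mkseqS /evs foldl_rcons -/(evs _ _) -IH /= addnA.
Qed.

Variable r0 : rows d.
Hypothesis hwalk : forall n, walk r0 (mkseq q n).

Definition rho_of n := walk_end r0 (mkseq q n).

Lemma rho_ofP n : rauzy_move (rho_of n) (q n).2 (rho_of n.+1) /\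
  (last (q n).2.1 (rho_of n).1 == (q n).2.1) = (q n).1.
Proof.
have := hwalk n.+1; rewrite mkseqS -cats1 walk_cat /= andbT => /andP[_ h].
have -> : rho_of n.+1 = rnext (rho_of n) (q n).
  by rewrite /rho_of /walk_end mkseqS foldl_rcons.
exact: okmoveP h.
Qed.

End path.
End rauzy_walks.

Section visit_matrix.
Variables (R : realType) (d : nat) (q : nat -> move d).
Let p n := (q n).2.

(** The matrix is the abelianization of the tower words; the stacking order recorded by the type is
    lost in it. *)
Lemma visit_mxE n b a : visit_mx R p n b a = (count_mem b (wrd q 0 n a))%:R.
Proof.
elim: n a => [|n IH] a; first by rewrite /= mxE addn0 eq_sym.
rewrite /= mulmxDr mulmx1 mxE; rewrite add0n /p.
have -> : (visit_mx R (fun n0 => (q n0).2) n *m delta_mx (q n).2.1 (q n).2.2) b a =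
    visit_mx R p n b (q n).2.1 * (a == (q n).2.2)%:R.
  rewrite mxE (bigD1 (q n).2.1) //= big1 ?addr0 ?mxE ?eqxx //.
  by move=> i /negPf ib; rewrite mxE ib mulr0.
rewrite !IH; case: (q n) => top [w l] /=; case: eqP => [->|_]; last by rewrite mulr0 addr0.
by rewrite mulr1 -natrD; case: top; rewrite count_cat // addnC.
Qed.

Lemma visit_colE n a : visit_col R p a n = \col_b (count_mem b (wrd q 0 n a))%:R.
Proof. by apply/colP => b; rewrite !mxE visit_mxE. Qed.

Lemma l1norm_visit_col n a : l1norm (visit_col R p a n) = (size (wrd q 0 n a))%:R.
Proof.
rewrite /l1norm visit_colE -sum_count_mem natr_sum; apply: eq_bigr => b _.
by rewrite mxE normr_nat.
Qed.

End visit_matrix.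

Section loops.
Local Open Scope nat_scope.

(* Roles of the letters: a left loop is a right loop with the alphabet reversed. *)
Definition LA (b : bool) := if b then lF else lA.
Definition LB (b : bool) := if b then lE else lB.
Definition LC (b : bool) := if b then lD else lC.
Definition LD (b : bool) := if b then lC else lD.
Definition LE (b : bool) := if b then lB else lE.
Definition LF (b : bool) := if b then lA else lF.

Lemma roleN b : [/\ LA (~~ b) = LF b, LB (~~ b) = LE b, LC (~~ b) = LD b,
  LD (~~ b) = LC b & LE (~~ b) = LB b /\ LF (~~ b) = LA b].
Proof. by case: b. Qed.

Lemma all_roles b (P : 'I_6 -> Prop) :
  P (LA b) -> P (LB b) -> P (LC b) -> P (LD b) -> P (LE b) -> P (LF b) -> forall x, P x.
Proof.
have I6 x : x \in [:: lA; lB; lC; lD; lE; lF].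
  by case: x => -[|[|[|[|[|[|m]]]]]] h; rewrite !inE; do ?[by rewrite -!val_eqE].
case: b => /= h1 h2 h3 h4 h5 h6 x; have := I6 x; rewrite !inE;
  by do ?[case/predU1P => [->//|]] => /eqP ->.
Qed.

Definition lp1 b : seq (move 6) := [:: (~~ b, (LF b, LA b)); (~~ b, (LF b, LB b));
  (b, (LC b, LF b)); (b, (LC b, LE b))].
Definition lp2 b : move 6 := (~~ b, (LD b, LC b)).
Definition lp3 b : seq (move 6) :=
  [:: (b, (LC b, LD b)); (~~ b, (LF b, LC b)); (~~ b, (LF b, LD b))].
Definition lp4 b : move 6 := (b, (LE b, LF b)).
Definition lp5 b : move 6 := (~~ b, (LF b, LE b)).

Definition loopw b r s : seq (move 6) :=
  lp1 b ++ nseq r (lp2 b) ++ lp3 b ++ nseq s (lp4 b) ++ [:: lp5 b].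

Lemma size_loopw b r s : size (loopw b r s) = r + s + 8.
Proof. by rewrite /loopw !size_cat !size_nseq /=; lia. Qed.

(** Both repeated moves fix the rows at which they occur, so the run lengths drop out and evaluation
    settles the rest. *)
Lemma loopw_walk b r s :
  walk perm_pi (loopw b r s) /\ walk_end perm_pi (loopw b r s) = perm_pi.
Proof.
set r1 := walk_end perm_pi (lp1 b).
have [w2 e2] : walk r1 (nseq r (lp2 b)) /\ walk_end r1 (nseq r (lp2 b)) = r1.
  by apply: walk_nseq; rewrite /r1; case: (b).
set r2 := walk_end r1 (lp3 b).
have [w4 e4] : walk r2 (nseq s (lp4 b)) /\ walk_end r2 (nseq s (lp4 b)) = r2.
  by apply: walk_nseq; rewrite /r2 /r1; case: (b).
rewrite /loopw !walk_cat !walk_end_cat -/r1 e2 -/r2 e4 w2 w4.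
by rewrite /r2 /r1; case: (b).
Qed.

(* In a left loop all towers are stacked in the opposite order. *)
Definition cc (b : bool) (x y : seq 'I_6) := if b then y ++ x else x ++ y.

Section one_loop.
Variables (b : bool) (st : 'I_6 -> seq 'I_6).
Let A := LA b. Let B := LB b. Let C := LC b. Let D := LD b. Let E := LE b. Let F := LF b.
Let F1 := cc b (st C) (st F).
Let E1 := cc b (st C) (st E).

(** The state in which the stopping rule for [r] is tested; [evs_mid2] gives the one for [s]. *)
Lemma evs_mid1 j : let st' := evs st (lp1 b ++ nseq j (lp2 b)) in
  [/\ st' A = cc b (st A) (st F), st' B = cc b (st B) (st F),
      st' C = cc b (st C) (pw j (st D)), st' D = st D & st' E = E1 /\ st' F = F1].
Proof.
rewrite evs_cat evs_nseq; last by case: (b).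
by rewrite /F1 /E1 /A /B /C /D /E /F; case: (b); do ?split.
Qed.

Lemma evs_mid2 r j : let st' := evs st (lp1 b ++ nseq r (lp2 b) ++ lp3 b ++ nseq j (lp4 b)) in
  let C1 := cc b (st C) (pw r (st D)) in
  [/\ st' A = cc b (st A) (st F), st' B = cc b (st B) (st F),
      st' C = cc b C1 F1, st' D = cc b (cc b C1 (st D)) F1 &
      st' E = E1 /\ st' F = cc b (pw j E1) F1].
Proof.
rewrite 2!catA 2!evs_cat; set st1 := evs st (lp1 b ++ _).
have [] := evs_mid1 r; rewrite -/st1 evs_nseq; last by case: (b).
by rewrite /F1 /E1 /A /B /C /D /E /F; case: (b) => /= -> -> -> -> [-> ->]; do ?split.
Qed.

Lemma evs_loop r s : let st' := evs st (loopw b r s) in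
  let C1 := cc b (st C) (pw r (st D)) in
  [/\ st' A = cc b (st A) (st F), st' B = cc b (st B) (st F),
      st' C = cc b C1 F1, st' D = cc b (cc b C1 (st D)) F1 &
      st' E = cc b E1 (cc b (pw s E1) F1) /\ st' F = cc b (pw s E1) F1].
Proof.
rewrite /loopw !catA evs_cat -!catA; set st1 := evs st _.
have [] := evs_mid2 r s; rewrite -/st1.
by rewrite /F1 /E1 /A /B /C /D /E /F; case: (b) => /= -> -> -> -> [-> ->]; do ?split.
Qed.

(* [mu] is the length or the number of occurrences of a letter. *)
Variable mu : seq 'I_6 -> nat.
Hypothesis mu_cat : forall x y, mu (x ++ y) = mu x + mu y.

Lemma mu_cc x y : mu (cc b x y) = mu x + mu y.
Proof. by rewrite /cc; case: (b); rewrite mu_cat // addnC. Qed.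

Lemma mu_pw n x : mu (pw n x) = n * mu x.
Proof.
have mu0 : mu [::] = 0 by have := mu_cat [::] [::]; rewrite /=; lia.
by elim: n => [|n IH] //=; rewrite /pw /= mu_cat -/(pw n x) IH mulSn.
Qed.

Lemma mu_loop r s : let st' := evs st (loopw b r s) in
  [/\ mu (st' A) = mu (st A) + mu (st F), mu (st' B) = mu (st B) + mu (st F),
      mu (st' C) = mu (st C) + r * mu (st D) + (mu (st C) + mu (st F)),
      mu (st' D) = mu (st C) + r * mu (st D) + mu (st D) + (mu (st C) + mu (st F)) &
      mu (st' E) = s.+1 * (mu (st C) + mu (st E)) + (mu (st C) + mu (st F)) /\
      mu (st' F) = s * (mu (st C) + mu (st E)) + (mu (st C) + mu (st F))].
Proof.
move=> st'; rewrite {}/st'; have [-> -> -> -> [-> ->]] := evs_loop r s.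
rewrite /F1 /E1 !mu_cc !mu_pw !mu_cc; split=> //; split=> //; lia.
Qed.

End one_loop.
End loops.

(** * Integer inequalities governing the loops *)

Section loop_parameters.
Local Open Scope nat_scope.
Implicit Types (st : 'I_6 -> seq 'I_6).

(* The parameters of the path are a_k = [a_seq k]; then a_(k-1) / k^2 is the
   integer [gap k.-1]. *)
Definition gap k := 4 ^ (k + 6).
Definition a_seq k := gap k * k.+1 ^ 2.

Lemma gap_ge k : 4096 <= gap k.
Proof. by rewrite /gap expnD leq_pmull // expn_gt0. Qed.

Lemma gapS k : gap k.+1 = 4 * gap k.
Proof. by rewrite /gap addSn expnS. Qed.

(** The entry inequalities of loop [k], with minima and maxima unfolded. The last field is extra: it
    lets copies of [C] be charged to [D] when the middle directions are compared. *)
Record loop_inv k st : Prop := Inv {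
  inv_pos : forall x, 0 < size (st x);
  inv_AE : a_seq k * size (st (LE (odd k))) < size (st (LA (odd k)));
  inv_AF : a_seq k * size (st (LF (odd k))) < size (st (LA (odd k)));
  inv_BE : a_seq k * size (st (LE (odd k))) < size (st (LB (odd k)));
  inv_BF : a_seq k * size (st (LF (odd k))) < size (st (LB (odd k)));
  inv_EC : gap k.-1 * size (st (LC (odd k))) < size (st (LE (odd k)));
  inv_ED : gap k.-1 * size (st (LD (odd k))) < size (st (LE (odd k)));
  inv_FC : gap k.-1 * size (st (LC (odd k))) < size (st (LF (odd k)));
  inv_FD : gap k.-1 * size (st (LD (odd k))) < size (st (LF (odd k)));
  inv_CD : size (st (LC (odd k))) <= 2 * size (st (LD (odd k)))
}.

(** The two stopping rules, with column norms expressed through the columns at the start of the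
    loop. *)
Definition r_test k st j :=
  k * (size (st (LC (odd k))) + size (st (LF (odd k)))) <
  size (st (LC (odd k))) + j * size (st (LD (odd k))).

Definition s_test k st j :=
  a_seq k.+1 * maxn (size (st (LA (odd k))) + size (st (LF (odd k))))
                 (size (st (LB (odd k))) + size (st (LF (odd k)))) <
  j * (size (st (LC (odd k))) + size (st (LE (odd k)))) +
  (size (st (LC (odd k))) + size (st (LF (odd k)))).

Record loop_good k st r s : Prop := Good {
  good_odd : odd r;
  good_r : r_test k st r;
  good_rmin : forall j, odd j -> j < r -> ~~ r_test k st j;
  good_s0 : 0 < s;
  good_s : s_test k st s;
  good_smin : forall j, j < s -> ~~ s_test k st j
}.

Lemma a_seq_ge k : 0 < k -> 4096 * k.+1 <= a_seq k.
Proof. by move=> k0; rewrite /a_seq; have := gap_ge k; nia. Qed.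

Lemma exists_good k st : 1 < k -> loop_inv k st -> exists r s, loop_good k st r s.
Proof.
move=> k1 [pos AE AF BE BF EC ED FC FD CD].
have exr : exists r, odd r && r_test k st r.
  exists (2 * (k * (size (st (LC (odd k))) + size (st (LF (odd k)))))).+1.
  rewrite /= mul2n odd_double /= /r_test; have := pos (LD (odd k)); nia.
have exs : exists s, s_test k st s.
  rewrite /s_test; move: (a_seq k.+1 * _) => X; exists X.
  have := pos (LE (odd k)); have := pos (LF (odd k)).
  move: (size _) (size _) (size _) => x y z; nia.
case: (ex_minnP exr) => r /andP[r1 r2] rm; case: (ex_minnP exs) => s s1 sm.
exists r, s; split => //.
- by move=> j oj jr; apply/negP => h; have := rm j; rewrite oj h => /(_ isT); lia.
(* With [s = 0] the rule would ask [C] and [F] together to dominate [A], whereas [A] dominates [F]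
   and [F] dominates [C]. *)
- rewrite lt0n; apply/negP => /eqP s0; move: s1; rewrite s0 /s_test mul0n add0n.
  have := a_seq_ge (ltnW k1); have := a_seq_ge (ltn0Sn k); have := gap_ge k.-1.
  have := pos (LF (odd k)); set m := maxn _ _ => p h1 h2 h3.
  have : size (st (LA (odd k))) <= m by rewrite /m leq_max leq_addr.
  have CF : size (st (LC (odd k))) <= size (st (LF (odd k))) by nia.
  have FA : 4096 * size (st (LF (odd k))) <= size (st (LA (odd k))) by nia.
  have : m <= a_seq k.+1 * m by nia.
  lia.
- by move=> j js; apply/negP => h; have := sm j h; lia.
Qed.

Lemma good_r_upper k st r s : 1 < k -> loop_inv k st -> loop_good k st r s ->
  size (st (LC (odd k))) + r * size (st (LD (odd k))) <=
  k * (size (st (LC (odd k))) + size (st (LF (odd k)))) + 2 * size (st (LD (odd k))).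
Proof.
move=> k1 _ [ro rt rm _ _ _]; case: r ro rt rm => [//|[|r]] ro _ rm; first by nia.
have := rm r; rewrite /= negbK in ro; rewrite ro => /(_ isT); rewrite /r_test -leqNgt.
by move=> h; have {}h := h ltac:(lia); rewrite !mulSn; lia.
Qed.

Section next.
Variables (k : nat) (st : 'I_6 -> seq 'I_6) (r s : nat).
Hypotheses (k1 : 1 < k) (hi : loop_inv k st) (hg : loop_good k st r s).
Let st' := evs st (loopw (odd k) r s).
Local Notation A := (size (st (LA (odd k)))).
Local Notation B := (size (st (LB (odd k)))).
Local Notation C := (size (st (LC (odd k)))).
Local Notation D := (size (st (LD (odd k)))).
Local Notation E := (size (st (LE (odd k)))).
Local Notation F := (size (st (LF (odd k)))).

(** The outer pairs exchange roles. The new large pair dominates by the stopping rule for [s]. The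
    new small pair dominates the middle columns since these are at most [k.+1 ^ 2 * F] by [DF],
    while the old [A] and [B] exceed [a_seq k * F], which is [gap k] times that bound. *)
Lemma inv_next : loop_inv k.+1 st'.
Proof.
have [pos AE AF BE BF EC ED FC FD CD] := hi.
have [_ _ _ s0 sT _] := hg; have rU := good_r_upper k1 hi hg.
have [mA mB mC mD [mE mF]] := mu_loop (odd k) st (@size_cat _) r s.
have [rA rB rC rD [rE rF]] := roleN (odd k).
have h1 := gap_ge k.-1; have h2 := a_seq_ge (ltnW k1).
have A1 : a_seq k = gap k * k.+1 ^ 2 by [].
have r0 : 0 < r by case: hg => h _ _ _ _ _; case: (r) h.
move: sT; rewrite /s_test => sT.
have mxA := leq_maxl (A + F) (B + F).
have mxB := leq_maxr (A + F) (B + F).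
have p x := pos x.
have pA := p (LA (odd k)); have pB := p (LB (odd k)); have pC := p (LC (odd k)).
have pD := p (LD (odd k)); have pE := p (LE (odd k)); have pF := p (LF (odd k)).
have FC' : 4096 * C <= F by apply: leq_trans (ltnW FC); rewrite leq_mul2r h1 orbT.
have FD' : 4096 * D <= F by apply: leq_trans (ltnW FD); rewrite leq_mul2r h1 orbT.
have rD1 : D <= r * D by rewrite leq_pmull.
have M1 : a_seq k.+1 * (A + F) <= a_seq k.+1 * maxn (A + F) (B + F) by rewrite leq_mul2l mxA orbT.
have M2 : a_seq k.+1 * (B + F) <= a_seq k.+1 * maxn (A + F) (B + F) by rewrite leq_mul2l mxB orbT.
have DF : C + r * D + D + (C + F) <= k.+1 ^ 2 * F.
  have kC : k * C <= k * F by rewrite leq_mul2l; apply/orP; right; lia.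
  rewrite mulnDr in rU.
  have : k.+1 ^ 2 * F = k * (k * F) + 2 * (k * F) + F by rewrite expnS expn1; ring.
  have : 2 * (k * F) <= k * (k * F) by rewrite leq_mul2r k1 orbT.
  have : 2 * F <= k * F by rewrite leq_mul2r k1 orbT.
  lia.
have D' : gap k * (C + r * D + D + (C + F)) <= a_seq k * F.
  by rewrite A1 -mulnA leq_mul2l DF orbT.
have C' : gap k * (C + r * D + (C + F)) <= gap k * (C + r * D + D + (C + F)).
  by rewrite leq_mul2l; apply/orP; right; lia.
rewrite mulSn in mE.
split; rewrite /= ?rA ?rB ?rC ?rD ?rE ?rF ?mA ?mB ?mC ?mD ?mE ?mF; try lia.
by apply: (@all_roles (odd k) (fun x => 0 < size (st' x))); rewrite ?mA ?mB ?mC ?mD ?mE ?mF; lia.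
Qed.

End next.
End loop_parameters.

(** * Construction of the path *)

Section path_construction.
Local Open Scope nat_scope.

Definition letters (x : 'I_6) : seq 'I_6 := [:: x].

(* The last two conditions keep the two limit directions apart. *)
Record loop_path (q : nat -> move 6) (n r s : nat -> nat) : Prop := LoopPath {
  lp_walk : forall m, walk perm_pi (mkseq q m);
  lp_end : forall k, 1 < k -> walk_end perm_pi (mkseq q (n k)) = perm_pi;
  lp_n : forall k, 1 < k -> n k.+1 = n k + r k + s k + 8;
  lp_loop : forall k, 1 < k ->
    mkseq (fun i => q (n k + i)) (r k + s k + 8) = loopw (odd k) (r k) (s k);
  lp_inv : forall k, 1 < k -> loop_inv k (wrd q 0 (n k));
  lp_good : forall k, 1 < k -> loop_good k (wrd q 0 (n k)) (r k) (s k);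
  lp_initA : count_mem lE (wrd q 0 (n 2) lB) = 0;
  lp_initE : size (wrd q 0 (n 2) lE) <= 3 * count_mem lE (wrd q 0 (n 2) lE)
}.

(* Locked, since these numbers are too big for unary computation. *)
Definition init_s1 := locked (10 * gap 1).
Definition init_s2 := locked (a_seq 2 * (2 * init_s1 + 6)).
(** A right and a left loop, each with a middle run of length 1. They leave [C] of size 20 and [E],
    [F] of size about [2 * init_s1], whence the factor 10 in [init_s1]; [init_s2] is [a_seq 2] times
    the size of [E], and [A], [B] have size about [7 * init_s2]. *)
Definition init_moves := loopw false 1 init_s1 ++ loopw true 1 init_s2.

Lemma init_sizes : let st := evs letters init_moves in
  [/\ size (st lA) = 7 * init_s2 + 7, size (st lB) = 7 * init_s2 + 14,
      size (st lC) = 20, size (st lD) = 16 &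
      size (st lE) = 2 * init_s1 + 6 /\ size (st lF) = 2 * init_s1 + 4].
Proof.
rewrite /init_moves evs_cat; move: init_s1 init_s2 => s1 s2.
have [a1 b1 c1 d1 [e1 f1]] := mu_loop false letters (@size_cat _) 1 s1.
have [a2 b2 c2 d2 [e2 f2]] := mu_loop true (evs letters (loopw false 1 s1)) (@size_cat _) 1 s2.
rewrite /= in a1 b1 c1 d1 e1 f1 a2 b2 c2 d2 e2 f2.
rewrite a2 b2 c2 d2 e2 f2 a1 b1 c1 d1 e1 f1.
by split; [lia|lia|lia|lia|split; lia].
Qed.

Lemma init_counts : let st := evs letters init_moves in
  count_mem lE (st lB) = 0 /\ count_mem lE (st lE) = init_s1 + 1.
Proof.
rewrite /init_moves evs_cat; move: init_s1 init_s2 => s1 s2.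
have [a1 b1 c1 d1 [e1 f1]] := mu_loop false letters (@count_cat _ (pred1 lE)) 1 s1.
have [a2 b2 c2 d2 [e2 f2]] := mu_loop true (evs letters (loopw false 1 s1))
   (@count_cat _ (pred1 lE)) 1 s2.
rewrite /LA /LB /LC /LD /LE /LF in a1 b1 c1 d1 e1 f1 a2 b2 c2 d2 e2 f2.
rewrite e2 b2 a1 b1 d1 e1 /=.
by split; lia.
Qed.

Lemma init_inv : loop_inv 2 (evs letters init_moves).
Proof.
have [a b c d [e f]] := init_sizes.
have h2 : a_seq 2 * (2 * init_s1 + 6) = init_s2 by apply: lock.
have h1 : init_s1 = 10 * gap 1 by apply: esym; apply: lock.
have h3 := gap_ge 1; have h4 : 0 < a_seq 2 by rewrite /a_seq muln_gt0 expn_gt0.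
have h5 : a_seq 2 * (2 * init_s1 + 4) <= init_s2 by rewrite -h2 leq_mul2l; apply/orP; right; lia.
have p x : 0 < size (evs letters init_moves x).
  by apply: (@all_roles false (fun x => 0 < size (evs letters init_moves x)));
    rewrite /= ?a ?b ?c ?d ?e ?f; lia.
move: init_s1 init_s2 (evs _ _) a b c d e f h1 h2 h5 p => s1 s2 st a b c d e f h1 h2 h5 p.
have o2 : odd 2 = false by [].
have p2 : 2.-1 = 1 by [].
split => //; rewrite ?o2 ?p2 /LA /LB /LC /LD /LE /LF ?a ?b ?c ?d ?e ?f;
  move: (a_seq 2) (gap 1) h1 h2 h3 h4 h5 => a2 g1 h1 h2 h3 h4 h5; lia.
Qed.

(** The run lengths depend on the towers already built, so the finite prefixes [LL k] are
    constructed by recursion, each extending the one before, and [q] is read off them. *)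
Lemma exists_loop_path : exists q n r s, loop_path q n r s.
Proof.
(* Stated for all states, reachable or not, so that choice yields one function before the recursion
   begins. *)
have ex (ks : nat * ('I_6 -> seq 'I_6)) : exists rs : nat * nat,
    1 < ks.1 -> loop_inv ks.1 ks.2 -> loop_good ks.1 ks.2 rs.1 rs.2.
  have [h|h] := EM (1 < ks.1 /\ loop_inv ks.1 ks.2); last first.
    by exists (0, 0) => h1 h2; case: h.
  by have [r [s hg]] := exists_good h.1 h.2; exists (r, s).
have [f hf] := choice ex.
pose fix LL k := if k is k'.+1 then if 1 < k' then
  LL k' ++ loopw (odd k') (f (k', evs letters (LL k'))).1 (f (k', evs letters (LL k'))).2
  else init_moves else init_moves.
pose r k := (f (k, evs letters (LL k))).1; pose s k := (f (k, evs letters (LL k))).2.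
have LLS k : 1 < k -> LL k.+1 = LL k ++ loopw (odd k) (r k) (s k) by move=> /= ->.
have LL2 : LL 2 = init_moves by [].
have pre k l : 1 < k -> k <= l -> exists t, LL l = LL k ++ t.
  move=> k1; elim: l => [|l IH]; first by rewrite leqn0 => /eqP h; rewrite h in k1.
  rewrite leq_eqVlt => /orP[/eqP ->|]; first by exists [::]; rewrite cats0.
  rewrite ltnS => kl; have [t E] := IH kl.
  by rewrite LLS; [rewrite E -catA; eexists|lia].
have sz k : k <= size (LL k.+2).
  elim: k => // k IH; rewrite LLS // size_cat size_loopw; lia.
pose m0 : move 6 := (false, (lA, lA)).
(* By [sz] this prefix has more than [m] moves, so the default is never returned. *)
pose q m := nth m0 (LL m.+3) m.
have qE k i : 1 < k -> i < size (LL k) -> q i = nth m0 (LL k) i.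
  move=> k1 ik; rewrite /q; have szi := sz i.+1.
  have [kl|lk] := leqP k i.+3.
    by have [t ->] := pre _ _ k1 kl; rewrite nth_cat ik.
  have [t ->] := pre i.+3 k isT (ltnW lk); rewrite nth_cat.
  by rewrite (leq_trans _ szi).
have mkq k : 1 < k -> mkseq q (size (LL k)) = LL k.
  move=> k1; apply: (@eq_from_nth _ m0); rewrite size_mkseq // => i ik.
  by rewrite nth_mkseq // (qE k).
have wq k : 1 < k -> wrd q 0 (size (LL k)) = evs letters (LL k).
  move=> k1; have := wrd_evs q 0 0 (size (LL k)); rewrite !add0n => ->.
  by rewrite -[X in evs _ X = _]/(mkseq q (size (LL k))) mkq.
have hw k : 1 < k -> walk perm_pi (LL k) /\ walk_end perm_pi (LL k) = perm_pi.
  elim: k => // k IH; rewrite ltnS leq_eqVlt => /orP[/eqP <-|k1].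
    rewrite LL2 /init_moves walk_cat walk_end_cat.
    have [w1 e1] := loopw_walk false 1 init_s1; have [w2 e2] := loopw_walk true 1 init_s2.
    by rewrite w1 e1 w2 e2.
  have [w1 e1] := IH k1; have [w2 e2] := loopw_walk (odd k) (r k) (s k).
  by rewrite LLS // walk_cat walk_end_cat w1 e1 w2 e2.
have hinv k : 1 < k -> loop_inv k (evs letters (LL k)).
  elim: k => // k IH; rewrite ltnS leq_eqVlt => /orP[/eqP <-|k1].
    by rewrite LL2; exact: init_inv.
  rewrite LLS // evs_cat; apply: inv_next => //; first exact: IH.
  by apply: (hf (k, _)) => //=; exact: IH.
exists q, (fun k => size (LL k)), r, s; split.
- move=> m; have [w _] := hw m.+2 isT.
  have E : LL m.+2 = mkseq q m ++ drop m (LL m.+2).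
    rewrite -{1}(cat_take_drop m (LL m.+2)); congr (_ ++ _).
    rewrite -(mkq m.+2) // /mkseq -map_take take_iota (minn_idPl _) // sz.
  by move: w; rewrite E walk_cat => /andP[].
- by move=> k k1; rewrite mkq //; exact: (hw k k1).2.
- by move=> k k1; rewrite LLS // size_cat size_loopw; lia.
- move=> k k1; apply: (@eq_from_nth _ m0); rewrite size_mkseq ?size_loopw // => i ik.
  rewrite nth_mkseq // (qE k.+1 _ (leqW k1)) ?LLS //; last by rewrite size_cat size_loopw; lia.
  by rewrite nth_cat ltnNge leq_addr /= addKn.
- by move=> k k1; rewrite (wq k k1); exact: hinv.
- by move=> k k1; rewrite (wq k k1); apply: (hf (k, _)) => //=; exact: hinv.
- by rewrite (wq 2 isT) LL2; exact: init_counts.1.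
- rewrite (wq 2 isT) LL2; have [_ _ _ _ [-> _]] := init_sizes.
  have [_ ->] := init_counts; have := gap_ge 1.
  have : init_s1 = 10 * gap 1 by apply: esym; apply: lock.
  by move: init_s1 (gap 1) => ? ?; lia.
Qed.

End path_construction.

Section loop_path_theory.
Variables (q : nat -> move 6) (n r s : nat -> nat).
Hypothesis hq : loop_path q n r s.

Definition sta k := wrd q 0 (n k).

Lemma n_lt k : (1 < k)%N -> (n k < n k.+1)%N.
Proof. by move=> k1; rewrite (lp_n hq k1); lia. Qed.

Lemma n_ge k : (k <= n k.+2)%N.
Proof. by elim: k => // k IH; apply: leq_ltn_trans IH _; apply: n_lt. Qed.

Lemma wrd_next N k : (1 < k)%N -> (N <= n k)%N ->
  wrd q N (n k.+1 - N) = evs (wrd q N (n k - N)) (loopw (odd k) (r k) (s k)).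
Proof.
move=> k1 Nk; have -> : (n k.+1 - N = (n k - N) + (r k + s k + 8))%N.
  by rewrite (lp_n hq k1); lia.
rewrite wrd_evs -(lp_loop hq k1); congr (evs _ _); rewrite /mkseq.
by apply: eq_map => i; congr q; lia.
Qed.

Lemma sta_next k : (1 < k)%N -> sta k.+1 = evs (sta k) (loopw (odd k) (r k) (s k)).
Proof. by move=> k1; have := wrd_next k1 (leq0n _); rewrite !subn0. Qed.

Lemma r_gt0 k : (1 < k)%N -> (0 < r k)%N.
Proof. by move=> k1; have := good_odd (lp_good hq k1); case: (r k). Qed.

Lemma s_gt0 k : (1 < k)%N -> (0 < s k)%N.
Proof. by move=> k1; have := good_s0 (lp_good hq k1). Qed.

Lemma next_ge (mu : seq 'I_6 -> nat) b st r' s' :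
  (forall x y, mu (x ++ y) = mu x + mu y)%N -> (0 < r')%N -> (0 < s')%N ->
  let m x := mu (st x) in let m' x := mu (evs st (loopw b r' s') x) in
  [/\ (m (LA b) + m (LF b) <= m' (LA b))%N, (m (LB b) + m (LF b) <= m' (LB b))%N,
      (m (LC b) + m (LD b) + m (LF b) <= m' (LC b))%N,
      (m (LC b) + m (LD b) + m (LF b) <= m' (LD b))%N &
      (m (LC b) + m (LE b) + m (LF b) <= m' (LE b))%N /\
      (m (LC b) + m (LE b) + m (LF b) <= m' (LF b))%N].
Proof.
move=> mu_cat r0 s0; have [a1 b1 c1 d1 [e1 f1]] := mu_loop b st mu_cat r' s'.
have rD : (mu (st (LD b)) <= r' * mu (st (LD b)))%N by rewrite leq_pmull.
have sE : (mu (st (LC b)) + mu (st (LE b)) <= s' * (mu (st (LC b)) + mu (st (LE b))))%N.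
  by rewrite leq_pmull.
rewrite mulSn in e1.
by split; rewrite ?a1 ?b1 ?c1 ?d1 ?e1 ?f1; [lia|lia|lia|lia|split; lia].
Qed.

(** Four loops beginning with a right one spread every column to all the others. The old column [B]
    needs all four: the first leaves it where it is, the second brings it into [A], and only the
    next left loop distributes [A] to every column. *)
Lemma wrd_positive N : exists j, forall a b, b \in wrd q N j a.
Proof.
have [k [ok k1 Nk]] : exists k, [/\ odd k = false, (1 < k)%N & (N <= n k)%N].
  exists (N.*2.+2); split => //; first by rewrite /= negbK odd_double.
  by have := n_ge N.*2; lia.
exists (n k.+4 - N)%N => a b.
have k2 := leqW k1; have k3 := leqW k2; have k4 := leqW k3.
have Nk1 : (N <= n k.+1)%N by have := n_lt k1; lia.
have Nk2 : (N <= n k.+2)%N by have := n_lt k2; lia.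
have Nk3 : (N <= n k.+3)%N by have := n_lt k3; lia.
rewrite (wrd_next k4 Nk3) (wrd_next k3 Nk2) (wrd_next k2 Nk1) (wrd_next k1 Nk).
set st := wrd q N (n k - N); set st1 := evs st _; set st2 := evs st1 _.
set st3 := evs st2 _.
have st0 x : (0 < count_mem x (st x))%N.
  rewrite -has_count has_pred1 /st; elim: (n k - N)%N x => [|j IH] x.
    by rewrite /= mem_head.
  rewrite wrdS; case: (q (N + j)%N) => t [w l]; case: eqP => // ->.
  by case: t; rewrite mem_cat IH ?orbT.
pose mu := count_mem b.
have mc x y : (mu (x ++ y) = mu x + mu y)%N by exact: count_cat.
have := next_ge (odd k) st mc (r_gt0 k1) (s_gt0 k1); rewrite -/st1.
have := next_ge (odd k.+1) st1 mc (r_gt0 k2) (s_gt0 k2); rewrite -/st2.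
have := next_ge (odd k.+2) st2 mc (r_gt0 k3) (s_gt0 k3); rewrite -/st3.
have := next_ge (odd k.+3) st3 mc (r_gt0 k4) (s_gt0 k4).
set st4 := evs st3 _.
have o1 : odd k.+1 = true by rewrite /= ok.
have o2 : odd k.+2 = false by rewrite /= ok.
have o3 : odd k.+3 = true by rewrite /= ok.
rewrite ok o1 o2 o3 /LA /LB /LC /LD /LE /LF.
move=> [A4 B4 C4 D4 [E4 F4]] [A3 B3 C3 D3 [E3 F3]] [A2 B2 C2 D2 [E2 F2]] [A1 B1 C1 D1 [E1 F1]].
suff : (0 < mu (st4 a))%N by rewrite /mu -has_count has_pred1.
have hb := st0 b; rewrite -/mu in hb.
have all4 : (0 < mu (st lA) + mu (st lB) + mu (st lC) + mu (st lD) + mu (st lE) + mu (st lF))%N.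
  move: b @mu mc A4 B4 C4 D4 E4 F4 A3 B3 C3 D3 E3 F3 A2 B2 C2 D2 E2 F2 A1 B1 C1 D1 E1 F1 hb.
  by apply: (@all_roles false); rewrite /LA /LB /LC /LD /LE /LF => mu *; lia.
by apply: (@all_roles false (fun a => (0 < mu (st4 a))%N));
  rewrite /LA /LB /LC /LD /LE /LF; lia.
Qed.

Lemma sta_grow k x : (1 < k)%N -> (k <= (size (sta k x)).+1)%N.
Proof.
elim: k x => // k IH x; rewrite ltnS leq_eqVlt => /orP[/eqP <-|k1].
  by have := inv_pos (lp_inv hq (isT : 1 < 2)%N) x.
have := next_ge (odd k) (sta k) (@size_cat _) (r_gt0 k1) (s_gt0 k1).
rewrite -(sta_next k1) => -[a b c d [e f]].
have h y := IH y k1.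
have hA := h (LA (odd k)); have hB := h (LB (odd k)); have hC := h (LC (odd k)).
have hD := h (LD (odd k)); have hE := h (LE (odd k)); have hF := h (LF (odd k)).
have p := inv_pos (lp_inv hq k1).
have := p (LF (odd k)); have := p (LC (odd k)); rewrite -/(sta k) => p1 p2.
by apply: (@all_roles (odd k) (fun x => (k.+1 <= (size (sta k.+1 x)).+1)%N)); lia.
Qed.

Lemma wrd_grow N : exists m, forall a, (N <= size (wrd q 0 m a))%N.
Proof. by exists (n N.+2) => a; have := @sta_grow N.+2 a isT; rewrite /sta; lia. Qed.

Lemma wrd_take k i : (1 < k)%N -> (i <= r k + s k + 8)%N ->
  wrd q 0 (n k + i) = evs (sta k) (take i (loopw (odd k) (r k) (s k))).
Proof.
move=> k1 ir; have := wrd_evs q 0 (n k) i; rewrite add0n => ->; congr evs.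
by rewrite -(lp_loop hq k1) /mkseq -map_take take_iota (minn_idPl ir).
Qed.

Lemma wrd_mid1 k j : (1 < k)%N -> (j <= r k)%N ->
  wrd q 0 (n k + 4 + j) = evs (sta k) (lp1 (odd k) ++ nseq j (lp2 (odd k))).
Proof.
move=> k1 jr; rewrite -addnA wrd_take //; last by lia.
congr evs; rewrite /loopw -{1}(subnKC jr) nseqD -catA catA take_size_cat //=.
by rewrite size_nseq; lia.
Qed.

Lemma wrd_mid2 k j : (1 < k)%N -> (j <= s k)%N ->
  wrd q 0 (n k + r k + j + 7) = evs (sta k) (lp1 (odd k) ++ nseq (r k) (lp2 (odd k))
    ++ lp3 (odd k) ++ nseq j (lp4 (odd k))).
Proof.
move=> k1 js; rewrite -!addnA wrd_take //; last by lia.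
congr evs; rewrite /loopw -{1}(subnKC js) nseqD -catA !catA -catA take_size_cat ?catA //.
by rewrite !size_cat !size_nseq /=; lia.
Qed.

Section real.
Variable R : realType.
Let p m := (q m).2.
Let a k : R := (a_seq k)%:R.

Lemma col_size x m : l1norm (visit_col R p x m) = (size (wrd q 0 m x))%:R.
Proof. exact: l1norm_visit_col. Qed.

Lemma lt_scale_max (c x y z : nat) : (c * x < z)%N -> (c * y < z)%N ->
  c%:R * Num.max x%:R y%:R < z%:R :> R.
Proof. by move=> h1 h2; rewrite /Num.max; case: ifP => _; rewrite -natrM ltr_nat. Qed.

Lemma max_nat (x y : nat) : Num.max x%:R y%:R = (maxn x y)%:R :> R.
Proof. by rewrite natr_max. Qed.

Lemma path_is_loop k : (1 < k)%N -> let b := odd k in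
  @is_loop R (LA b) (LB b) (LC b) (LD b) (LE b) (LF b) a p k (n k) (r k) (s k).
Proof.
move=> k1 b; rewrite /is_loop.
have [pos AE AF BE BF EC ED FC FD CD] := lp_inv hq k1.
have [ro rt rm s0 st sm] := lp_good hq k1.
rewrite -!/(sta k) -/b in AE AF BE BF EC ED FC FD CD rt rm st sm.
split.
- split; rewrite !col_size -/(sta k).
    by rewrite lt_min /a !lt_scale_max.
  (* The square in [a_seq k.-1] cancels, which leaves an integer ratio. *)
  have -> : a k.-1 / k%:R ^+ 2 = (gap k.-1)%:R.
    rewrite /a /a_seq natrM natrX prednK ?(ltnW k1) // mulfK //.
    by rewrite expf_neq0 // pnatr_eq0; lia.
  by rewrite lt_min !lt_scale_max.
- rewrite -[LHS]/(mkseq (snd \o (fun i => q (n k + i)%N)) _) /mkseq map_comp.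
  rewrite -/(mkseq _ _) (lp_loop hq k1) /loopw !map_cat !map_nseq -/b.
  by case: (b).
- have E j : (j <= r k)%N ->
      (k%:R * l1norm (visit_col R p (LF b) (n k + 4 + j)) <
       l1norm (visit_col R p (LC b) (n k + 4 + j))) = r_test k (sta k) j.
    move=> jr; rewrite !col_size wrd_mid1 // -/b.
    have [_ _ -> _ [_ ->]] := evs_mid1 b (sta k) j.
    rewrite !mu_cc ?mu_pw; try exact: size_cat.
    by rewrite -natrM ltr_nat /r_test -/b.
  split=> //; first by rewrite E.
  by move=> j oj jr; rewrite E ?(ltnW jr) //; apply: rm.
- have E j : (j <= s k)%N ->
      (a k.+1 * Num.max (l1norm (visit_col R p (LA b) (n k + r k + j + 7)))
       (l1norm (visit_col R p (LB b) (n k + r k + j + 7))) <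
       l1norm (visit_col R p (LF b) (n k + r k + j + 7))) = s_test k (sta k) j.
    move=> js; rewrite !col_size wrd_mid2 // -/b.
    have [-> -> _ _ [_ ->]] := evs_mid2 b (sta k) (r k) j.
    rewrite !mu_cc ?mu_pw; try exact: size_cat.
    rewrite !mu_cc; try exact: size_cat.
    by rewrite max_nat -natrM ltr_nat /s_test -/b.
  split=> //; first by rewrite E.
  by move=> j js; rewrite E ?(ltnW js) //; apply: sm.
Qed.

Lemma path_alternating : alternating_loop_path a p n.
Proof.
exists 2%N, r, s, (rho_of q perm_pi); split => //.
- by split=> // m; case: (rho_ofP (lp_walk hq) m).
- by move=> k k1; apply: (lp_end hq).
- by move=> k k1; apply: (lp_n hq).
- by move=> k k1; have := path_is_loop k1; case: (odd k).
Qed.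

End real.
End loop_path_theory.

(** * Limit directions *)

Section deviations.
Variable R : realType.
Implicit Types (u v w : 'I_6 -> R) (W : seq 'I_6).

Definition dist1 u v : R := \sum_x `|u x - v x|.
Definition prob_vec u := (forall x, 0 <= u x) /\ \sum_x u x = 1.
Definition freqs W x : R := (count_mem x W)%:R / (size W)%:R.
(** Length of [W] times the l1 distance of its frequencies from [v]; without normalization it is
    subadditive under concatenation. *)
Definition dev v W : R := \sum_x `|(count_mem x W)%:R - (size W)%:R * v x|.

Lemma dist1_ge0 u v : 0 <= dist1 u v. Proof. exact: sumr_ge0. Qed.

Lemma dist1_sym u v : dist1 u v = dist1 v u.
Proof. by apply: eq_bigr => x _; rewrite distrC. Qed.

Lemma dist1_tri v u w : dist1 u w <= dist1 u v + dist1 v w.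
Proof. by rewrite /dist1 -big_split; apply: ler_sum => x _; apply: ler_distD. Qed.

Lemma dist1_refl u : dist1 u u = 0.
Proof. by rewrite /dist1 big1 // => x _; rewrite subrr normr0. Qed.

Lemma le_dist1 u v x : `|u x - v x| <= dist1 u v.
Proof. by rewrite /dist1 (bigD1 x) //= lerDl; apply: sumr_ge0. Qed.

Lemma dist1_simp u v : prob_vec u -> prob_vec v -> dist1 u v <= 2.
Proof.
move=> [u0 u1] [v0 v1]; have -> : 2 = \sum_x (u x + v x) by rewrite big_split u1 v1.
apply: ler_sum => x _; apply: le_trans (ler_normB _ _) _.
by rewrite !ger0_norm.
Qed.

Lemma dev_cat v W1 W2 : dev v (W1 ++ W2) <= dev v W1 + dev v W2.
Proof.
rewrite /dev -big_split; apply: ler_sum => x _; apply: le_trans (ler_normD _ _).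
by rewrite le_eqVlt; apply/orP; left; apply/eqP; congr `|_|;
  rewrite count_cat size_cat !natrD /=; ring.
Qed.

Lemma dev_cc v b W1 W2 : dev v (cc b W1 W2) <= dev v W1 + dev v W2.
Proof. by rewrite /cc; case: b; [rewrite [X in _ <= X]addrC|]; apply: dev_cat. Qed.

Lemma dev_nil v : dev v [::] = 0.
Proof. by rewrite /dev big1 // => x _; rewrite mul0r subrr normr0. Qed.

Lemma dev_pw v n W : dev v (pw n W) <= n%:R * dev v W.
Proof.
elim: n => [|n IH]; first by rewrite dev_nil mul0r.
rewrite -natr1 mulrDl mul1r addrC; apply: le_trans (dev_cat _ _ _) _.
by rewrite lerD2l.
Qed.

Lemma sum_count_memR W : \sum_x (count_mem x W)%:R = (size W)%:R :> R.
Proof. by rewrite -natr_sum sum_count_mem. Qed.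

Lemma freqs_simp W : (0 < size W)%N -> prob_vec (freqs W).
Proof.
move=> W0; split=> [x|]; first by apply: divr_ge0.
by rewrite -mulr_suml sum_count_memR divff // pnatr_eq0 -lt0n.
Qed.

Lemma dev_freqs v W : (0 < size W)%N -> dev v W = (size W)%:R * dist1 (freqs W) v.
Proof.
move=> W0; rewrite /dev /dist1 mulr_sumr; apply: eq_bigr => x _.
rewrite -[X in _ = X * _]ger0_norm // -normrM; congr `|_|.
by rewrite mulrBr /freqs [_ * (_ / _)]mulrC divfK // pnatr_eq0 -lt0n.
Qed.

Lemma dev_le2 v W : prob_vec v -> dev v W <= 2 * (size W)%:R.
Proof.
move=> hv; have [W0|W0] := posnP (size W).
  by have /size0nil -> := W0; rewrite dev_nil mulr0.
rewrite dev_freqs // mulrC ler_wpM2r //; apply: dist1_simp => //; exact: freqs_simp.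
Qed.

(** Copies of [W0] do not deviate from the frequencies of [W0], so only [Rest] counts, and its
    deviation is at most twice its length. *)
Lemma freqs_close W0 W Rest m (c : R) : (0 < size W0)%N -> (0 < size W)%N ->
  (forall x, count_mem x W = m * count_mem x W0 + count_mem x Rest)%N ->
  (size Rest)%:R <= c * (size W)%:R -> dist1 (freqs W) (freqs W0) <= 2 * c.
Proof.
move=> p0 p hc hR; have pR : 0 < (size W)%:R :> R by rewrite ltr0n.
have sW : size W = (m * size W0 + size Rest)%N.
  by rewrite -!sum_count_mem big_distrr -big_split; apply: eq_bigr => x _; rewrite hc.
rewrite -(ler_pM2l pR) -dev_freqs //.
have -> : dev (freqs W0) W = dev (freqs W0) Rest.
  apply: eq_bigr => x _; congr `|_|; rewrite hc sW !natrD !natrM /freqs mulrDl.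
  rewrite -mulrA [(size W0)%:R * _]mulrC divfK ?pnatr_eq0 -?lt0n //; ring.
apply: le_trans (dev_le2 _ (freqs_simp p0)) _.
by rewrite mulrCA ler_wpM2l // mulrC.
Qed.

Definition near v (e : R) W := dev v W <= e * (size W)%:R.

Lemma near_cc v e b W1 W2 : near v e W1 -> near v e W2 -> near v e (cc b W1 W2).
Proof.
rewrite /near => h1 h2; apply: le_trans (dev_cc _ _ _ _) _.
by rewrite (mu_cc b (@size_cat _)) natrD mulrDr lerD.
Qed.

Lemma near_ccR v e e' b W1 W2 : prob_vec v -> 0 <= e -> near v e W1 ->
  2 * (size W2)%:R <= e' * (size W1)%:R -> near v (e + e') (cc b W1 W2).
Proof.
rewrite /near => hv e0 h1 h2; apply: le_trans (dev_cc _ _ _ _) _.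
have h3 := dev_le2 W2 hv; rewrite (mu_cc b (@size_cat _)) natrD mulrDr !mulrDl.
have : 0 <= (size W2)%:R :> R by []. 
have : 0 <= e * (size W2)%:R by apply: mulr_ge0.
have [e'0|e'0] := leP 0 e'.
  have : 0 <= e' * (size W2)%:R by apply: mulr_ge0.
  lra.
have : e' * (size W1)%:R <= 0 by apply: mulr_le0_ge0 => //; apply: ltW.
move=> h4 h5 h6; have -> : (size W2)%:R = 0 :> R by lra.
lra.
Qed.

End deviations.

Section geometric_limits.
Variable R : realType.

Lemma le_lim (f : nat -> R) l c N : f @ \oo --> l -> (forall m, (N <= m)%N -> f m <= c) ->
  l <= c.
Proof.
move=> fl h; rewrite leNgt; apply/negP => cl.
have /cvgrPdist_lt/(_ (l - c)) : f @ \oo --> l by [].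
case=> [|M _ hM]; first lra.
have := hM (maxn M N) (leq_maxl _ _); have := h (maxn M N) (leq_maxr _ _).
rewrite ltr_norml => ? /andP[_ ?]; lra.
Qed.

(** The steps from [k] on add up to at most 4/3 of the bound on the first, rounded up to 2. *)
Lemma geometric_cvg (U : nat -> 'I_6 -> R) (c : R) k0 : 0 <= c ->
  (forall k, (k0 <= k)%N -> dist1 (U k.+1) (U k) <= c * 4^-1 ^+ k) ->
  exists u, (forall x, U k x @[k --> \oo] --> u x) /\
    forall k, (k0 <= k)%N -> dist1 (U k) u <= 2 * c * 4^-1 ^+ k.
Proof.
move=> c0 hU.
have e0 k : 0 <= c * 4^-1 ^+ k by rewrite mulr_ge0 // exprn_ge0 // invr_ge0.
have tel k j : (k0 <= k)%N -> dist1 (U k) (U (k + j)%N) <= 2 * c * 4^-1 ^+ k - 2 * c * 4^-1 ^+ (k + j).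
  move=> kk; elim: j => [|j IH].
    by rewrite addn0 dist1_refl; have := e0 k; lra.
  apply: le_trans (dist1_tri (U (k + j)%N) _ _) _.
  have := hU (k + j)%N (leq_trans kk (leq_addr _ _)); rewrite dist1_sym addnS.
  rewrite [4^-1 ^+ (k + j).+1]exprS; have := e0 (k + j)%N; lra.
have cx x : exists l : R, U k x @[k --> \oo] --> l.
  (* Subtracting the bound on the remaining steps makes the coordinate monotone. *)
  pose f k := U (k0 + k)%N x - 2 * c * 4^-1 ^+ (k0 + k).
  have fnd : nondecreasing_seq f.
    apply/nondecreasing_seqP => k; rewrite /f addnS.
    have := hU (k0 + k)%N (leq_addr _ _); have := le_dist1 (U (k0 + k).+1) (U (k0 + k)%N) x.
    have := ler_norm (U (k0 + k)%N x - U (k0 + k).+1 x); rewrite distrC.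
    by rewrite exprS; have := e0 (k0 + k)%N; lra.
  have fub : has_ubound (range f).
    exists (U k0 x + 2 * c * 4^-1 ^+ k0) => _ [k _ <-]; rewrite /f.
    have := tel k0 k (leqnn _); have := le_dist1 (U k0) (U (k0 + k)%N) x.
    have := ler_norm (U (k0 + k)%N x - U k0 x); rewrite distrC.
    by have := e0 (k0 + k)%N; lra.
  have cf := nondecreasing_cvgn fnd fub.
  exists (sup (range f)); rewrite -(cvg_shiftn k0).
  have -> : (fun k => U (k + k0)%N x) = f \+ (fun k => 2 * c * 4^-1 ^+ k0 * 4^-1 ^+ k).
    by apply/funext => k; rewrite /f /= addnC exprD; ring.
  have -> : sup (range f) = sup (range f) + 2 * c * 4^-1 ^+ k0 * 0.
    by rewrite mulr0 addr0.
  apply: cvgD => //; apply: cvgMl_tmp.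
  by apply: cvg_expr; rewrite ger0_norm ?invr_ge0 // invf_lt1 //; lra.
have [u hu] := choice cx; exists u; split=> // k kk.
apply: (@le_lim (fun m => dist1 (U k) (U m)) _ _ k).
  apply: cvg_sum_seq => x; apply: cvg_norm; apply: cvgB => //; exact: cvg_cst.
move=> m km; have := tel k (m - k)%N kk; rewrite subnKC //; have := e0 m; lra.
Qed.

Lemma lim_simp (U : nat -> 'I_6 -> R) (u : 'I_6 -> R) N : (forall k, (N <= k)%N -> prob_vec (U k)) ->
  (forall x, U k x @[k --> \oo] --> u x) -> prob_vec u.
Proof.
move=> hU hu; split=> [x|].
  rewrite -oppr_le0; apply: (@le_lim (fun k => - U k x) _ _ N); first by apply: cvgN.
  by move=> k Nk; rewrite oppr_le0; case: (hU k Nk).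
have h := @cvg_sum_seq R _ (index_enum 'I_6) _ _ hu.
apply: le_anti; apply/andP; split.
  by apply: (le_lim h (N := N)) => k Nk; case: (hU k Nk) => _ ->.
rewrite -lerN2; apply: (@le_lim (fun k => - \sum_(b <- index_enum 'I_6) U k b) _ _ N).
  exact: cvgN.
by move=> k Nk; case: (hU k Nk) => _ ->.
Qed.

End geometric_limits.

Section limits.
Variables (R : realType) (q : nat -> move 6) (n r s : nat -> nat).
Hypothesis hq : loop_path q n r s.
Let st k := sta q n k.
Local Notation Q := (4^-1 : R).

Lemma Q0 k : 0 < Q ^+ k. Proof. by rewrite exprn_gt0 // invr_gt0. Qed.

Lemma gapQ k : (0 < k)%N -> (gap k.-1)%:R^-1 = Q ^+ (k + 5) :> R.
Proof. by move=> k0; rewrite /gap natrX -exprVn; congr (_ ^+ _); lia. Qed.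

Lemma freqs_close_nat W0 W Rest m k : (1 < k)%N -> (0 < size W0)%N -> (0 < size W)%N ->
  (forall x, count_mem x W = m * count_mem x W0 + count_mem x Rest)%N ->
  (gap k.-1 * size Rest <= 2 * size W)%N -> dist1 (freqs R W) (freqs R W0) <= Q ^+ 4 * Q ^+ k.
Proof.
move=> k1 p0 p hc hR.
have -> : Q ^+ 4 * Q ^+ k = 2 * (2 * (gap k.-1)%:R^-1).
  by rewrite gapQ ?(ltnW k1) // exprD; field.
apply: (freqs_close p0 p hc); rewrite -mulrA mulrCA ler_pdivlMl; last first.
  by rewrite ltr0n; have := gap_ge k.-1; lia.
by rewrite -!natrM ler_nat.
Qed.

Lemma sta_pos k x : (1 < k)%N -> (0 < size (st k x))%N.
Proof. by move=> k1; apply: (inv_pos (lp_inv hq k1)). Qed.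

(** [A] and [B] gain only the negligible [F]. The new [E] and the new [F] both consist mainly of
    copies of the old [E]: the [C] in each copy is negligible by the entry inequalities, the final
    [C] and [F] by the stopping rule for [s]. Hence the new [F] is close to the old [E], not to the
    old [F]. *)
Lemma close_next k : (1 < k)%N -> let b := odd k in
  let cl x y := dist1 (freqs R (st k.+1 x)) (freqs R (st k y)) <= Q ^+ 4 * Q ^+ k in
  [/\ cl (LA b) (LA b), cl (LB b) (LB b), cl (LE b) (LE b) & cl (LF b) (LE b)].
Proof.
move=> k1 b cl.
have [pos AE AF BE BF EC ED FC FD CD] := lp_inv hq k1.
have [_ _ _ s0 sT _] := lp_good hq k1.
rewrite -!/(sta q n k) -!/(st k) -/b /s_test -/b in pos AE AF BE BF EC ED FC FD CD sT.
have {}AF : (a_seq k * size (st k (LF b)) < size (st k (LA b)))%N := AF.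
have {}BF : (a_seq k * size (st k (LF b)) < size (st k (LB b)))%N := BF.
have {}sT : (a_seq k.+1 * maxn (size (st k (LA b)) + size (st k (LF b)))
    (size (st k (LB b)) + size (st k (LF b))) <
  s k * (size (st k (LC b)) + size (st k (LE b))) +
  (size (st k (LC b)) + size (st k (LF b))))%N := sT.
have hs := sta_next hq k1; rewrite -!/(st _) -/b in hs.
have [mA mB _ _ [mE mF]] := mu_loop b (st k) (@size_cat _) (r k) (s k).
have cnt x := mu_loop b (st k) (@count_cat _ (pred1 x)) (r k) (s k).
have p1 x := sta_pos x (leqW k1); have p0 x := sta_pos x k1.
rewrite -hs in mA mB mE mF.
have g1 := gap_ge k.-1.
have ag : (16 * gap k.-1 <= a_seq k.+1)%N.
  rewrite /a_seq (_ : gap k.+1 = 16 * gap k.-1)%N; last by rewrite gapS -[in LHS](prednK (ltnW k1)) gapS; lia.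
  by rewrite leq_pmulr // expn_gt0.
have ak : (gap k.-1 <= a_seq k)%N.
  have gk : (gap k = 4 * gap k.-1)%N by rewrite -gapS prednK // ltnW.
  apply: (@leq_trans (gap k)); first by lia.
  by rewrite /a_seq leq_pmulr // expn_gt0.
have CF : (size (st k (LC b)) <= size (st k (LF b)))%N.
  by apply: leq_trans (ltnW FC); rewrite leq_pmull //; lia.
have main t : (s k <= t)%N -> (gap k.-1 * size (pw t (st k (LC b)) ++ st k (LC b) ++ st k (LF b)) <=
    2 * (t * (size (st k (LC b)) + size (st k (LE b))) + (size (st k (LC b)) + size (st k (LF b)))))%N.
  move=> st'; rewrite !size_cat mu_pw; last exact: size_cat.
  have h1 : (gap k.-1 * (t * size (st k (LC b))) <= t * size (st k (LE b)))%N.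
    by rewrite mulnCA leq_mul2l (ltnW EC) orbT.
  have h2 : (gap k.-1 * (size (st k (LC b)) + size (st k (LF b))) <=
      gap k.-1 * (2 * size (st k (LF b))))%N.
    by rewrite leq_mul2l; apply/orP; right; lia.
  have h3 : (a_seq k.+1 * size (st k (LF b)) <= a_seq k.+1 *
      maxn (size (st k (LA b)) + size (st k (LF b))) (size (st k (LB b)) + size (st k (LF b))))%N.
    rewrite leq_mul2l; apply/orP; right; apply: leq_trans (leq_maxl _ _); exact: leq_addl.
  have h4 : (16 * gap k.-1 * size (st k (LF b)) <= a_seq k.+1 * size (st k (LF b)))%N.
    by rewrite leq_mul2r ag orbT.
  have h5 : (s k * (size (st k (LC b)) + size (st k (LE b))) <=
     t * (size (st k (LC b)) + size (st k (LE b))))%N by rewrite leq_mul2r st' orbT.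
  rewrite mulnDr; lia.
rewrite /cl; split.
- apply: (@freqs_close_nat _ _ (st k (LF b)) 1) => // [x|].
    by have [h _ _ _ _] := cnt x; rewrite hs h mul1n.
  rewrite mA; apply: leq_trans (leq_mul ak (leqnn _)) _.
  apply: leq_trans (ltnW AF) _; apply: leq_trans (leq_addr (size (st k (LF b))) _) _.
  by rewrite leq_pmull.
- apply: (@freqs_close_nat _ _ (st k (LF b)) 1) => // [x|].
    by have [_ h _ _ _] := cnt x; rewrite hs h mul1n.
  rewrite mB; apply: leq_trans (leq_mul ak (leqnn _)) _.
  apply: leq_trans (ltnW BF) _; apply: leq_trans (leq_addr (size (st k (LF b))) _) _.
  by rewrite leq_pmull.
- apply: (@freqs_close_nat _ _ (pw (s k).+1 (st k (LC b)) ++ st k (LC b) ++ st k (LF b)) (s k).+1) => // [x|].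
    have [_ _ _ _ [h _]] := cnt x; rewrite hs h !count_cat mu_pw; last exact: count_cat.
    by rewrite mulnDr; lia.
  by rewrite mE; apply: main.
- apply: (@freqs_close_nat _ _ (pw (s k) (st k (LC b)) ++ st k (LC b) ++ st k (LF b)) (s k)) => // [x|].
    have [_ _ _ _ [_ h]] := cnt x; rewrite hs h !count_cat mu_pw; last exact: count_cat.
    by rewrite mulnDr; lia.
  by rewrite mF; apply: main.
Qed.

(** Column [y] is close to itself across every loop and defines the limit. Column [x] is close to
    itself when it is in the large pair and to the previous [y] when in the small one, so it is
    controlled by [y] one or two loops earlier. *)
Lemma limit_direction b : exists u : 'I_6 -> R,
  [/\ prob_vec u, dist1 (freqs R (st 2 (LB b))) u <= 2 * Q ^+ 4 * Q ^+ 2 &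
  forall k, (3 < k)%N ->
    dist1 (freqs R (st k (LA b))) u <= Q ^+ k /\ dist1 (freqs R (st k (LB b))) u <= Q ^+ k].
Proof.
set x := LA b; set y := LB b.
have next k : (2 <= k)%N -> dist1 (freqs R (st k.+1 y)) (freqs R (st k y)) <= Q ^+ 4 * Q ^+ k /\
    dist1 (freqs R (st k.+1 x)) (freqs R (st k (if odd k == b then x else y))) <= Q ^+ 4 * Q ^+ k.
  by rewrite /x /y => /close_next []; case: (odd k); case: (b).
have [u [hu du]] := geometric_cvg (ltW (Q0 4)) (fun k k2 => proj1 (next k k2)).
exists u; split.
- by apply: (lim_simp _ hu (N := 2%N)) => k k2; apply/freqs_simp/sta_pos.
- exact: du.
have E4 : Q ^+ 4 = 256^-1 by rewrite exprVn -natrX.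
move=> [|k] // k3; have k2 : (2 <= k)%N by lia.
have hB := du k.+1 (leqW k2); have e := Q0 k.
split; last by rewrite E4 in hB; have := Q0 k.+1; lra.
have [_] := next k k2; case: eqP => ok h.
  have [k' k'E] : exists k', k = k'.+1 by exists k.-1; rewrite prednK // ltnW.
  have k1 : (2 <= k')%N by lia.
  have [_] := next k' k1; rewrite k'E /= in ok h e *; rewrite -ok.
  have -> : (odd k' == ~~ odd k') = false by case: (odd k').
  move=> f; have := dist1_tri (freqs R (st k'.+1 x)) (freqs R (st k'.+2 x)) u.
  have := dist1_tri (freqs R (st k' y)) (freqs R (st k'.+1 x)) u; have := du k' k1.
  have := Q0 k'; move: (Q ^+ 4) E4 h f => ? -> h f; rewrite !exprS in h *.
  lra.
have := dist1_tri (freqs R (st k y)) (freqs R (st k.+1 x)) u; have := du k k2.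
by move: (Q ^+ 4) E4 h => ? -> h; rewrite exprS; lra.
Qed.

(** The endpoints differ in the letter [E]: at time [n 2] its frequency is 0 in column [B] and at
    least 1/3 in column [E], and all later loops change these by far less. *)
Lemma exists_limits : exists u v : 'I_6 -> R, [/\ prob_vec u, prob_vec v, u lE < v lE,
  forall k, (3 < k)%N -> dist1 (freqs R (st k lA)) u <= Q ^+ k /\ dist1 (freqs R (st k lB)) u <= Q ^+ k &
  forall k, (3 < k)%N -> dist1 (freqs R (st k lE)) v <= Q ^+ k /\ dist1 (freqs R (st k lF)) v <= Q ^+ k].
Proof.
have [u [su h1 hu]] := limit_direction false; have [v [sv h2 hv]] := limit_direction true.
exists u, v; split=> //; last by move=> k /hv[].
have := le_dist1 (freqs R (st 2 lB)) u lE; have := le_dist1 (freqs R (st 2 lE)) v lE.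
have -> : freqs R (st 2 lB) lE = 0 by rewrite /freqs /st /sta (lp_initA hq) mul0r.
have h3 : 3^-1 <= freqs R (st 2 lE) lE.
  rewrite /freqs ler_pdivlMr ?ltr0n ?sta_pos // ler_pdivrMl //.
  by rewrite -natrM ler_nat; apply: (lp_initE hq).
have E4 : Q ^+ 4 = 256^-1 by rewrite exprVn -natrX.
have E2 : Q ^+ 2 = 16^-1 by rewrite exprVn -natrX.
rewrite E4 E2 /LB in h1 h2; rewrite sub0r normrN.
have := ler_norm (freqs R (st 2 lE) lE - v lE); have := ler_norm (u lE); lra.
Qed.

End limits.

(** * Outer columns between loop times *)

Section near_paths.
Variables (R : realType) (q : nat -> move 6) (n r s : nat -> nat).
Hypothesis hq : loop_path q n r s.
Let st k := sta q n k.
Local Notation Q := (4^-1 : R).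
Variables u v : 'I_6 -> R.
Hypotheses (su : prob_vec u) (sv : prob_vec v).
Hypothesis hu : forall k, (3 < k)%N ->
  dist1 (freqs R (st k lA)) u <= Q ^+ k /\ dist1 (freqs R (st k lB)) u <= Q ^+ k.
Hypothesis hv : forall k, (3 < k)%N ->
  dist1 (freqs R (st k lE)) v <= Q ^+ k /\ dist1 (freqs R (st k lF)) v <= Q ^+ k.

(** Limit directions of the large pair [LA], [LB] and of the small pair [LE], [LF] in a loop of
    parity [b]. *)
Definition big_dir (b : bool) := if b then v else u.
Definition small_dir (b : bool) := if b then u else v.

Lemma small_dir_simp b : prob_vec (small_dir b).
Proof. by case: b. Qed.

Lemma big_dir_simp b : prob_vec (big_dir b).
Proof. by case: b. Qed.

Lemma near_dist1 (w : 'I_6 -> R) e W : (0 < size W)%N -> near w e W <-> dist1 (freqs R W) w <= e.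
Proof.
move=> W0; rewrite /near dev_freqs // mulrC ler_pM2r // ltr0n //.
Qed.

Lemma near_le (w : 'I_6 -> R) e e' W : e <= e' -> near w e W -> near w e' W.
Proof. by move=> h h1; apply: le_trans h1 _; apply: ler_wpM2r. Qed.

Lemma near_cat (w : 'I_6 -> R) e W1 W2 : near w e W1 -> near w e W2 -> near w e (W1 ++ W2).
Proof. exact: (@near_cc _ _ _ false). Qed.

Lemma near_roles k : (3 < k)%N -> let b := odd k in
  [/\ near (big_dir b) (Q ^+ k) (st k (LA b)), near (big_dir b) (Q ^+ k) (st k (LB b)),
      near (small_dir b) (Q ^+ k) (st k (LE b)) & near (small_dir b) (Q ^+ k) (st k (LF b))].
Proof.
move=> k3 b; have k1 : (1 < k)%N by lia.
have [h1 h2] := hu k3; have [h3 h4] := hv k3.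
by rewrite /b; case: (odd k); split; apply/near_dist1 => //; apply: (sta_pos hq).
Qed.

Let nears b e (S : 'I_6 -> seq 'I_6) := [/\ near (big_dir b) e (S (LA b)),
  near (big_dir b) e (S (LB b)), near (small_dir b) e (S (LE b)) &
  near (small_dir b) e (S (LF b))].

(** [A] and [B] do not lose, and [E], [F] lose only to each other; every move of a loop after the
    fourth is of this kind. *)
Definition tail_move b (m : move 6) := let: (t, (w, l)) := m in
  [&& l != LA b, l != LB b & (l \in [:: LE b; LF b]) ==> (w \in [:: LE b; LF b])].

Lemma nears_tail b e S ms : all (tail_move b) ms -> nears b e S -> nears b e (evs S ms).
Proof.
elim: ms S => //= -[t [w l]] ms IH S /andP[/and3P[lA lB lw] /IH{}IH] [h1 h2 h3 h4].
apply: IH; have hw x : x \in [:: LE b; LF b] -> near (small_dir b) e (S x).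
  by rewrite !inE => /orP[] /eqP ->.
have hx x : x \in [:: LE b; LF b] -> near (small_dir b) e (@ev 6 S (t, (w, l)) x).
  move=> xx; rewrite /=; case: eqP => [xl|_]; last exact: hw.
  rewrite xl in xx; rewrite xx in lw.
  by case: (t); apply: near_cat; apply: hw.
split; try by apply: hx; rewrite !inE eqxx ?orbT.
  by rewrite /= eq_sym (negPf lA).
by rewrite /= eq_sym (negPf lB).
Qed.

Lemma scale_small k (x y : nat) : (1 < k)%N -> (gap k.-1 * x < y)%N ->
  2 * x%:R <= Q ^+ k * y%:R.
Proof.
move=> k1 h; have g0 : 0 < (gap k.-1)%:R :> R by rewrite ltr0n; have := gap_ge k.-1; lia.
have hy : (gap k.-1)%:R * x%:R <= y%:R :> R by rewrite -natrM ler_nat ltnW.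
have -> : Q ^+ k = 1024 * (gap k.-1)%:R^-1.
  by rewrite gapQ ?(ltnW k1) // exprD; have -> : Q ^+ 5 = 1024^-1; [rewrite exprVn -natrX|field].
have h2 : x%:R <= (gap k.-1)%:R^-1 * y%:R :> R by rewrite ler_pdivlMl.
have : 0 <= x%:R :> R by [].
by rewrite -mulrA; lra.
Qed.

(** Foreign columns enter the outer ones only in the first four moves: [F] enters [A] and [B], and
    [C] enters [E] and [F]. Their relative size costs a second [Q ^+ k]; the later moves preserve
    the bounds. *)
Lemma near_path k i : (3 < k)%N -> (i <= r k + s k + 8)%N ->
  nears (odd k) (2 * Q ^+ k) (wrd q 0 (n k + i)).
Proof.
move=> k3 ir; have k1 : (1 < k)%N by lia.
rewrite (wrd_take hq k1 ir) -/(st k).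
have [nA nB nE nF] := near_roles k3.
have [pos AE AF BE BF EC ED FC FD CD] := lp_inv hq k1.
have ak : (gap k.-1 <= a_seq k)%N.
  have gk : (gap k = 4 * gap k.-1)%N by rewrite -gapS prednK // ltnW.
  by apply: (@leq_trans (gap k)); [lia|rewrite /a_seq leq_pmulr // expn_gt0].
have Q2 : Q ^+ k <= 2 * Q ^+ k by have := Q0 R k; lra.
have e2 : 2 * Q ^+ k = Q ^+ k + Q ^+ k by lra.
have eg := ltW (Q0 R k).
have ccN b x y : cc b x y = cc (~~ b) y x by case: b.
have nA' : near (big_dir (odd k)) (2 * Q ^+ k) (cc (odd k) (st k (LA (odd k))) (st k (LF (odd k)))).
  rewrite e2; apply: near_ccR => //; first exact: big_dir_simp.
  by apply: scale_small => //; apply: leq_ltn_trans AF; rewrite leq_mul2r ak orbT.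
have nB' : near (big_dir (odd k)) (2 * Q ^+ k) (cc (odd k) (st k (LB (odd k))) (st k (LF (odd k)))).
  rewrite e2; apply: near_ccR => //; first exact: big_dir_simp.
  by apply: scale_small => //; apply: leq_ltn_trans BF; rewrite leq_mul2r ak orbT.
have nE' : near (small_dir (odd k)) (2 * Q ^+ k) (cc (odd k) (st k (LC (odd k))) (st k (LE (odd k)))).
  by rewrite e2 ccN; apply: near_ccR => //; [exact: small_dir_simp|exact: scale_small].
have nF' : near (small_dir (odd k)) (2 * Q ^+ k) (cc (odd k) (st k (LC (odd k))) (st k (LF (odd k)))).
  by rewrite e2 ccN; apply: near_ccR => //; [exact: small_dir_simp|exact: scale_small].
have {}nA := near_le Q2 nA; have {}nB := near_le Q2 nB.
have {}nE := near_le Q2 nE; have {}nF := near_le Q2 nF.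
have [i4|i4] := ltnP i 4.
  have -> : take i (loopw (odd k) (r k) (s k)) = take i (lp1 (odd k)).
    by rewrite /loopw take_cat (_ : size (lp1 _) = 4%N) // i4.
  move: nA' nB' nE' nF' nA nB nE nF; rewrite /nears.
  by case: i i4 {ir} => [|[|[|[|]]]] // _; case: (odd k) => *; split.
have -> : take i (loopw (odd k) (r k) (s k)) = lp1 (odd k) ++ take (i - 4)
   (nseq (r k) (lp2 (odd k)) ++ lp3 (odd k) ++ nseq (s k) (lp4 (odd k)) ++ [:: lp5 (odd k)]).
  by rewrite /loopw take_cat (_ : size (lp1 _) = 4%N) // ltnNge i4.
rewrite evs_cat; apply: nears_tail.
  apply/allP => m /mem_take; apply/allP; rewrite !all_cat !all_nseq.
  by case: (odd k); rewrite /= !orbT.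
have := evs_mid1 (odd k) (st k) 0; rewrite -[nseq 0 _]/[::] cats0.
by move=> [h1 h2 _ _ [h3 h4]]; rewrite /nears h1 h2 h3 h4.
Qed.

Lemma n_find m k0 : (1 < k0)%N -> (n k0 <= m)%N ->
  exists k i, [/\ (k0 <= k)%N, (i <= r k + s k + 8)%N & m = (n k + i)%N].
Proof.
move=> k1 km; pose P k := (k0 <= k)%N && (m < n k.+1)%N.
have exP : exists k, P k.
  exists (maxn k0 m.+2); rewrite /P leq_maxl /=.
  have h : (1 < maxn k0 m.+2)%N by rewrite leq_max k1.
  have := n_ge hq (maxn k0 m.+2).-1; have := leq_maxr k0 m.+2.
  move: (maxn k0 m.+2) h => [//|[//|l]] _ /=; lia.
case: (ex_minnP exP) => k /andP[kk mk] hmin.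
have nk : (n k <= m)%N.
  rewrite leqNgt; apply/negP => mnk; have kk0 : (k0 < k)%N.
    rewrite ltn_neqAle kk andbT; apply/eqP => h; rewrite -h in mnk; lia.
  have := hmin k.-1; rewrite /P prednK; last by lia.
  by rewrite mnk andbT => h; have := h ltac:(lia); lia.
exists k, (m - n k)%N; split=> //; last by rewrite subnKC.
by have := lp_n hq (leq_trans k1 kk); lia.
Qed.

Lemma cvg_dir (e : R) : 0 < e -> exists N, forall m, (N <= m)%N ->
  [/\ dist1 (freqs R (wrd q 0 m lA)) u < e, dist1 (freqs R (wrd q 0 m lB)) u < e,
      dist1 (freqs R (wrd q 0 m lE)) v < e & dist1 (freqs R (wrd q 0 m lF)) v < e].
Proof.
move=> e0; have Qlim : (fun k => 2 * Q ^+ k) @ \oo --> (2 * 0 : R).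
  by apply: cvgMl_tmp; apply: cvg_expr; rewrite ger0_norm ?invr_ge0 // invf_lt1 //; lra.
have /cvgrPdist_lt/(_ e e0) [k0 _ hk0] := Qlim.
exists (n (maxn k0 4)) => m nm; have k1 : (1 < maxn k0 4)%N by rewrite leq_max orbT.
have [k [i [kk ir ->]]] := n_find k1 nm; rewrite geq_max in kk; case/andP: kk => kk0 k4.
have Qk : 2 * Q ^+ k < e.
  have Qp : 0 < 2 * Q ^+ k by have := Q0 R k; lra.
  by have := hk0 k kk0; rewrite /= mulr0 sub0r normrN gtr0_norm.
have wpos x : (0 < size (wrd q 0 (n k + i) x))%N.
  by elim: (n k + i)%N x => // j IH x; rewrite wrdS; case: (q _) => t [w l];
    case: eqP => // _; case: t; rewrite size_cat addn_gt0 !IH.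
have := near_path k4 ir; rewrite /nears.
by case: (odd k) => -[/(near_dist1 _ _ (wpos _)) h1 /(near_dist1 _ _ (wpos _)) h2
  /(near_dist1 _ _ (wpos _)) h3 /(near_dist1 _ _ (wpos _)) h4]; split; lra.
Qed.

End near_paths.

(** * Direction of the middle columns *)

Section middle_limit.
Variables (R : realType) (q : nat -> move 6) (n r s : nat -> nat).
Hypothesis hq : loop_path q n r s.
Let st k := sta q n k.
Local Notation Q := (4^-1 : R).
Variables u v : 'I_6 -> R.
Hypotheses (su : prob_vec u) (sv : prob_vec v).
Hypothesis hu : forall k, (3 < k)%N ->
  dist1 (freqs R (st k lA)) u <= Q ^+ k /\ dist1 (freqs R (st k lB)) u <= Q ^+ k.
Hypothesis hv : forall k, (3 < k)%N ->
  dist1 (freqs R (st k lE)) v <= Q ^+ k /\ dist1 (freqs R (st k lF)) v <= Q ^+ k.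

Definition mid x : R := (u x + v x) / 2.

(* The direction tracked by the middle columns: each loop mixes in the small
   direction with weight 1/(k+1), alternately v and u. *)
Definition mid_k k x : R := mid x + (odd k)%:R * ((v x - u x) / (2 * k%:R)).

Lemma mid_simp : prob_vec mid.
Proof.
have [u0 u1] := su; have [v0 v1] := sv; split=> [x|].
  by rewrite /mid; have := u0 x; have := v0 x; lra.
by rewrite /mid -mulr_suml big_split /= u1 v1; lra.
Qed.

(** The exact recursion of a running average, which the loops obey up to the errors in
    [mid_step]. *)
Lemma mid_kS k x : (0 < k)%N -> k.+1%:R * mid_k k.+1 x = k%:R * mid_k k x + small_dir u v (odd k) x.
Proof.
move=> k0; have kR : k%:R != 0 :> R by rewrite pnatr_eq0 -lt0n.
have kR1 : k.+1%:R != 0 :> R by rewrite pnatr_eq0.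
rewrite /mid_k /= /small_dir /mid; case: (odd k) => /=.
  rewrite mul0r addr0 mul1r -!(natr1 k); field; exact: kR.
rewrite mul0r addr0 mul1r; rewrite -!(natr1 k) in kR1 *; field; exact: kR1.
Qed.

Lemma mid_k_simp k : (0 < k)%N -> prob_vec (mid_k k).
Proof.
move=> k0; have [u0 u1] := su; have [v0 v1] := sv.
have kR : 1 <= k%:R :> R by rewrite ler1n.
have [_ m1] := mid_simp; split=> [x|].
  have h1 := u0 x; have h2 := v0 x; rewrite /mid_k /mid; case: (odd k) => /=; last by rewrite mul0r; lra.
  have k2 : 0 < (2 * k%:R)^-1 :> R by rewrite invr_gt0; lra.
  have k3 : (2 * k%:R)^-1 <= 2^-1 :> R.
    by rewrite lef_pV2 ?posrE; lra.
  rewrite mul1r; move: (_^-1) k2 k3 => i k2 k3.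
  have : u x * i <= u x * 2^-1 by apply: ler_wpM2l.
  have : 0 <= v x * i by apply: mulr_ge0 => //; lra.
  lra.
rewrite /mid_k big_split /= m1 -mulr_sumr -mulr_suml sumrB u1 v1.
by rewrite subrr mul0r mulr0 addr0.
Qed.

Lemma dist1_mid_k k : (0 < k)%N -> dist1 (mid_k k) mid <= k%:R^-1.
Proof.
move=> k0; have h := dist1_simp sv su.
have kR : 0 < k%:R :> R by rewrite ltr0n.
have -> : dist1 (mid_k k) mid = (odd k)%:R * (2 * k%:R)^-1 * dist1 v u.
  rewrite /dist1 mulr_sumr; apply: eq_bigr => x _.
  rewrite /mid_k addrAC subrr add0r !normrM ger0_norm // [X in _ * (_ * X)]ger0_norm.
    by ring.
  by rewrite invr_ge0; lra.
have i0 : 0 < k%:R^-1 :> R by rewrite invr_gt0.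
have d0 := dist1_ge0 v u; rewrite invfM; case: (odd k) => /=; last by rewrite !mul0r ltW.
rewrite mul1r; move: (k%:R^-1) i0 => i i0.
have : i * dist1 v u <= i * 2 by rewrite ler_pM2l.
lra.
Qed.

Let dd k := st k (LD (odd k)).
Let ccc k := st k (LC (odd k)).

Section one_step.
Variable k : nat.
Hypothesis k3 : (3 < k)%N.
Let b := odd k.
Let k1 : (1 < k)%N. Proof. by move: k3; lia. Qed.
Let d : nat := size (dd k).
Let c : nat := size (ccc k).
Let f : nat := size (st k (LF b)).
Let d' : nat := size (dd k.+1).

Let invk := lp_inv hq k1.
Let goodk := lp_good hq k1.

Lemma next_cols x : [/\ count_mem x (dd k.+1) =
    count_mem x (ccc k) + r k * count_mem x (dd k) + (count_mem x (ccc k) + count_mem x (st k (LF b))) &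
  count_mem x (ccc k.+1) = count_mem x (dd k.+1) + count_mem x (dd k)]%N.
Proof.
have [_ _ h1 h2 _] := mu_loop b (st k) (@count_cat _ (pred1 x)) (r k) (s k).
have [_ _ rC rD _] := roleN b.
rewrite /dd /ccc /= -/b rD rC /st (sta_next hq k1) -/b h1 h2.
by split=> //; rewrite addnAC.
Qed.

Lemma next_sizes : [/\ d' = c + r k * d + (c + f) & size (ccc k.+1) = d' + d]%N.
Proof.
have [_ _ h1 h2 _] := mu_loop b (st k) (@size_cat _) (r k) (s k).
have [_ _ rC rD _] := roleN b.
rewrite /d' /c /d /f /dd /ccc /= -/b rD rC /st (sta_next hq k1) -/b h1 h2.
by split=> //; rewrite addnAC.
Qed.

Let h_lower : (k * (c + f) < c + r k * d)%N.
Proof. exact: (good_r goodk). Qed.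

Let h_upper : (c + r k * d <= k * (c + f) + 2 * d)%N.
Proof. exact: (good_r_upper k1 invk goodk). Qed.

Let c_d : (c <= 2 * d)%N.
Proof. exact: (inv_CD invk). Qed.

Let d_f : (gap k.-1 * d < f)%N.
Proof. exact: (inv_FD invk). Qed.

Let d_d' : d%:R <= Q ^+ (k + 5) * d'%:R :> R.
Proof.
have [E _] := next_sizes; rewrite -gapQ ?(ltnW k1) // ler_pdivlMl.
  by rewrite -natrM ler_nat E; apply: leq_trans (ltnW d_f) _; lia.
by rewrite ltr0n; have := gap_ge k.-1; lia.
Qed.

Let d0 : (0 < d)%N. Proof. exact: (sta_pos hq). Qed.
Let d'0 : (0 < d')%N. Proof. by apply: (sta_pos hq); lia. Qed.

(** The run of the old [D] has weight about k/(k+1) and the pair [C], [F] about 1/(k+1), so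
    multiplication by [k.+1] makes the recursion nonexpanding. The error [Q ^+ k] is the distance of
    [F] from its limit; the remaining errors are multiples of [d], which is tiny against [d']. *)
Lemma mid_step : k.+1%:R * dist1 (freqs R (dd k.+1)) (mid_k k.+1) <=
  k%:R * dist1 (freqs R (dd k)) (mid_k k) + Q ^+ k + (16 * k%:R + 20) * Q ^+ (k + 5).
Proof.
set phi := small_dir u v b; set w' := mid_k k.+1; set w := mid_k k.
have k0 : (0 < k)%N := ltnW k1.
have sw : prob_vec w := mid_k_simp k0.
have sw' : prob_vec w' by apply: mid_k_simp.
have sphi : prob_vec phi by exact: small_dir_simp.
have [Ed' _] := next_sizes.
pose F := ccc k ++ st k (LF b).
have Fsz : (size F)%:R = c%:R + f%:R :> R by rewrite size_cat natrD.
have main : dev w' (dd k.+1) <= (r k)%:R * dev w (dd k) + dev phi F + dev w' (ccc k) +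
   dist1 w w' * `|(r k)%:R * d%:R - k%:R * (size F)%:R|.
  rewrite /dev /dist1 mulr_sumr mulr_suml -!big_split; apply: ler_sum => x _ /=.
  have E1 : phi x = (k%:R + 1) * w' x - k%:R * w x.
    by have := mid_kS x k0; rewrite -natr1 -/w' -/w -/b -/phi; lra.
  have [cx _] := next_cols x.
  have -> : (count_mem x (dd k.+1))%:R - (size (dd k.+1))%:R * w' x =
      (r k)%:R * ((count_mem x (dd k))%:R - (size (dd k))%:R * w x) +
      ((count_mem x F)%:R - (size F)%:R * phi x) +
      ((count_mem x (ccc k))%:R - (size (ccc k))%:R * w' x) +
      (w x - w' x) * ((r k)%:R * d%:R - k%:R * (size F)%:R).
    rewrite -/d' -/d -/c cx Ed' E1 Fsz /F count_cat !natrD !natrM; ring.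
  apply: le_trans (ler_normD _ _) _; rewrite normrM lerD2r.
  apply: le_trans (ler_normD _ _) _; rewrite lerD2r.
  apply: le_trans (ler_normD _ _) _; rewrite lerD2r normrM ger0_norm //.
have hF : dev phi F <= Q ^+ k * f%:R + 2 * c%:R.
  apply: le_trans (dev_cat _ _ _) _; rewrite addrC lerD //; last exact: dev_le2.
  by have [_ _ _ h] := near_roles hq hu hv k3.
have hc := dev_le2 (ccc k) sw'; rewrite -/c in hc.
have hD := dist1_simp sw sw'.
have cd : c%:R <= 2 * d%:R :> R by rewrite -natrM ler_nat.
have hZ : `|(r k)%:R * d%:R - k%:R * (size F)%:R| <= 4 * d%:R :> R.
  have h1 : k%:R * (size F)%:R <= c%:R + (r k)%:R * d%:R :> R.
    by rewrite Fsz -!natrD -!natrM -!natrD ler_nat ltnW.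
  have h2 : c%:R + (r k)%:R * d%:R <= k%:R * (size F)%:R + 2 * d%:R :> R.
    by rewrite Fsz -!natrD -!natrM -!natrD ler_nat.
  have h3 : 0 <= c%:R :> R by [].
  by apply/ler_normlP; split; lra.
(* The mismatch between the run and [k] times the pair costs 8 [d]; with 4 [d] for each of the two
   occurrences of [C] this gives the 16 below. *)
have hDZ : dist1 w w' * `|(r k)%:R * d%:R - k%:R * (size F)%:R| <= 2 * (4 * d%:R).
  by apply: ler_pM => //; apply: dist1_ge0.
set e := dist1 (freqs R (dd k)) w; set e' := dist1 (freqs R (dd k.+1)) w'.
have De : dev w (dd k) = d%:R * e by rewrite dev_freqs.
have De' : dev w' (dd k.+1) = d'%:R * e' by rewrite dev_freqs.
have e0 : 0 <= e by apply: dist1_ge0.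
have e2 : e <= 2 by apply: dist1_simp => //; apply: freqs_simp.
have dR : 0 < d%:R :> R by rewrite ltr0n.
have d'R : 0 < d'%:R :> R by rewrite ltr0n.
have h1 : d'%:R * e' <= (r k)%:R * d%:R * e + Q ^+ k * (size F)%:R + 16 * d%:R.
  rewrite -De'; apply: le_trans main _; rewrite De mulrA.
  have h1 : 0 <= Q ^+ k * c%:R by rewrite mulr_ge0 // ltW // Q0.
  have h2 : Q ^+ k * (size F)%:R = Q ^+ k * c%:R + Q ^+ k * f%:R by rewrite Fsz mulrDr.
  by lra.
have h2 : k.+1%:R * ((r k)%:R * d%:R) <= k%:R * d'%:R + 2 * d%:R :> R.
  have A (rd krd kc kf d2 : nat) : (c + rd <= kc + kf + d2 ->
    rd + krd <= kc + krd + (kc + kf) + d2)%N by clear; lia.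
  by rewrite -!natrM -!natrD ler_nat Ed' mulSn !mulnDr; apply: A; rewrite -mulnDr.
have h3 : k.+1%:R * (size F)%:R <= d'%:R :> R.
  have A (cf kcf rd : nat) : (kcf < c + rd -> cf + kcf <= c + rd + cf)%N by clear; lia.
  by rewrite Fsz -!natrD -!natrM ler_nat Ed' mulSn; apply: A.
rewrite -(ler_pM2l d'R).
have h4 : k.+1%:R * (d'%:R * e') <= k.+1%:R *
    ((r k)%:R * d%:R * e + Q ^+ k * (size F)%:R + 16 * d%:R) by apply: ler_wpM2l.
have h5 : k.+1%:R * ((r k)%:R * d%:R) * e <= (k%:R * d'%:R + 2 * d%:R) * e.
  by apply: ler_wpM2r.
have h6 : Q ^+ k * (k.+1%:R * (size F)%:R) <= Q ^+ k * d'%:R.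
  by apply: ler_wpM2l => //; rewrite ltW // Q0.
have h7 : d%:R * e <= d%:R * 2 by rewrite ler_pM2l.
have h8 : (16 * k%:R + 20) * d%:R <= (16 * k%:R + 20) * (Q ^+ (k + 5) * d'%:R).
  by apply: ler_wpM2l; rewrite ?d_d' // addr_ge0 ?mulr_ge0.
have kk : k.+1%:R = k%:R + 1 :> R by rewrite natr1.
move: h4 h5 h6; rewrite kk; lra.
Qed.

End one_step.

Local Notation H := (2^-1 : R).

Let err k : (0 < k)%N -> Q ^+ k + (16 * k%:R + 20) * Q ^+ (k + 5) <= 2 * H ^+ k.
Proof.
move=> k0; rewrite exprD; have -> : Q ^+ 5 = 1024^-1 by rewrite exprVn -natrX.
have -> : Q = H * H by field.
rewrite exprMn; have h0 : 0 < H ^+ k by rewrite exprn_gt0 // invr_gt0.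
have h1 : (k%:R + 2) * H ^+ k <= 2.
  rewrite exprVn ler_pdivrMr ?exprn_gt0 //.
  rewrite -natrX -natrD -natrM ler_nat; have := ltn_expl k (isT : 1 < 2)%N; lia.
have kR : 1 <= k%:R :> R by rewrite ler1n.
have h2 : (k%:R + 2) * H ^+ k * H ^+ k <= 2 * H ^+ k by rewrite ler_pM2r.
have h3 : (0 : R) <= k%:R * (H ^+ k * H ^+ k) by rewrite !mulr_ge0 // ltW.
have h4 : 0 <= H ^+ k * H ^+ k by rewrite mulr_ge0 // ltW.
lra.
Qed.

(** The added term [4 * H ^+ k] decreases by [2 * H ^+ k] at each step, which is the bound [err] on
    the error, so the sum never increases; at [k = 4] it is at most 8 + 1/4. *)
Lemma mid_bound k : (3 < k)%N -> k%:R * dist1 (freqs R (dd k)) (mid_k k) <= 12.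
Proof.
have pos j x : (3 < j)%N -> (0 < size (st j x))%N by move=> j3; apply: (sta_pos hq); lia.
suff hh : (3 < k)%N -> k%:R * dist1 (freqs R (dd k)) (mid_k k) + 4 * H ^+ k <= 12.
  move=> /hh; have : 0 < H ^+ k by rewrite exprn_gt0 // invr_gt0.
  lra.
elim: k => // k IH; rewrite ltnS leq_eqVlt => /orP[/eqP <-|k3].
  have h1 : dist1 (freqs R (dd 4)) (mid_k 4) <= 2.
    by apply: dist1_simp; [apply/freqs_simp/pos|apply: mid_k_simp].
  have -> : H ^+ 4 = 16^-1 by rewrite exprVn -natrX.
  lra.
have := mid_step k3; have := IH k3; have := err (ltnW (ltnW (ltnW k3))).
rewrite [H ^+ k.+1]exprS; have : 0 < H ^+ k by rewrite exprn_gt0 // invr_gt0.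
lra.
Qed.

(** The constant 13 is the 12 of [mid_bound] plus 1 for the distance from [mid_k k] to [mid]. The
    new [C] has the letters of the new [D] and the old [D]; the index shift for the latter doubles
    the constant. *)
Lemma near_mid k : (4 < k)%N -> near mid (26 / k%:R) (dd k) /\ near mid (26 / k%:R) (ccc k).
Proof.
have pos j x : (3 < j)%N -> (0 < size (st j x))%N by move=> j3; apply: (sta_pos hq); lia.
have hd j : (3 < j)%N -> near mid (13 / j%:R) (dd j).
  move=> j3; apply/near_dist1; first exact: pos.
  have j0 : (0 < j)%N by lia.
  have jR : 0 < j%:R :> R by rewrite ltr0n.
  apply: le_trans (dist1_tri (mid_k j) _ _) _.
  have h1 : dist1 (freqs R (dd j)) (mid_k j) <= 12 / j%:R.
    by rewrite ler_pdivlMr // mulrC mid_bound.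
  have h2 := dist1_mid_k j0; rewrite -[_^-1]mul1r in h2.
  have -> : 13 / j%:R = 12 / j%:R + 1 / j%:R :> R by rewrite -mulrDl; congr (_ / _); lra.
  exact: lerD.
case: k => // k; rewrite ltnS => k3.
have kR : 4 <= k%:R :> R by rewrite ler_nat.
have kR1 : 0 < k.+1%:R :> R by rewrite ltr0n.
have k1E : k.+1%:R = k%:R + 1 :> R by rewrite natr1.
have b1 : 13 / k.+1%:R <= 26 / k.+1%:R :> R by rewrite ler_pM2r ?invr_gt0 //; lra.
have b2 : 13 / k%:R <= 26 / k.+1%:R :> R.
  by rewrite ler_pdivrMr; [rewrite mulrAC ler_pdivlMr //; lra|lra].
have hd1 := near_le b1 (hd k.+1 (leqW k3)); have hd0 := near_le b2 (hd k k3).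
split=> //; rewrite /near.
have -> : dev mid (ccc k.+1) = dev mid (dd k.+1 ++ dd k).
  have [_ sz2] := next_sizes k3.
  apply: eq_bigr => x _; have [_ cx2] := next_cols k3 x.
  by rewrite cx2 sz2 count_cat size_cat.
have [_ ->] := next_sizes k3; rewrite -size_cat; exact: near_cat.
Qed.

End middle_limit.

(** * The generic point *)

Section prefix_deviation.
Variables (R : realType) (q : nat -> move 6) (n r s : nat -> nat).
Hypothesis hq : loop_path q n r s.
Variable w : 'I_6 -> R.
Hypothesis sw : prob_vec w.
Let st k := sta q n k.
Let dd k := st k (LD (odd k)).
Let ccc k := st k (LC (odd k)).
Let ff k := st k (LF (odd k)).
Variable eps : nat -> R.
Hypothesis eps0 : forall k, 0 <= eps k.
Hypothesis near_dc : forall k, (4 < k)%N -> near w (eps k) (dd k) /\ near w (eps k) (ccc k).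

(** What surrounds the run of [D] in the word of [LC b], the letter that plays the role of [D] in
    the next loop; see [word_C]. *)
Definition pre_word (b : bool) := if b then [:: LF b; LC b] else [:: LC b].
Definition post_word (b : bool) := if b then [:: LC b] else [:: LC b; LF b].

Lemma pw_letter m (x : 'I_6) : pw m [:: x] = nseq m x.
Proof. by elim: m => //= m IH; rewrite /pw /= -/(pw m [:: x]) IH. Qed.

Lemma word_C b r' s' : evs letters (loopw b r' s') (LC b) =
  pre_word b ++ nseq r' (LD b) ++ post_word b.
Proof.
have [_ _ -> _ _] := evs_loop b letters r' s'.
by rewrite /letters pw_letter /cc /pre_word /post_word; case: b => /=; rewrite -?catA.
Qed.

Lemma dev_take_le2 i W : dev w (take i W) <= 2 * (size W)%:R.
Proof.
apply: le_trans (dev_le2 _ sw) _; rewrite ler_pM2l ?ltr0n // ler_nat size_take.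
by case: ltnP => // /ltnW.
Qed.

(** Complete blocks are either near [w] or charged twice their length; the last, broken block costs
    [M]. *)
Lemma take_blocks (good : pred (seq 'I_6)) (e M : R) (Bs : seq (seq 'I_6)) i : 0 <= e ->
  (forall B, B \in Bs -> good B -> near w e B) ->
  (forall B, B \in Bs -> forall j, (j <= size B)%N -> dev w (take j B) <= e * j%:R + M) ->
  (i <= size (flatten Bs))%N -> 0 <= M ->
  dev w (take i (flatten Bs)) <=
    e * i%:R + 2 * (\sum_(B <- Bs | ~~ good B) (size B)%:R) + M.
Proof.
move=> e0; elim: Bs i => [|B Bs IH] i hg hM.
  by rewrite big_nil leqn0 => /eqP -> M0; rewrite dev_nil !mulr0 !add0r.
rewrite /= take_cat size_cat big_cons => iB M0.
have sge : 0 <= \sum_(B0 <- Bs | ~~ good B0) (size B0)%:R :> R by apply: sumr_ge0.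
have [iB'|iB'] := ltnP i (size B).
  have := hM B (mem_head _ _) i (ltnW iB'); case: (good B) => /=; first by lra.
  have : 0 <= (size B)%:R :> R by []. 
  by lra.
have {}IH := IH (i - size B)%N (fun B' h => hg B' (mem_behead (h : B' \in behead (B :: Bs))))
  (fun B' h => hM B' (mem_behead (h : B' \in behead (B :: Bs)))) ltac:(lia) M0.
apply: le_trans (dev_cat _ _ _) _.
have -> : i%:R = (size B)%:R + (i - size B)%:R :> R by rewrite -natrD subnKC.
have hB : 0 <= e * (size B)%:R by apply: mulr_ge0.
case gB: (good B) => /=.
  by have := hg B (mem_head _ _) gB; rewrite /near mulrDr; lra.
by have := dev_le2 B sw; rewrite mulrDr; lra.
Qed.

Section level.
Variable k : nat.
Hypothesis k4 : (4 < k)%N.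
Let b := odd k.
Let k1 : (1 < k)%N. Proof. by lia. Qed.
Let e := eps k.
Let e0 : 0 <= e := eps0 k.

Let d_f : (4096 * size (dd k) <= size (ff k))%N.
Proof.
apply: leq_trans (ltnW (inv_FD (lp_inv hq k1))).
by rewrite leq_mul2r gap_ge orbT.
Qed.

Let c_f : (size (ccc k) <= size (ff k))%N.
Proof.
apply: leq_trans (ltnW (inv_FC (lp_inv hq k1))).
by rewrite leq_pmull //; have := gap_ge k.-1; lia.
Qed.

Definition blocksD (d c f : seq 'I_6) m := if b then [:: f; c] ++ nseq m d ++ [:: c]
  else [:: c] ++ nseq m d ++ [:: c; f].

Lemma dd_blocks : dd k.+1 = flatten (blocksD (dd k) (ccc k) (ff k) (r k)).
Proof.
have [_ _ h1 h2 _] := evs_loop b (st k) (r k) (s k).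
have [_ _ rC rD _] := roleN b.
rewrite /dd /= -/b rD /st (sta_next hq k1) -/b h1 /blocksD /cc /ccc /ff /pw -/b.
by case: (b); rewrite /= flatten_cat /= ?cats0 -?catA.
Qed.

Lemma ccc_blocks : ccc k.+1 = flatten (blocksD (dd k) (ccc k) (ff k) (r k).+1).
Proof.
have [_ _ h1 h2 _] := evs_loop b (st k) (r k) (s k).
have [_ _ rC rD _] := roleN b.
rewrite /ccc /= -/b rC /st (sta_next hq k1) -/b h2 /blocksD /cc /dd /ccc /ff -/b.
have := pwSr (r k) (st k (LD b)); rewrite /pw /= => E.
case: (b) E => /= E; rewrite flatten_cat /= ?cats0 -?catA //.
by congr (_ ++ _); rewrite catA -E -!catA.
Qed.

(** The block [F] occurs once and is the only one not known to be near [w]. It is also the longest,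
    so a broken block costs at most twice its length. *)
Lemma blocks_prefix m i : (i <= size (flatten (blocksD (dd k) (ccc k) (ff k) m)))%N ->
  dev w (take i (flatten (blocksD (dd k) (ccc k) (ff k) m))) <= e * i%:R + 4 * (size (ff k))%:R.
Proof.
move=> hi; have [nd nc] := near_dc k4.
have d0 := sta_pos hq (LD b) k1.
pose good B := (B == dd k) || (B == ccc k).
have hB B : B \in blocksD (dd k) (ccc k) (ff k) m -> [|| B == dd k, B == ccc k | B == ff k].
  by rewrite /blocksD; case: (b); rewrite !(inE, mem_cat, mem_nseq);
    repeat (move=> /orP[]); do ?[case/andP => _]; move=> ->; rewrite ?orbT.
have bad : \sum_(B <- blocksD (dd k) (ccc k) (ff k) m | ~~ good B) (size B)%:R <= (size (ff k))%:R :> R.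
  have gd : good (dd k) by rewrite /good eqxx.
  have gc : good (ccc k) by rewrite /good eqxx orbT.
  have z : \sum_(B <- nseq m (dd k) | ~~ good B) (size B)%:R = 0 :> R.
    by rewrite big_seq_cond big1 // => B /andP[]; rewrite mem_nseq => /andP[_ /eqP ->]; rewrite gd.
  rewrite /blocksD; case: (b); rewrite !(big_cons, big_cat, big_nil) /= z gc /=;
    by case: ifP => _; rewrite ?big_cons ?gc ?big_nil ?add0r ?addr0.
have M0 : 0 <= 2 * (size (ff k))%:R :> R by apply: mulr_ge0.
have := @take_blocks good e (2 * (size (ff k))%:R) _ i e0 _ _ hi M0.
move=> h; apply: le_trans (h _ _) _; last by lra.
  by move=> B _ /orP[] /eqP ->.
move=> B /hB BB j jB.
have sB : (size B <= size (ff k))%N.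
  by case/or3P: BB => /eqP -> //; apply: leq_trans d_f; rewrite leq_pmull.
apply: le_trans (dev_le2 _ sw) _.
have : (size (take j B))%:R <= (size (ff k))%:R :> R.
  by rewrite ler_nat size_take_min geq_min; apply/orP; right.
have : 0 <= e * j%:R by apply: mulr_ge0.
lra.
Qed.

(* The part of [dd k.+1] swept by the orbit segment between two consecutive
   approximations of the generic point. *)
Definition sweep k m := flatten (nseq m (dd k)) ++ flatten [seq st k x | x <- post_word (odd k)].

Section one_sweep.
Variable m : nat.
Hypothesis rm : (r k <= m + 2)%N.

(** By the stopping rule the run of [D] is about [k] times as long as [F]; the factor 2 absorbs the
    small columns and the two copies that may be missing from the sweep. *)
Lemma k_f : (k * size (ff k) <= 2 * (m * size (dd k)))%N.
Proof.
have := good_r (lp_good hq k1); rewrite /r_test -!/(sta q n k) -!/(st k).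
rewrite -/(ccc k) -/(ff k) -/(dd k) mulnDr => h1.
have h2 : (r k * size (dd k) <= (m + 2) * size (dd k))%N by rewrite leq_mul2r rm orbT.
have h3 : (k * (4096 * size (dd k)) <= k * size (ff k))%N by rewrite leq_mul2l d_f orbT.
have h4 : (2 * size (dd k) <= k * size (dd k))%N by rewrite leq_mul2r k1 orbT.
have h5 : (size (ccc k) <= k * size (ccc k))%N by rewrite leq_pmull //; apply: ltnW.
rewrite mulnDl in h2; lia.
Qed.

Lemma sweep_size : (k * size (ff k) <= 2 * size (sweep k m))%N.
Proof.
apply: leq_trans k_f _; rewrite leq_mul2l /sweep size_cat -/(pw m (dd k)) mu_pw ?leq_addr //.
exact: size_cat.
Qed.

Lemma sweep_dev : dev w (sweep k m) <= eps k * (size (sweep k m))%:R + 2 * (size (ff k))%:R.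
Proof.
have [nd nc] := near_dc k4.
have h1 : dev w (pw m (dd k)) <= e * (size (pw m (dd k)))%:R.
  apply: le_trans (dev_pw _ _ _) _; rewrite mu_pw ?natrM; last exact: size_cat.
  by rewrite mulrCA ler_wpM2l.
rewrite /sweep -/(pw m (dd k)) size_cat natrD mulrDr.
apply: le_trans (dev_cat _ _ _) _; rewrite -addrA; apply: lerD => //.
have hf := dev_le2 (ff k) sw.
have ef : 0 <= e * (size (ff k))%:R by apply: mulr_ge0.
have f0 : 0 <= (size (ff k))%:R :> R by [].
move: nc; rewrite /near /ccc /post_word -/b -/e => nc.
have := dev_cat w (ccc k) (ff k); move: hf ef f0; rewrite /ccc /ff -/b.
by case: (b) nc; rewrite /= ?cats0 ?size_cat ?natrD ?mulrDr; lra.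
Qed.

(** The bounds [hd] and [hc] on broken [D] and [C] are to come from the level below. [F], when
    present, stands at the end, where the part already traversed is at least k/2 times as long. *)
Lemma sweep_prefix e1 M i : 0 <= e1 -> 0 <= M ->
  (forall j, (j <= size (dd k))%N -> dev w (take j (dd k)) <= e1 * j%:R + M) ->
  (forall j, (j <= size (ccc k))%N -> dev w (take j (ccc k)) <= e1 * j%:R + M) ->
  (i <= size (sweep k m))%N ->
  dev w (take i (sweep k m)) <= (e + e1 + 4 / k%:R) * i%:R + M.
Proof.
move=> e10 M0 hd hc hi; have [nd nc] := near_dc k4.
pose W1 := flatten (nseq m (dd k) ++ [:: ccc k]).
have kR : 0 < k%:R :> R by rewrite ltr0n; lia.
have main j : (j <= size W1)%N -> dev w (take j W1) <= (e + e1) * j%:R + M.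
  move=> hj; have ee : 0 <= e + e1 by apply: addr_ge0.
  have := @take_blocks predT (e + e1) M _ j ee _ _ hj M0.
  rewrite big_pred0_eq mulr0 addr0; apply=> B; rewrite mem_cat mem_nseq inE.
    move=> h _; apply: (@near_le _ _ e); first by rewrite lerDl.
    by case/orP: h => [/andP[_ /eqP ->]|/eqP ->].
  move=> h l hl; have : 0 <= e * l%:R by apply: mulr_ge0.
  rewrite mulrDl; case/orP: h => [/andP[_ /eqP E]|/eqP E]; rewrite E in hl *.
    by have := hd l hl; lra.
  by have := hc l hl; lra.
have [W2 [E hW2]] : exists W2, sweep k m = W1 ++ W2 /\ (size W2 <= size (ff k))%N.
  exists (if b then [::] else ff k); rewrite /sweep /W1 /post_word -/b /ccc /ff -/b.
  by case: (b); rewrite flatten_cat /= ?cats0 -?catA.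
have k4R : 0 <= 4 / k%:R :> R by rewrite divr_ge0 // ltW.
rewrite E size_cat in hi; rewrite E take_cat [(e + e1 + _) * _]mulrDl.
case: ltnP => iW.
  by have := main i (ltnW iW); have : 0 <= 4 / k%:R * i%:R :> R := mulr_ge0 k4R (ler0n _ _); lra.
apply: le_trans (dev_cat _ _ _) _; have := main _ (leqnn (size W1)); rewrite take_size.
have iWR : (size W1)%:R <= i%:R :> R by rewrite ler_nat.
have h1 : (e + e1) * (size W1)%:R <= (e + e1) * i%:R by apply: ler_wpM2l => //; apply: addr_ge0.
have h2 : dev w (take (i - size W1) W2) <= 2 * (size (ff k))%:R.
  apply: le_trans (dev_take_le2 _ _) _.
  by rewrite ler_pM2l // ler_nat.
have h3 : 2 * (size (ff k))%:R <= 4 / k%:R * i%:R :> R.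
  rewrite mulrAC ler_pdivlMr // -!natrM ler_nat.
  have mW : (m * size (dd k) <= size W1)%N.
    rewrite /W1 flatten_cat size_cat -/(pw m (dd k)) mu_pw ?leq_addr //; exact: size_cat.
  have := k_f; rewrite -mulnA [(size (ff k) * k)%N]mulnC.
  move: (k * _)%N (m * _)%N (size W1) mW iW => x y z; lia.
lra.
Qed.

End one_sweep.
End level.

(** The errors from [U], from the [F] of the first sweep and from a broken block of level [k] amount
    to 7 times the length of [F], hence to at most 14/k times the first sweep; the second sweep adds
    4/k of its own traversed part. *)
Lemma sweeps_prefix k m m' (U : seq 'I_6) N : (4 < k)%N -> (r k <= m + 2)%N ->
  (r k.+1 <= m' + 2)%N -> (size U <= size (dd k))%N ->
  (size (U ++ sweep k m) <= N)%N -> (N <= size ((U ++ sweep k m) ++ sweep k.+1 m'))%N ->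
  dev w (take N ((U ++ sweep k m) ++ sweep k.+1 m')) <=
    (eps k + eps k.+1 + 18 / k%:R) * N%:R.
Proof.
move=> k4 rm rm' hU h1 h2; have k4' := leqW k4.
have kR : 0 < k%:R :> R by rewrite ltr0n; lia.
rewrite take_cat ltnNge h1 /=; set i := (N - _)%N.
have iE : N%:R = (size U)%:R + (size (sweep k m))%:R + i%:R :> R.
  by rewrite -!natrD -size_cat subnKC.
have hi : (i <= size (sweep k.+1 m'))%N by rewrite size_cat in h2; lia.
have M0 : 0 <= 4 * (size (ff k))%:R :> R by apply: mulr_ge0.
have hd j : (j <= size (dd k.+1))%N -> dev w (take j (dd k.+1)) <= eps k * j%:R + 4 * (size (ff k))%:R.
  by rewrite dd_blocks //; apply: blocks_prefix.
have hc j : (j <= size (ccc k.+1))%N -> dev w (take j (ccc k.+1)) <= eps k * j%:R + 4 * (size (ff k))%:R.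
  by rewrite ccc_blocks //; apply: blocks_prefix.
have P1 := sweep_prefix k4' rm' (eps0 k) M0 hd hc hi.
have P2 := sweep_dev k4 m.
have P3 := le_trans (dev_cat w U (sweep k m)) (lerD (dev_le2 U sw) P2).
apply: le_trans (dev_cat _ _ _) _; apply: le_trans (lerD P3 P1) _.
have sF : (k%:R * (size (ff k))%:R <= 2 * (size (sweep k m))%:R :> R).
  by rewrite -!natrM ler_nat; apply: sweep_size.
have F1 : (size (ff k))%:R <= 2 / k%:R * (size (sweep k m))%:R :> R.
  by rewrite mulrAC ler_pdivlMr // mulrC.
have UF : 2 * (size U)%:R <= (size (ff k))%:R :> R.
  rewrite -natrM ler_nat; have k1 : (1 < k)%N by lia.
  have := inv_FD (lp_inv hq k1); rewrite -!/(sta q n k) -!/(st k) -/(dd k) -/(ff k).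
  have : (4096 * size (dd k) <= gap k.-1 * size (dd k))%N by rewrite leq_mul2r gap_ge orbT.
  lia.
have K1 : 4 / k.+1%:R <= 4 / k%:R :> R.
  by apply: ler_wpM2l => //; rewrite lef_pV2 ?posrE // ?ltr0n ?ler_nat.
have K2 : 4 / k.+1%:R * i%:R <= 4 / k%:R * i%:R :> R by apply: ler_wpM2r.
have s0 : 0 <= (size (sweep k m))%:R :> R by [].
have u0 : 0 <= (size U)%:R :> R by [].
have i0 : 0 <= i%:R :> R by [].
have e0 := eps0 k; have e0' := eps0 k.+1.
have ki0 : 0 < k%:R^-1 :> R by rewrite invr_gt0.
rewrite iE; move: K2 P1 P2 P3 F1 => K2 _ _ _ F1.
move: (size _)%:R (size U)%:R i%:R (size (ff k))%:R (k%:R^-1) (eps k) (eps k.+1)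
  (k.+1%:R^-1) s0 u0 i0 e0 e0' ki0 K2 F1 UF => S U' I F K e e' K' s0 u0 i0 e0 e0' ki0 K2 F1 UF.
have := mulr_ge0 e0 u0; have := mulr_ge0 e0' u0; have := mulr_ge0 e0' s0.
have := mulr_ge0 (ltW ki0) u0; have := mulr_ge0 (ltW ki0) s0; have := mulr_ge0 (ltW ki0) i0.
lra.
Qed.

End prefix_deviation.

(** * Nested intervals for the generic point *)

Section typical_point.
Variables (R : realType) (q : nat -> move 6) (n r s : nat -> nat).
Hypothesis hq : loop_path q n r s.
Variable S : nat -> iet R 6.
Hypothesis hS : rauzy_seq S q.
Let Sk k := S (n k).
Let D k := LD (odd k).

Lemma wrd_loop k x : (1 < k)%N ->
  wrd q (n k) (n k.+1 - n k) x = evs letters (loopw (odd k) (r k) (s k)) x.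
Proof. by move=> k1; rewrite (wrd_next hq k1) // subnn. Qed.

(** [step_down] chooses between the first two visits to [D]; they exist because [F] is far longer
    than [D]. *)
Lemma r_gt1 k : (1 < k)%N -> (1 < r k)%N.
Proof.
move=> k1; have := good_r (lp_good hq k1); rewrite /r_test mulnDr.
have := inv_FD (lp_inv hq k1); have := gap_ge k.-1.
have := sta_pos hq (LD (odd k)) k1; rewrite /sta.
move: (size _) (size _) (size _) => c f d d0 g h1 h2.
have h3 : (4096 * d <= gap k.-1 * d)%N by rewrite leq_mul2r g orbT.
have h4 : (c <= k * c)%N by rewrite leq_pmull // ltnW.
have h5 : (f <= k * f)%N by rewrite leq_pmull // ltnW.
have h6 : (d < r k * d)%N by clear -h1 h2 h3 h4 h5 d0; lia.
by move: h6; rewrite -{1}[d]mul1n ltn_mul2r => /andP[].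
Qed.

Lemma itin_nseq (T : iet R 6) x a m : itin T x (nseq m a) <->
  forall i, (i < m)%N -> inI T a (x + i%:R * tau T a).
Proof.
have E i y : y + i.+1%:R * tau T a = y + tau T a + i%:R * tau T a by rewrite -natr1; ring.
elim: m x => [|m IH] x; first by split.
split=> /= [[h /IH hm] [|i]|h]; first by rewrite mul0r addr0.
  by rewrite ltnS => /hm; rewrite E.
split; first by have := h 0%N isT; rewrite mul0r addr0.
apply/IH => i im; have := h i.+1 im.
by rewrite E.
Qed.

Lemma dW_nseq (T : iet R 6) a m : dW T (nseq m a) = m%:R * tau T a.
Proof.
elim: m => [|m IH]; first by rewrite dW_nil mul0r.
by rewrite /= dW_cons IH -natr1 mulrDl mul1r addrC.
Qed.

(** [c] is the displacement from the base of the tower over [D k.+1] to the chosen visit to the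
    interval of [D k], and [m] the number of visits still to come in the run. The strict inequality
    at the right end will keep the limit point inside the half-open intervals. The last clause
    describes the way from this visit to the return. *)
Definition descent k (c : R) m :=
  [/\ (r k <= m + 2)%N, (m < r k)%N,
    left_end (Sk k) (iet_rows (Sk k)).1 (D k) <=
      left_end (Sk k.+1) (iet_rows (Sk k.+1)).1 (D k.+1) + c,
    left_end (Sk k.+1) (iet_rows (Sk k.+1)).1 (D k.+1) + iet_len (Sk k.+1) (D k.+1) + c <
      left_end (Sk k) (iet_rows (Sk k)).1 (D k) + iet_len (Sk k) (D k) &
    forall y, inI (Sk k.+1) (D k.+1) y ->
      let V := nseq m (D k) ++ post_word (odd k) in
      itin (Sk k) (y + c + tau (Sk k) (D k)) V /\
      y + c + tau (Sk k) (D k) + dW (Sk k) V = y + tau (Sk k.+1) (D k.+1)].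

(* The next approximating interval is put inside the first or the second visit
   to [D k] along the run of [D k], according to the direction of the
   translation, so as to stay away from the right end of the current one. *)
Lemma step_down k : (1 < k)%N -> exists c m, descent k c m.
Proof.
move=> k1; have nk := n_lt hq k1.
have nE : (n k + (n k.+1 - n k))%N = n k.+1 by rewrite subnKC // ltnW.
have DE : D k.+1 = LC (odd k) by rewrite /D /=; case: (odd k).
set x := D k.+1; set t := tau (Sk k) (D k); set P := pre_word (odd k).
have hw : wrd q (n k) (n k.+1 - n k) x = P ++ nseq (r k) (D k) ++ post_word (odd k).
  by rewrite wrd_loop // /x DE word_C.
have tE : tau (Sk k.+1) x = dW (Sk k) P + (r k)%:R * t + dW (Sk k) (post_word (odd k)).
  have := dW_wrd hS (n k) (n k.+1 - n k) x; rewrite nE hw => <-.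
  by rewrite !dW_cat dW_nseq addrA.
have hy y : inI (Sk k.+1) x y ->
    (forall i, (i < r k)%N -> inI (Sk k) (D k) (y + dW (Sk k) P + i%:R * t)) /\
    itin (Sk k) (y + dW (Sk k) P + (r k)%:R * t) (post_word (odd k)).
  rewrite /Sk -{1}nE => /(wrd_itin hS); rewrite hw => /itin_cat[_ /itin_cat[/itin_nseq h1]].
  by rewrite dW_nseq.
have xin : inI (Sk k.+1) x (left_end (Sk k.+1) (iet_rows (Sk k.+1)).1 x).
  by rewrite /inI lexx ltrDl iet_len_gt0.
(* With zero translation the point would stay in the interval of [D k], but the letter after the run
   is [C]. *)
have t0 : t != 0.
  apply/eqP => t0; have [h1 h2] := hy _ xin.
  have {h1} := h1 0%N (ltnW (r_gt1 k1)); rewrite t0 !mulr0 in h2 *.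
  have {h2} : inI (Sk k) (LC (odd k)) (left_end (Sk k.+1) (iet_rows (Sk k.+1)).1 x + dW (Sk k) P + 0).
    by move: h2; rewrite /post_word; case: (odd k) => -[].
  by move=> a b; have := inI_inj a b; rewrite /D; case: (odd k).
pose j : nat := (t < 0)%R; have j1 : (j <= 1)%N by rewrite /j; case: (t < 0).
have jr : (j < r k)%N := leq_ltn_trans j1 (r_gt1 k1).
exists (dW (Sk k) P + j%:R * t), (r k - j.+1)%N.
have inD y : inI (Sk k.+1) x y -> inI (Sk k) (D k) (y + (dW (Sk k) P + j%:R * t)).
  by move=> /hy[/(_ j jr)]; rewrite addrA.
have inD' y : inI (Sk k.+1) x y -> inI (Sk k) (D k) (y + (dW (Sk k) P + j%:R * t) + `|t|).
  move=> /hy[h _]; have := h (1 - j)%N (leq_ltn_trans (leq_subr _ _) (r_gt1 k1)).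
  rewrite /j; case: ltrP => ht /=; first by rewrite ltr0_norm // mul1r addrA addrK mul0r addr0.
  by rewrite ger0_norm // mul1r mul0r addr0.
split.
- by move: (r_gt1 k1); lia.
- by move: (r_gt1 k1); lia.
- by case/andP: (inD _ xin).
- have tp : 0 < `|t| by rewrite normr_gt0.
  rewrite ltNge; apply/negP => h; set d := iet_len (Sk k.+1) x in h.
  have d0 : 0 < d := iet_len_gt0 _ _.
  have : inI (Sk k.+1) x (left_end (Sk k.+1) (iet_rows (Sk k.+1)).1 x + Num.max 0 (d - `|t|)).
    by rewrite /inI lerDl le_max lexx /= ltrD2l gt_max d0 gtrBl tp.
  move=> /inD' /andP[_]; have := le_max (d - `|t|) 0 (d - `|t|).
  by rewrite lexx orbT => ?; lra.
move=> y yx V; have [h1 h2] := hy _ yx.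
have e1 : y + (dW (Sk k) P + j%:R * t) + t + (r k - j.+1)%:R * t = y + dW (Sk k) P + (r k)%:R * t.
  by rewrite -[in RHS](subnKC jr) natrD -[j.+1%:R]natr1; ring.
split; last by rewrite tE /V dW_cat dW_nseq addrA e1; ring.
apply/itin_cat; split; last by rewrite dW_nseq e1.
apply/itin_nseq => i ir; have := h1 (j.+1 + i)%N ltac:(lia).
rewrite natrD -[j.+1%:R]natr1; congr (inI _ _ _); rewrite -/t; ring.
Qed.

Let K0 := 5%N.
Let st k := sta q n k.
Let dd k := st k (LD (odd k)).

Lemma size_sweep k m (U : seq 'I_6) : (4 < k)%N -> (m < r k)%N -> (size U <= size (dd k))%N ->
  (size U + size (sweep q n k m) <= size (dd k.+1))%N.
Proof.
move=> k4 mr hU; rewrite /dd /st (dd_blocks hq k4) /sweep /blocksD -/(pw m _).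
have h : (size (pw m (dd k)) + size (dd k) <= size (flatten (nseq (r k) (dd k))))%N.
  by rewrite -/(pw (r k) _) !mu_pw; [rewrite addnC -mulSn leq_mul2r mr orbT|exact: size_cat..].
by move: h hU; rewrite /dd /post_word /st; case: (odd k); rewrite !flatten_cat !size_cat /= ?size_cat /=; lia.
Qed.

(* A typical point lies in the interval of the letter [D k] at every level [k],
   and its orbit shadows all the runs of [D k]. *)
Lemma exists_nested_point : exists (z : R) (m : nat -> nat) (U : nat -> seq 'I_6),
  0 <= z < tot (S 0%N) /\
    forall k, (K0 <= k)%N -> [/\ (r k <= m k + 2)%N, (size (U k) <= size (dd k))%N,
      itin (S 0%N) z (U k) & U k.+1 = U k ++ sweep q n k (m k)].
Proof.
have ex k : exists cm : R * nat, (1 < k)%N -> descent k cm.1 cm.2.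
  have [k1|k1] := ltnP 1 k; last by exists (0, 0%N).
  by have [c [m h]] := step_down k1; exists (c, m).
have [cm hcm] := choice ex; pose m k := (cm k).2; pose c k := (cm k).1.
(* Total displacement from the base of level [K0 + j] to that of level [K0]; thus [z0 - cs j] is the
   base point, at level [K0 + j], of the tower through the limit point [z0]. *)
pose cs j := \sum_(i < j) c (K0 + i)%N.
pose U := fix U k := if k is k'.+1 then
  if (K0 <= k')%N then U k' ++ sweep q n k' (m k') else dd K0 else dd K0.
have US k : (K0 <= k)%N -> U k.+1 = U k ++ sweep q n k (m k) by move=> /= ->.
pose lo j := left_end (Sk (K0 + j)) (iet_rows (Sk (K0 + j))).1 (D (K0 + j)) + cs j.
pose hi j := lo j + iet_len (Sk (K0 + j)) (D (K0 + j)).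
have csS j : cs j.+1 = cs j + c (K0 + j)%N by rewrite /cs big_ord_recr.
have loS j : lo j <= lo j.+1.
  have [_ _ h _ _] := hcm (K0 + j)%N isT.
  by rewrite /lo csS addnS; move: h; rewrite -/(c _); lra.
have hiS j : hi j.+1 < hi j.
  have [_ _ _ h _] := hcm (K0 + j)%N isT.
  by rewrite /hi /lo csS addnS; move: h; rewrite -/(c _); lra.
have lohi j : lo j < hi j by rewrite ltrDl iet_len_gt0.
have lom i j : (i <= j)%N -> lo i <= lo j.
  by move=> ij; rewrite -(subnKC ij); elim: (j - i)%N => [|l IH];
    rewrite ?addn0 // addnS; apply: le_trans (loS _).
have him i j : (i <= j)%N -> hi j <= hi i.
  by move=> ij; rewrite -(subnKC ij); elim: (j - i)%N => [|l IH];
    rewrite ?addn0 // addnS; apply: le_trans (ltW (hiS _)) _.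
have lh i j : lo i < hi j.
  have [ij|/ltnW ij] := leqP i j.
    by apply: le_lt_trans (lom _ _ ij) (lohi j).
  by apply: lt_le_trans (lohi i) (him _ _ ij).
pose z0 := sup (range lo).
have sl : has_sup (range lo).
  split; first by exists (lo 0%N), 0%N.
  by exists (hi 0%N) => _ [i _ <-]; apply: ltW.
have zl j : lo j <= z0 by apply: ub_le_sup; [case: sl|exists j].
have zh j : z0 < hi j.
  apply: le_lt_trans (hiS j); apply: ge_sup; first by case: sl.
  by move=> _ [i _ <-]; apply: ltW.
have zin j : inI (Sk (K0 + j)) (D (K0 + j)) (z0 - cs j).
  by have := zl j; have := zh j; rewrite /inI /hi /lo => ? ?; apply/andP; split; lra.
(* [U] is the remainder of the tower of level [K0 + j] from the floor of [z0] on: after it the orbit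
   is at the first return of the base point. *)
have main j : [/\ (size (U (K0 + j)%N) <= size (dd (K0 + j)))%N,
   itin (S 0%N) z0 (U (K0 + j)%N) &
   z0 + dW (S 0%N) (U (K0 + j)%N) = z0 - cs j + tau (Sk (K0 + j)) (D (K0 + j))].
  elim: j => [|j [IH1 IH2 IH3]].
    have h := zin 0%N; rewrite /cs big_ord0 subr0 addn0 in h *.
    have -> : U K0 = dd K0 by rewrite /U /K0 /=.
    split=> //; first by apply: (wrd_itin hS); exact: h.
    by congr (_ + _); rewrite /dd /st /sta (dW_wrd hS) add0n.
  have [h1 h2 _ _ h] := hcm (K0 + j)%N isT; rewrite addnS US ?leq_addr //.
  have kk : (1 < K0 + j)%N by [].
  have := h (z0 - cs j.+1); rewrite -addnS => /(_ (zin j.+1)) [].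
  rewrite -/(c _) -/(m _) (_ : z0 - cs j.+1 + c (K0 + j)%N = z0 - cs j); last by rewrite csS; ring.
  have sE : sweep q n (K0 + j) (m (K0 + j)%N) =
      exw q (n (K0 + j)) (nseq (m (K0 + j)%N) (D (K0 + j)) ++ post_word (odd (K0 + j))).
    by rewrite exw_cat /sweep /exw map_nseq.
  move=> V1 V2; split.
  - rewrite size_cat; move: h2; rewrite -/(m _) => h2.
    apply: (@size_sweep (K0 + j) (m (K0 + j)%N) _ isT h2 IH1).
  - apply/itin_cat; split=> //; rewrite IH3 sE; exact: (exw_itin hS).
  - by rewrite dW_cat addrA IH3 sE (dW_exw hS) V2 addnS.
exists z0, m, U; split.
  have [_ h _] := main 0%N; rewrite addn0 in h.
  have : (0 < size (U K0))%N by apply: (sta_pos hq).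
  by case: (U K0) h => // a V [/inI_dom].
move=> k kk; have [h1 h2 _] := main (k - K0)%N; rewrite subnKC // in h1 h2.
split=> //; last exact: US.
by have [] := hcm k (leq_trans _ kk).
Qed.

Variable w : 'I_6 -> R.
Hypothesis sw : prob_vec w.
Hypothesis near_dc : forall k, (4 < k)%N ->
  near w (26 / k%:R) (dd k) /\ near w (26 / k%:R) (st k (LC (odd k))).

Lemma exists_typical_point : exists z : R, 0 <= z < tot (S 0%N) /\
  forall a, (fun N : nat => N%:R^-1 * \sum_(i < N)
    ((inI (S 0%N) a (iter i (iet_map (S 0%N)) z))%:R : R)) @ \oo --> w a.
Proof.
have [z [m [U [zd hU]]]] := exists_nested_point; exists z; split=> // a.
have eps0 k : 0 <= 26 / k%:R :> R by apply: divr_ge0.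
have swp k : (K0 <= k)%N -> (0 < size (sweep q n k (m k)))%N.
  move=> kk; rewrite /sweep size_cat addn_gt0; apply/orP; right.
  have k1 : (1 < k)%N := leq_trans (isT : (1 < K0)%N) kk.
  rewrite /post_word; case: (odd k) => /=; rewrite size_cat addn_gt0.
    by rewrite (sta_pos hq).
  by rewrite (sta_pos hq).
have Ulen k : (k <= size (U (K0 + k)%N))%N.
  elim: k => // k IH; have kk : (K0 <= K0 + k)%N by apply: leq_addr.
  have [_ _ _] := hU _ kk; rewrite addnS => ->; rewrite size_cat.
  by have := swp _ kk; lia.
have Umono j k : (K0 <= j)%N -> (j <= k)%N -> (size (U j) <= size (U k))%N.
  move=> Kj jk; rewrite -(subnKC jk); elim: (k - j)%N => [|l IH]; first by rewrite addn0.
  have [_ _ _] := hU (j + l)%N (leq_trans Kj (leq_addr _ _)); rewrite addnS => ->.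
  by rewrite size_cat; apply: leq_trans IH (leq_addr _ _).
apply/cvgrPdist_le => e e0.
(* 70 is 26 + 26 + 18: the constant of [near_dc] at two levels and that of [sweeps_prefix]. *)
pose k1 := (K0 + Num.truncn (70 / e)).+1.
have hk1 : 70 / e < k1%:R.
  apply: lt_le_trans (truncnS_gt _) _; rewrite ler_nat ltnS; exact: leq_addl.
exists (size (U k1.+1)) => // N /= hN.
(* The least such [k] puts time [N] in the sweep of level [k.+1]. *)
have exP : exists k, (K0 <= k)%N && (N < size (U k.+2))%N.
  exists (K0 + N)%N; rewrite leq_addr -!addnS; apply: leq_trans (Ulen _); lia.
case: (ex_minnP exP) => k /andP[Kk Nk] kmin.
have k1k : (k1 <= k)%N.
  rewrite leqNgt; apply/negP => kk1.
  have : (size (U k.+2) <= size (U k1.+1))%N by apply: Umono; rewrite ?ltnS; lia.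
  lia.
have kN : (size (U k.+1) <= N)%N.
  rewrite leqNgt; apply/negP => h; have := kmin k.-1.
  have K1k : (K0 < k)%N by apply: leq_trans k1k; rewrite /k1 ltnS leq_addr.
  rewrite prednK ?(leq_trans _ Kk) // h andbT => h'.
  by have := h' ltac:(lia); lia.
have [rm Ud _ U1] := hU k Kk; have [rm' _ _ U2] := hU k.+1 (leqW Kk).
have [_ _ it _] := hU k.+2 (leqW (leqW Kk)).
have kR : 0 < k%:R :> R by rewrite ltr0n; apply: leq_trans Kk.
have := @sweeps_prefix R q n r s hq w sw (fun k => 26 / k%:R) eps0 near_dc k (m k) (m k.+1) (U k) N
  Kk rm rm' Ud; rewrite -U1 -U2 => /(_ kN (ltnW Nk)).
set V := take N (U k.+2) => hdev.
have sV : size V = N by rewrite size_take Nk.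
have N0 : (0 < N)%N.
  apply: leq_trans kN; rewrite U1 size_cat; apply: leq_trans (swp k Kk) (leq_addl _ _).
have NR : 0 < N%:R :> R by rewrite ltr0n.
have -> : \sum_(i < N) ((inI (S 0%N) a (iter i (iet_map (S 0%N)) z))%:R : R) = (count_mem a V)%:R.
  have itV : itin (S 0%N) z V.
    by move: it; rewrite -{1}(cat_take_drop N (U k.+2)) => /itin_cat[].
  rewrite -sum1_count natr_sum [RHS]big_mkcond [RHS](big_nth a) [RHS]big_mkord sV.
  apply: eq_bigr => i _; have iV : (i < size V)%N by rewrite sV.
  have h := itin_nth a itV iV; rewrite /=; case: eqP => [<-|ne]; first by rewrite h.
  by case: (boolP (inI _ _ _)) => // h'; case: ne; apply: inI_inj h h'.
have hb : `|(count_mem a V)%:R - N%:R * w a| <= dev w V.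
  by rewrite /dev (bigD1 a) //= sV lerDl; apply: sumr_ge0.
rewrite distrC -[w a](mulKf (lt0r_neq0 NR)) -mulrBr normrM ger0_norm ?invr_ge0 ?(ltW NR) //.
rewrite ler_pdivrMl //; apply: le_trans hb (le_trans hdev _).
rewrite mulrC ler_pM2l //.
have kk : 26 / k.+1%:R <= 26 / k%:R :> R.
  by apply: ler_wpM2l => //; rewrite lef_pV2 ?posrE // ?ltr0n ?ler_nat.
apply: (@le_trans _ _ (70 / k%:R)).
  move: kk; rewrite /=; move: (k.+1%:R^-1) (k%:R^-1) => y x; lra.
rewrite ler_pdivrMr // mulrC -ler_pdivrMr //; apply: le_trans (ltW hk1) _.
by rewrite ler_nat.
Qed.

End typical_point.

(** * Visitation simplices *)

Section cones.
Variables (R : realType) (d : nat) (rho : nat -> rows d) (q : nat -> move d).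
Hypothesis hrho : forall n, rauzy_move (rho n) (q n).2 (rho n.+1).
Local Notation lens := (@lens R d q).
Let p m := (q m).2.

Lemma winner_neq_loser n : (q n).2.1 != (q n).2.2.
Proof. by have [] := rauzy_move_perm (hrho n). Qed.

(** [wrd] recurses on the last step; this is the recursion on the first one, where the step matrix
    multiplies from the left. *)
Lemma count_wrdSl n j a y : count_mem y (wrd q n j.+1 a) =
  (count_mem y (wrd q n.+1 j a) +
   (y == (q n).2.1) * count_mem (q n).2.2 (wrd q n.+1 j a))%N.
Proof.
have wl := winner_neq_loser n; elim: j a => [|j IH] a.
  rewrite wrdS addn0; case: (q n) wl => t [w l] /= wl.
  have [->|al] := eqVneq a l; last by rewrite /= !addn0 muln0 addn0.
  by case: t; rewrite /= !addn0 [w == y]eq_sym muln1 // addnC.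
rewrite wrdS [in RHS](wrdS q n.+1 j) addSnnS; case: (q (n + j.+1)%N) => t [w l].
by case: eqP => _ //; case: t; rewrite !count_cat !IH mulnDr; lia.
Qed.

(** [lens] applies the inverse step matrices in turn, so from a column of a visitation matrix it
    leaves the column of the remaining product. *)
Lemma lens_col n j a x : lens (fun b => (count_mem b (wrd q 0 (n + j) a))%:R) n x =
  (count_mem x (wrd q n j a))%:R.
Proof.
elim: n j x => [|n IH] j x //=; have wl := winner_neq_loser n.
have E y : lens (fun b => (count_mem b (wrd q 0 (n.+1 + j) a))%:R) n y =
    (count_mem y (wrd q n j.+1 a))%:R by rewrite addSnnS IH.
rewrite !E !count_wrdSl eqxx [(q n).2.2 == _]eq_sym (negPf wl).
by rewrite mul1n mul0n addn0 natrD addrK; case: eqP => [->|] //; rewrite addn0.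
Qed.

Lemma lens_sum (I : finType) (c : I -> R) (F : I -> 'I_d -> R) n x :
  lens (fun b => \sum_i c i * F i b) n x = \sum_i c i * lens (F i) n x.
Proof.
elim: n x => //= n IH x; rewrite !IH; case: eqP => // _.
by rewrite -sumrB; apply: eq_bigr => i _; rewrite mulrBr.
Qed.

Lemma cvg_lens (U : nat -> 'I_d -> R) u n x : (forall y, U k y @[k --> \oo] --> u y) ->
  lens (U k) n x @[k --> \oo] --> lens u n x.
Proof.
move=> h; elim: n x => //= n IH x; case: eqP => _; last exact: IH.
by apply: cvgB; apply: IH.
Qed.

(** Membership in the cone spanned by the columns of the visitation matrix at time [m]; see
    [visit_simplexE]. *)
Definition nonneg_lens (v : 'I_d -> R) m := forall x, 0 <= lens v m x.

Lemma nonneg_lensS v m : nonneg_lens v m.+1 -> nonneg_lens v m.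
Proof.
move=> h x; have := h x; have := h (q m).2.1; have := h (q m).2.2.
rewrite /= eqxx eq_sym (negPf (winner_neq_loser m)).
case: eqP => [->|] //; lra.
Qed.

Lemma nonneg_lens_le v m m' : (m <= m')%N -> nonneg_lens v m' -> nonneg_lens v m.
Proof.
by move=> mm; rewrite -(subnKC mm); elim: (m' - m)%N => [|l IH];
  rewrite ?addn0 // addnS => /nonneg_lensS.
Qed.

Lemma wrd_gt0 n j a : (0 < size (wrd q n j a))%N.
Proof.
elim: j a => // j IH a; rewrite wrdS; case: (q _) => t [w l].
by case: eqP => // _; case: t; rewrite size_cat addn_gt0 IH.
Qed.

Lemma nonneg_lens_limit (U : nat -> 'I_d -> R) u :
  (forall n, exists N, forall k, (N <= k)%N -> nonneg_lens (U k) n) ->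
  (forall y, U k y @[k --> \oo] --> u y) -> forall n, nonneg_lens u n.
Proof.
move=> hU hu n x; have [N hN] := hU n; rewrite -oppr_le0.
apply: (@le_lim R (fun k => - lens (U k) n x) _ _ N).
  by apply: cvgN; apply: cvg_lens.
by move=> k kN; rewrite oppr_le0; apply: hN.
Qed.

(** The weight of a column is the area of its tower: height times formal length of the base. *)
Lemma average_of_cols v m : \sum_a v a = 1 -> nonneg_lens v m ->
  exists th : 'I_d -> R, [/\ forall a, 0 <= th a, \sum_a th a = 1 &
    forall b, v b = \sum_a th a * ((count_mem b (wrd q 0 m a))%:R / (size (wrd q 0 m a))%:R)].
Proof.
move=> v1 hv; exists (fun a => (size (wrd q 0 m a))%:R * lens v m a).
have E := lens_wrd hrho v 0 m; split.
- by move=> a; apply: mulr_ge0.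
- rewrite -[RHS]v1 [RHS](eq_bigr _ (fun b _ => E b)) exchange_big /=.
  apply: eq_bigr => a _; rewrite -mulr_suml -natr_sum sum_count_mem.
  by rewrite add0n.
move=> b; rewrite -[v b]/(lens v 0 b) E; apply: eq_bigr => a _.
rewrite mulrAC [_%:R * (_ / _)]mulrC divfK // pnatr_eq0 -lt0n; exact: wrd_gt0.
Qed.

(** [lens] inverts the visitation matrix, so the preimage of [V] in the simplex is its vector of
    formal lengths, rescaled to sum 1. *)
Lemma visit_simplexE m (V : 'cV[R]_d) : visit_simplex R p m V <->
  \sum_x V x ord0 = 1 /\ nonneg_lens (fun x => V x ord0) m.
Proof.
have mulE (y : 'cV[R]_d) b : (visit_mx R p m *m y) b ord0 =
    \sum_a (count_mem b (wrd q 0 m a))%:R * y a ord0.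
  by rewrite mxE; apply: eq_bigr => a _; rewrite visit_mxE.
split=> [[y [y0 y1] <-]|[V1 hV]].
  set W := visit_mx R p m *m y.
  have W0 b : 0 <= W b ord0 by rewrite mulE; apply: sumr_ge0 => a _; apply: mulr_ge0.
  have nW : l1norm W = \sum_b W b ord0 by apply: eq_bigr => b _; rewrite ger0_norm.
  have W1 : 1 <= l1norm W.
    rewrite nW (eq_bigr _ (fun b _ => mulE y b)) exchange_big -[leLHS]y1; apply: ler_sum => a _.
    rewrite -mulr_suml -natr_sum sum_count_mem; apply: ler_peMl => //.
    by rewrite ler1n; apply: wrd_gt0.
  have W1' : l1norm W != 0 by apply: lt0r_neq0; lra.
  rewrite /projectivize; split.
    rewrite (eq_bigr (fun b => (l1norm W)^-1 * W b ord0)); last by move=> b _; rewrite mxE.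
    by rewrite -mulr_sumr -nW mulVf.
  move=> x; rewrite (@eq_lens _ _ _ _ (fun b => \sum_a ((l1norm W)^-1 * y a ord0) *
      (count_mem b (wrd q 0 (m + 0) a))%:R)); last first.
    move=> b; rewrite mxE mulE mulr_sumr; apply: eq_bigr => a _; rewrite addn0; ring.
  rewrite lens_sum; apply: sumr_ge0 => a _; rewrite lens_col mulr_ge0 //.
  by apply: mulr_ge0 => //; rewrite invr_ge0; lra.
pose L x := lens (fun x => V x ord0) m x.
have L0 x : 0 <= L x by apply: hV.
have VE b : V b ord0 = \sum_a (count_mem b (wrd q 0 m a))%:R * L a.
  have := lens_wrd hrho (fun x => V x ord0) 0 m b; exact.
have V0 b : 0 <= V b ord0 by rewrite VE; apply: sumr_ge0 => a _; apply: mulr_ge0.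
have c0 : 0 < \sum_a L a.
  rewrite lt0r sumr_ge0 ?andbT //; apply/eqP => /eqP.
  rewrite psumr_eq0 // => /allP h; move: V1; rewrite big1; first by lra.
  move=> b _; rewrite VE big1 // => a _; have := h a (mem_index_enum _) => /= /eqP ->.
  by rewrite mulr0.
set c := \sum_a L a in c0.
exists (c^-1 *: \col_a L a).
  split=> [a|]; first by rewrite !mxE mulr_ge0 // invr_ge0 ltW.
  rewrite (eq_bigr (fun a => c^-1 * L a)); last by move=> a _; rewrite !mxE.
  by rewrite -mulr_sumr mulVf // lt0r_neq0.
have -> : visit_mx R p m *m (c^-1 *: \col_a L a) = c^-1 *: V.
  apply/colP => b; rewrite -scalemxAr !mxE; congr (_ * _); rewrite VE.
  by apply: eq_bigr => a _; rewrite visit_mxE mxE.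
have nE : l1norm (c^-1 *: V) = c^-1.
  rewrite /l1norm (eq_bigr (fun b => c^-1 * V b ord0)).
    by rewrite -mulr_sumr V1 mulr1.
  by move=> b _; rewrite mxE ger0_norm // mulr_ge0 // invr_ge0 ltW.
by rewrite /projectivize nE scalerA invrK divff ?scale1r // lt0r_neq0.
Qed.

End cones.

(** * The limit segment and its extreme points *)

Section limit_segment.
Variables (R : realType) (q : nat -> move 6) (n r s : nat -> nat).
Hypothesis hq : loop_path q n r s.
Variables (rho : nat -> rows 6) (u v : 'I_6 -> R).
Hypothesis hrho : forall m, rauzy_move (rho m) (q m).2 (rho m.+1).
Hypotheses (su : prob_vec u) (sv : prob_vec v).
Local Notation Q := (4^-1 : R).
Hypothesis hu : forall k, (3 < k)%N ->
  dist1 (freqs R (sta q n k lA)) u <= Q ^+ k /\ dist1 (freqs R (sta q n k lB)) u <= Q ^+ k.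
Hypothesis hv : forall k, (3 < k)%N ->
  dist1 (freqs R (sta q n k lE)) v <= Q ^+ k /\ dist1 (freqs R (sta q n k lF)) v <= Q ^+ k.
Local Notation nonneg_lens := (@nonneg_lens R 6 q).

Definition seg t (x : 'I_6) : R := (1 - t) * u x + t * v x.

Lemma mid_seg : mid u v =1 seg 2^-1.
Proof. by move=> x; rewrite /mid /seg; lra. Qed.

Lemma cvg_of_dist1 (U : nat -> 'I_6 -> R) l : (forall e, 0 < e -> exists N, forall m, (N <= m)%N ->
  dist1 (U m) l < e) -> forall x, U m x @[m --> \oo] --> l x.
Proof.
move=> h x; apply/cvgrPdist_lt => e /h[N hN]; exists N => // m /= Nm.
by rewrite distrC; apply: le_lt_trans (le_dist1 _ _ _) (hN m Nm).
Qed.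

(** Columns at later times lie in each fixed cone, and the cones are closed. *)
Lemma nonneg_ends m : nonneg_lens u m /\ nonneg_lens v m.
Proof.
have col a j k : (j <= k)%N -> nonneg_lens (freqs R (wrd q 0 k a)) j.
  move=> jk x; rewrite (@eq_lens _ _ _ _ (fun y => (size (wrd q 0 k a))%:R^-1 *
    (count_mem y (wrd q 0 (j + (k - j)) a))%:R + 0 * 0)); last first.
    by move=> y; rewrite subnKC // mul0r addr0 mulrC.
  rewrite (lens_lin q _ _ _ (fun=> 0)) mul0r addr0 (lens_col R hrho).
  by rewrite mulr_ge0 // invr_ge0.
split.
  apply: (nonneg_lens_limit (U := fun k => freqs R (wrd q 0 k lA))).
    by move=> j; exists j => k; apply: col.
  by apply: cvg_of_dist1 => e /(cvg_dir hq su sv hu hv)[N hN]; exists N => k /hN[].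
apply: (nonneg_lens_limit (U := fun k => freqs R (wrd q 0 k lE))).
  by move=> j; exists j => k; apply: col.
by apply: cvg_of_dist1 => e /(cvg_dir hq su sv hu hv)[N hN]; exists N => k /hN[].
Qed.

Lemma nonneg_seg t m : 0 <= t <= 1 -> nonneg_lens (seg t) m.
Proof.
move=> /andP[t0 t1] x; rewrite lens_lin; have [h1 h2] := nonneg_ends m.
by apply: addr_ge0; apply: mulr_ge0 => //; lra.
Qed.

Lemma seg_sum t : \sum_x seg t x = 1.
Proof.
have [_ u1] := su; have [_ v1] := sv.
by rewrite /seg big_split -!mulr_sumr /= u1 v1; lra.
Qed.

Lemma cvg_mid (e : R) : 0 < e -> exists N, forall k, (N <= k)%N ->
  dist1 (freqs R (sta q n k lC)) (mid u v) < e /\ dist1 (freqs R (sta q n k lD)) (mid u v) < e.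
Proof.
move=> e0; exists (maxn 5 (Num.truncn (26 / e)).+1) => k; rewrite geq_max => /andP[k4 ke].
have [] := near_mid hq su sv hu hv k4; rewrite /= => h1 h2.
have pos x : (0 < size (sta q n k x))%N by apply: (sta_pos hq); lia.
have {}ke : 26 / k%:R < e.
  have k0 : 0 < k%:R :> R by rewrite ltr0n; lia.
  rewrite ltr_pdivrMr // mulrC -ltr_pdivrMr //; apply: lt_le_trans (truncnS_gt _) _.
  by rewrite ler_nat.
move: h1 h2; rewrite /LC /LD; case: (odd k) => /(near_dist1 _ _ (pos _)) h1 /(near_dist1 _ _ (pos _)) h2;
  by split; lra.
Qed.

(** A single time suffices since the cones are nested; it is a loop time because [C] and [D] are
    controlled only there. *)
Lemma cols_near_seg (e : R) : 0 < e -> exists m, forall a, exists2 t, 0 <= t <= 1 &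
  dist1 (freqs R (wrd q 0 m a)) (seg t) < e.
Proof.
move=> e0; have [N1 h1] := cvg_dir hq su sv hu hv e0; have [N2 h2] := cvg_mid e0.
pose k := (maxn N1 N2).+2; exists (n k) => a.
have nk : (N1 <= n k)%N by apply: leq_trans (leq_maxl _ _) (n_ge hq _).
have kN : (N2 <= k)%N by rewrite /k -addn2; apply: leq_trans (leq_maxr N1 N2) (leq_addr _ _).
have [hA hB hE hF] := h1 _ nk; have [hC hD] := h2 _ kN.
have e1 : seg 0 = u by apply/funext => x; rewrite /seg; lra.
have e2 : seg 1 = v by apply/funext => x; rewrite /seg; lra.
have e3 : seg 2^-1 = mid u v by apply/funext => x; rewrite mid_seg.
by apply: (@all_roles false (fun a => exists2 t, 0 <= t <= 1 & dist1 (freqs R (wrd q 0 (n k) a)) (seg t) < e));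
  [exists 0|exists 0|exists 2^-1|exists 2^-1|exists 1|exists 1]; rewrite ?e1 ?e2 ?e3 //; lra.
Qed.

(** A convex combination of columns is near the same combination of nearby segment points, which is
    the segment point with the averaged parameter. *)
Lemma near_seg (e : R) : 0 < e -> exists N, forall m, (N <= m)%N ->
  forall x : 'I_6 -> R, \sum_a x a = 1 -> nonneg_lens x m ->
  exists2 t, 0 <= t <= 1 & forall a, `|x a - seg t a| < e.
Proof.
move=> e0; have [N hN] := cols_near_seg e0; exists N => m Nm x x1 /(nonneg_lens_le hrho Nm) xN.
have [th [th0 th1 xE]] := average_of_cols hrho x1 xN.
have ex a : exists t, 0 <= t <= 1 /\ dist1 (freqs R (wrd q 0 N a)) (seg t) < e.
  by have [t ? ?] := hN a; exists t.
have [t ht] := choice ex.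
exists (\sum_a th a * t a).
  rewrite sumr_ge0 /=; last by move=> a _; apply: mulr_ge0 => //; case: (ht a) => /andP[].
  rewrite -th1; apply: ler_sum => a _; apply: ler_piMr => //.
  by case: (ht a) => /andP[].
move=> b; have -> : seg (\sum_a th a * t a) b = \sum_a th a * seg (t a) b.
  rewrite /seg -{1}th1 -sumrB !mulr_suml -big_split; apply: eq_bigr => a _ /=; ring.
rewrite xE -sumrB; apply: le_lt_trans (ler_norm_sum _ _ _) _.
rewrite (eq_bigr (fun a => th a * `|freqs R (wrd q 0 N a) b - seg (t a) b|)); last first.
  by move=> a _; rewrite -mulrBr normrM ger0_norm.
have lt_e a : `|freqs R (wrd q 0 N a) b - seg (t a) b| < e.
  by apply: le_lt_trans (le_dist1 _ _ _) _; case: (ht a).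
have [a0 tha] : exists a, 0 < th a.
  apply/not_existsP => h; move: th1; rewrite big1; first by lra.
  by move=> a _; have := h a; have := th0 a; rewrite le_eqVlt => /orP[/eqP|].
rewrite -[e]mul1r -th1 mulr_suml (bigD1 a0) //= [ltRHS](bigD1 a0) //=.
apply: ltr_leD; first by rewrite ltr_pM2l.
by apply: ler_sum => a _; apply: ler_wpM2l => //; apply: ltW.
Qed.

Hypothesis uv : u lE < v lE.

(** The parameter is read off the coordinate [E], where the ends differ; the approximations of
    [near_seg] have nearby parameters, and letting the tolerance shrink gives equality in the other
    coordinates. *)
Lemma in_seg (x : 'I_6 -> R) : \sum_a x a = 1 -> (forall m, nonneg_lens x m) ->
  exists2 t, 0 <= t <= 1 & x =1 seg t.
Proof.
move=> x1 xn; set dl := v lE - u lE; have d0 : 0 < dl by rewrite subr_gt0.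
pose t := (x lE - u lE) / dl.
have [u0 u1] := su; have [v0 v1] := sv.
have le1 (y : 'I_6 -> R) : prob_vec y -> forall a, y a <= 1.
  by move=> [y0 <-] a; rewrite (bigD1 a) //= lerDl; apply: sumr_ge0.
have appr (e : R) : 0 < e -> exists2 t', 0 <= t' <= 1 &
    `|t - t'| < e / dl /\ forall a, `|x a - seg t' a| < e.
  move=> e0; have [N /(_ N (leqnn N) x x1 (xn N)) [t' ht hx]] := near_seg e0.
  exists t' => //; split=> //; have := hx lE.
  rewrite ltr_pdivlMr // -[X in _ * X]gtr0_norm // -normrM mulrBl /t divfK ?gt_eqF //.
  by rewrite (_ : x lE - seg t' lE = x lE - u lE - t' * dl) // /seg /dl; ring.
exists t.
  apply/andP; split; rewrite leNgt; apply/negP => h.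
    have [|t' /andP[a b] []] := appr (- t * dl); first by apply: mulr_gt0; lra.
    by rewrite mulfK ?gt_eqF // ltr_norml => /andP[]; lra.
  have [|t' /andP[a b] []] := appr ((t - 1) * dl); first by apply: mulr_gt0; lra.
  by rewrite mulfK ?gt_eqF // ltr_norml => /andP[]; lra.
move=> a; apply/eqP; rewrite -subr_eq0 -normr_le0 leNgt; apply/negP => h.
set z := `|_| in h; have dp : 0 < 1 + dl^-1 by rewrite addr_gt0 // invr_gt0.
(* The tolerance e is chosen so that e, for the coordinate, and e / [dl], for the parameter, add up
   to [z]. *)
have [|t' _ [h1 h2]] := appr (z / (1 + dl^-1)); first by apply: divr_gt0.
have {}h2 := h2 a.
have h3 : `|seg t' a - seg t a| <= `|t - t'|.
  rewrite (_ : seg t' a - seg t a = (t' - t) * (v a - u a)); last by rewrite /seg; ring.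
  rewrite normrM distrC; apply: ler_piMr => //; rewrite ler_norml.
  by have := u0 a; have := v0 a; have := le1 _ su a; have := le1 _ sv a => *; apply/andP; split; lra.
have : z <= `|x a - seg t' a| + `|seg t' a - seg t a|.
  by rewrite /z (_ : x a - seg t a = (x a - seg t' a) + (seg t' a - seg t a)) ?ler_normD //; ring.
have : z / (1 + dl^-1) * (1 + dl^-1) = z by rewrite divfK ?gt_eqF.
rewrite mulrDr mulr1.
lra.
Qed.

Lemma in_cone (x : 'I_6 -> R) : (forall m, nonneg_lens x m) ->
  exists2 t, 0 <= t <= 1 & forall a, x a = (\sum_b x b) * seg t a.
Proof.
move=> xn; have x0 a : 0 <= x a := xn 0%N a.
have [c0|c0] := eqVneq (\sum_b x b) 0.
  exists 0; first by lra.
  move=> a; rewrite c0 mul0r; apply/eqP.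
  by move/eqP: c0; rewrite psumr_eq0 // => /allP/(_ a (mem_index_enum a)).
have cp : 0 < \sum_b x b by rewrite lt0r c0 sumr_ge0.
have [||t t01 E] := @in_seg (fun a => (\sum_b x b)^-1 * x a + 0 * 0).
- rewrite (eq_bigr (fun a => (\sum_b x b)^-1 * x a)); last by move=> a _; rewrite mul0r addr0.
  by rewrite -mulr_sumr mulVf.
- move=> m a; rewrite (lens_lin q _ _ _ (fun=> 0)) mul0r addr0 mulr_ge0 ?invr_ge0 ?(ltW cp) //.
  exact: xn.
by exists t => // a; rewrite -E mul0r addr0 mulVKf.
Qed.

(** Coordinate [E] gives the parameter of the sum as an average of [t1] and [t2]; being 0 or 1 it
    forces both. Products with the weights are compared, as a weight may vanish. *)
Lemma seg_extreme t0 (x1 x2 : 'I_6 -> R) : t0 = 0 \/ t0 = 1 ->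
  (forall m, nonneg_lens x1 m) -> (forall m, nonneg_lens x2 m) ->
  (forall a, x1 a + x2 a = seg t0 a) -> exists c, forall a, x1 a = c * seg t0 a.
Proof.
move=> ht h1 h2 E; have [t1 /andP[t10 t11] E1] := in_cone h1; have [t2 /andP[t20 t21] E2] := in_cone h2.
have c1 : 0 <= \sum_b x1 b by apply: sumr_ge0 => b _; apply: (h1 0%N).
have c2 : 0 <= \sum_b x2 b by apply: sumr_ge0 => b _; apply: (h2 0%N).
have c12 : \sum_b x1 b + \sum_b x2 b = 1.
  by rewrite -big_split -(seg_sum t0); apply: eq_bigr => a _; apply: E.
move: (\sum_b x1 b) (\sum_b x2 b) E1 E2 c1 c2 c12 => a1 a2 E1 E2 p1 p2 a12.
exists a1 => a; rewrite E1.
have et : a1 * t1 + a2 * t2 = t0.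
  have d0 : v lE - u lE != 0 by rewrite gt_eqF // subr_gt0.
  have := E lE; rewrite E1 E2 /seg => h; apply: (mulIf d0).
  have hu1 : (a1 + a2) * u lE = u lE by rewrite a12 mul1r.
  lra.
suff h : a1 * t1 = a1 * t0 by rewrite /seg !mulrDr !mulrA !mulrBr h.
have h3 : 0 <= a1 * t1 by apply: mulr_ge0.
have h4 : 0 <= a2 * t2 by apply: mulr_ge0.
have h5 : 0 <= a1 * (1 - t1) by apply: mulr_ge0 => //; lra.
have h6 : 0 <= a2 * (1 - t2) by apply: mulr_ge0 => //; lra.
move: et h3 h4 h5 h6 a12; rewrite !mulrBr !mulr1; move: (a1 * t1) (a2 * t2) => y1 y2.
case: ht => ->; rewrite ?mulr0 ?mulr1 => *.
  lra.
lra.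
Qed.

End limit_segment.

Lemma ball_colE (R : realType) (d : nat) (u v : 'cV[R]_d) e : 0 < e ->
  (forall x, `|u x ord0 - v x ord0| < e) -> ball u e v.
Proof. by move=> e0 h; split=> // i j; rewrite (ord1 j); apply: h. Qed.

Lemma projectivize_col (R : realType) (q : nat -> move 6) m a :
  projectivize (visit_col R (fun m => (q m).2) a m) = \col_x freqs R (wrd q 0 m a) x.
Proof.
apply/colP => x; rewrite /projectivize l1norm_visit_col visit_colE !mxE mulrC; exact.
Qed.

Lemma cvg_projectivize (R : realType) (q : nat -> move 6) (mm : nat -> nat) a (l : 'I_6 -> R) :
  (forall e, 0 < e -> exists N, forall k, (N <= k)%N -> dist1 (freqs R (wrd q 0 (mm k) a)) l < e) ->
  projectivize (visit_col R (fun m => (q m).2) a (mm k)) @[k --> \oo] --> (\col_x l x : 'cV[R]_6).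
Proof.
move=> h; apply/cvg_ballP => e e0; have [N hN] := h e e0; exists N => // k /= kN.
apply: ball_colE => // x; rewrite projectivize_col !mxE distrC.
exact: le_lt_trans (le_dist1 _ _ _) (hN k kN).
Qed.

Theorem theorem3 (R : realType) :
  exists (a : nat -> R) (T : iet R 6) (p : nat -> 'I_6 * 'I_6)
         (n : nat -> nat),
    [/\ (forall k, 0 < a k),
        minimal T,
        iet_rows T = perm_pi,
        rauzy_path T p &
        alternating_loop_path a p n] /\
    exists u v : 'cV[R]_6,
    [/\ [/\ (forall m, visit_simplex R p m.+1 `<=` visit_simplex R p m),
            simplex u /\ simplex v,
            u <> v,
            hausdorff_cvg (visit_simplex R p) (segment u v) &
            ergodic_vec T u /\ ergodic_vec T v],
        [/\ (projectivize (visit_col R p lA m) @[m --> \oo] --> u),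
            (projectivize (visit_col R p lB m) @[m --> \oo] --> u),
            (projectivize (visit_col R p lE m) @[m --> \oo] --> v) &
            (projectivize (visit_col R p lF m) @[m --> \oo] --> v)] &
        exists w : 'cV[R]_6,
        [/\ open_segment u v w,
            (projectivize (visit_col R p lC (n k)) @[k --> \oo] --> w),
            (projectivize (visit_col R p lD (n k)) @[k --> \oo] --> w) &
            generic_vec T w]].
Proof.
have [q [n [r [s hq]]]] := exists_loop_path.
have [u [v [su sv uv hu hv]]] := exists_limits R hq.
pose rho := rho_of q perm_pi.
have hrho m : rauzy_move (rho m) (q m).2 (rho m.+1) by case: (rho_ofP (lp_walk hq) m).
have htop m : (last (q m).2.1 (rho m).1 == (q m).2.1) = (q m).1.
  by case: (rho_ofP (lp_walk hq) m).
have rho0 : perm_eq (rho 0%N).1 (enum 'I_6) /\ perm_eq (rho 0%N).2 (enum 'I_6).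
  have e6 : enum 'I_6 = [:: lA; lB; lC; lD; lE; lF].
    apply: (inj_map val_inj); rewrite val_enum_ord. by [].
  by rewrite e6.
have hpos := wrd_positive hq; have hgrow := wrd_grow hq.
pose sg := seg u v.
have sg0 : sg 0 = u by apply/funext => x; rewrite /sg /seg; lra.
have sg1 : sg 1 = v by apply/funext => x; rewrite /sg /seg; lra.
have sgm : sg 2^-1 = mid u v by apply/funext => x; rewrite mid_seg.
have sgn t m : 0 <= t <= 1 -> nonneg_lens (R:=R) q (sg t) m.
  exact: (nonneg_seg hq hrho su sv hu hv).
have sgs t : \sum_x sg t x = 1 by apply: seg_sum.
(* This includes the ends: nonnegative along the path and nonzero, they are positive at every level
   and so are length vectors with the same path. *)
have sgp t : 0 <= t <= 1 -> pos_lens (R:=R) q (sg t).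
  move=> ht; apply: (nonneg_pos_lens hrho hpos); first by move=> m; apply: sgn.
  apply/not_existsP => h; have := sgs t; rewrite big1; first by lra.
  by move=> x _; have /negP/negPn/eqP := h x.
have h2 : 0 <= (2^-1 : R) <= 1 by lra.
have [S [hS Sr Sl]] := iet_family rho0 hrho htop (sgp _ h2).
have totS : tot (S 0%N) = 1 by rewrite -(sgs 2^-1); apply: eq_bigr => x _; apply: Sl.
have inv t (ht : 0 <= t <= 1) :=
  exists_invariant rho0 hrho htop hpos hgrow lA (sgp _ h2) hS Sr Sl (sgp t ht) (sgs t).
have [code [cT _]] := family_codes hgrow lA hS Sr.
have mvE (mu : probability (measurableTypeR R) R) t :
    (forall a, fine (mu (Iset (S 0%N) a)) = sg t a) ->
    measure_vec (S 0%N) mu = \col_x sg t x.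
  by move=> h; apply/colP => x; rewrite !mxE -IsetE.
have erg t : t = 0 \/ t = 1 -> ergodic_vec (S 0%N) (\col_x sg t x).
  move=> ht; have t01 : 0 <= t <= 1 by case: ht => ->; lra.
  have [mu [hmu imu]] := inv t t01; exists mu; first exact: mvE.
  apply: (ergodic_of_extreme hS hpos hgrow lA cT imu hmu (sgs t)) => x1 x2 h1' h2' E.
  exact: (seg_extreme hq hrho su sv hu hv uv ht h1' h2' E).
exists (fun k => (a_seq k)%:R), (S 0%N), (fun m => (q m).2), n; split.
  split.
  - by move=> k; rewrite ltr0n /a_seq muln_gt0 !expn_gt0.
  - exact: (rauzy_minimal hS hpos hgrow).
  - exact: Sr.
  - by exists S; split=> // m; case: (hS m).
  - exact: (path_alternating hq R).
exists (\col_x u x), (\col_x v x); split.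
- split.
  + by move=> m V /(visit_simplexE hrho)[h1 h3]; apply/(visit_simplexE hrho);
      split=> //; apply: (nonneg_lensS hrho).
  + have [[u0 u1] [v0 v1]] := (su, sv).
    split; (split; [by move=> i; rewrite mxE|]).
      by rewrite -u1; apply: eq_bigr => x _; rewrite mxE.
    by rewrite -v1; apply: eq_bigr => x _; rewrite mxE.
  + by move/matrixP/(_ lE ord0); rewrite !mxE; lra.
  + have segE t : (1 - t) *: (\col_x u x) + t *: (\col_x v x) = \col_x sg t x :> 'cV[R]_6.
      by apply/colP => x; rewrite !mxE.
    move=> e e0; have [N hN] := near_seg hq hrho su sv hu hv e0.
    exists N => // m /= Nm; split.
      move=> V /(visit_simplexE hrho)[V1 hV].
      have [t ht h] := hN m Nm _ V1 hV.
      exists (\col_x sg t x); first by exists t; [rewrite /= in_itv|exact: segE].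
      by apply: ball_colE => // x; rewrite mxE distrC; apply: h.
    (* The segment lies in every visitation simplex, so its points are their own approximations. *)
    move=> W [t /= ht <-]; rewrite in_itv /= in ht; rewrite segE.
    exists (\col_x sg t x); last exact: ballxx.
    have E : (fun x => (\col_x sg t x : 'cV[R]_6) x ord0) = sg t by apply/funext => x; rewrite mxE.
    by apply/(visit_simplexE hrho); split; [rewrite -[RHS](sgs t)|rewrite E; exact: sgn];
      apply: eq_bigr => x _; rewrite mxE.
  + by rewrite -{1}sg0 -sg1; split; apply: erg; [left|right].
- by split; apply: cvg_projectivize => e /(cvg_dir hq su sv hu hv)[N hN]; exists N => k /hN[].
exists (\col_x sg 2^-1 x); split.
- exists 2^-1; first by rewrite /= in_itv /=; lra.
  by apply/colP => x; rewrite !mxE.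
- by rewrite sgm; apply: cvg_projectivize => e /(cvg_mid hq su sv hu hv)[N hN]; exists N => k /hN[].
- by rewrite sgm; apply: cvg_projectivize => e /(cvg_mid hq su sv hu hv)[N hN]; exists N => k /hN[].
have [mu [hmu imu]] := inv _ h2; exists mu; first exact: mvE.
split=> //; have nm := near_mid hq su sv hu hv.
have [z [zd zf]] := exists_typical_point hq hS (mid_simp su sv) nm.
have lm a : iet_len (S 0%N) a = mid u v a by rewrite Sl -sgm.
exists z; first by rewrite dom_iet.
apply: (generic_of_freq totS zd imu _ cT (T_dense hS hpos hgrow lA)).
  by move=> a; rewrite Sl; apply: hmu.
by move=> a; rewrite lm; apply: zf.
Qed.
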